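(* Let $g\ge2$ and let $$G_g=\{(A_1,\dots,A_{2g})\in (SL_2(\mathbb{R}))^{2g}:\ [A_1,A_2][A_3,A_4]\cdots[A_{2g-1},A_{2g}]=I\}.$$ For $\mathcal{A}=(A_1,\dots,A_{2g})\in G_g$ let $S_{\mathcal{A}}$ be the hyperbolic surface defined by $\mathcal{A}$, and given a word $W$ let $l(W,\mathcal{A})$ be the length of the closed geodesic on $S_{\mathcal{A}}$ in the homotopy class defined by $W$. Then for each $\eta>0$ the following holds for almost all $\mathcal{A}\in G_g$ (among those defining a closed hyperbolic surface): there exists a constant $K=K(\mathcal{A})>0$ such that for each pair of words $W_1,W_2$, either $l(W_1,\mathcal{A})=l(W_2,\mathcal{A})$ or $$|l(W_1,\mathcal{A})-l(W_2,\mathcal{A})|\ \geq\ K\,(4g-1)^{-[(2g+4)(4g-2)+\eta]\,\left(\max(|W_1|,|W_2|)\right)^2}.$$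
   Context: $[A,B]=ABA^{-1}B^{-1}$. A tuple $\mathcal{A}\in G_g$ defines a closed hyperbolic surface $S_{\mathcal{A}}$ of genus $g$ if the homomorphism from the genus $g$ surface group to $PSL_2(\mathbb{R})$ sending the standard generators to the classes of $A_1,\dots,A_{2g}$ is injective with discrete image $\Gamma$; then $S_{\mathcal{A}}=\Gamma\backslash\mathbb{H}^2$. Words $W$ are reduced words in the $2g$ generators and their inverses which represent nontrivial elements of the surface group; $|W|$ is the number of letters of $W$. Evaluating $W$ at $\mathcal{A}$ gives an element of $\Gamma\cong\pi_1(S_{\mathcal{A}})$, hence a free homotopy class of closed curves. ''Almost all'' is with respect to the Lebesgue measure class on the manifold of smooth points of the real algebraic set $G_g$. *)

(* Defs.v *)
From HB Require Import structures.
From mathcomp Require Import all_boot all_order all_algebra.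
From mathcomp Require Import all_classical all_reals all_analysis.
From mathcomp Require mpoly.
From mathcomp Require Import complex.

Set Implicit Arguments.
Unset Strict Implicit.
Unset Printing Implicit Defensive.

Import Order.TTheory GRing.Theory Num.Theory.
Import numFieldNormedType.Exports.

Local Open Scope classical_set_scope.
Local Open Scope ring_scope.

Section AlgebraicSets.
Variables (R : realType) (n : nat).
Implicit Types (V B : set 'rV[R]_n) (x : 'rV[R]_n).

Definition poly_val (f : mpoly.mpoly n R) x : R := mpoly.meval (x 0) f.

Definition vanishes_on V (f : mpoly.mpoly n R) : Prop :=
  forall x, V x -> poly_val f x = 0.

(* The gradients at x of the polynomials in the vanishing ideal I(V) span a
   space of dimension at least r. *)
Definition gradient_rank_ge V x (r : nat) : Prop :=
  exists f : 'I_r -> mpoly.mpoly n R,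
    (forall i, vanishes_on V (f i)) /\
    row_free (\matrix_(i < r, j < n) poly_val (mpoly.mderiv j (f i)) x).

(* Smooth (nonsingular) points: the rank at x of the differentials of the
   elements of I(V) is the largest one attained on V. *)
Definition smooth_point V x : Prop :=
  V x /\ exists r, gradient_rank_ge V x r /\
                   forall y, V y -> ~ gradient_rank_ge V y r.+1.

(* phi, defined on the open set U, is the inverse of a chart of the
   d-dimensional manifold of smooth points of V: an injective C^1 immersion
   that is open as a map into the smooth locus (transition maps between such
   charts are C^1
   diffeomorphisms, so C^1 and C^oo charts give the same null sets). *)
Record local_param V (d : nat) (U : set 'rV[R]_d)
    (phi : 'rV[R]_d -> 'rV[R]_n) : Prop := LocalParam {
  param_open : open U;
  param_inj : {in U &, injective phi};
  param_differentiable : forall u, U u -> differentiable phi u;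
  param_C1 : forall u, U u -> {for u, continuous (jacobian phi)};
  param_immersion : forall u, U u -> row_free (jacobian phi u);
  param_homeo : forall U', open U' -> U' `<=` U ->
    exists2 O, open O & phi @` U' = O `&` smooth_point V }.

End AlgebraicSets.

(* Lebesgue outer measure zero in R^d, by countable covers by boxes. The boxes
   are indexed by a subset D of nat because for d = 0 every box has volume 1,
   so that the empty set must be coverable by an empty family. *)
Definition lebesgue_null (R : realType) (d : nat) (B : set 'rV[R]_d) : Prop :=
  forall e : R, 0 < e -> exists (D : pred nat) (a b : nat -> 'rV[R]_d),
    [/\ forall k i, a k 0 i <= b k 0 i,
        B `<=` \bigcup_(k in [set k | D k])
                 [set u | forall i, a k 0 i <= u 0 i <= b k 0 i] &
        (\sum_(0 <= k <oo | D k) (\prod_(i < d) (b k 0 i - a k 0 i))%:E <= e%:E)%E].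

Definition almost_all_smooth (R : realType) (n : nat) (V : set 'rV[R]_n)
    (P : 'rV[R]_n -> Prop) : Prop :=
  forall (d : nat) (U : set 'rV[R]_d) (phi : 'rV[R]_d -> 'rV[R]_n),
    local_param V U phi -> lebesgue_null [set u | U u /\ ~ P (phi u)].

Lemma odd_gen_subproof (g : nat) (i : 'I_g) : (2 * i < 2 * g)%N.
Proof. by rewrite ltn_pmul2l. Qed.

Lemma even_gen_subproof (g : nat) (i : 'I_g) : ((2 * i).+1 < 2 * g)%N.
Proof. by rewrite !mul2n ltn_Sdouble. Qed.

(* Indices are counted from 0: for i < g, these are the positions of
   A_(2i+1) and A_(2i+2) in (A_1, ..., A_2g). *)
Definition odd_gen g (i : 'I_g) : 'I_(2 * g) := Ordinal (odd_gen_subproof i).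
Definition even_gen g (i : 'I_g) : 'I_(2 * g) := Ordinal (even_gen_subproof i).

(* (i, false) is the i-th generator and (i, true) its inverse. *)
Definition letter (g : nat) : Type := ('I_(2 * g) * bool)%type.
Definition word (g : nat) : Type := seq (letter g).

Definition inv_letter g (s : letter g) : letter g := (s.1, ~~ s.2).

Definition reduced g (w : word g) : bool :=
  sorted (fun s t : letter g => t != inv_letter s) w.

Definition relator (g : nat) : word g :=
  flatten [seq [:: (odd_gen i, false); (even_gen i, false);
                   (odd_gen i, true); (even_gen i, true)] | i <- enum 'I_g].

(* Equality in the surface group
   < a_1, ..., a_2g | [a_1, a_2] ... [a_(2g-1), a_2g] >. *)
Inductive surface_eq (g : nat) : word g -> word g -> Prop :=
| SurfaceRefl w : surface_eq w w
| SurfaceSym w1 w2 : surface_eq w1 w2 -> surface_eq w2 w1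
| SurfaceTrans w1 w2 w3 :
    surface_eq w1 w2 -> surface_eq w2 w3 -> surface_eq w1 w3
| SurfaceCancel u s v : surface_eq (u ++ [:: s; inv_letter s] ++ v) (u ++ v)
| SurfaceRelator u v : surface_eq (u ++ relator g ++ v) (u ++ v).

Definition admissible_word g (w : word g) : Prop :=
  reduced w /\ ~ surface_eq w [::].

(* (M_2(R))^(2g), identified with R^(8g) *)
Notation tuple_space R g := 'rV[R]_(2 * g * (2 * 2)).

Section Representations.
Variables (R : realType) (g : nat).
Implicit Types (A : tuple_space R g) (w : word g).

Definition tuple_entry A (i : 'I_(2 * g)) : 'M[R]_2 :=
  vec_mx (row i (vec_mx A)).

Definition commutator_mx (M N : 'M[R]_2) : 'M[R]_2 := M * N * M^-1 * N^-1.

Definition G_set : set (tuple_space R g) :=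
  [set A | (forall i, \det (tuple_entry A i) = 1) /\
           \prod_(i < g) commutator_mx (tuple_entry A (odd_gen i))
                                       (tuple_entry A (even_gen i)) = 1].

Definition eval_letter A (s : letter g) : 'M[R]_2 :=
  if s.2 then (tuple_entry A s.1)^-1 else tuple_entry A s.1.

Definition eval_word A w : 'M[R]_2 := \prod_(s <- w) eval_letter A s.

(* Equality of the classes in PSL_2(R) *)
Definition psl_eq (M N : 'M[R]_2) : Prop := M = N \/ M = - N.

(* The preimage in SL_2(R) of the image in PSL_2(R) of the surface group;
   SL_2(R) -> PSL_2(R) being a two-fold covering, one is discrete exactly
   when the other is. *)
Definition Gamma A : set 'M[R]_2 :=
  [set M | exists w, psl_eq M (eval_word A w)].

Definition defines_closed_surface A : Prop :=
  (forall w1 w2, psl_eq (eval_word A w1) (eval_word A w2) ->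
                 surface_eq w1 w2) /\
  Gamma A `<=` isolated (Gamma A).

End Representations.

Section Surface.
Variable R : realType.
Local Open Scope complex_scope.
Local Notation C := (R[i]).
Implicit Types (z w : C).

Definition half_plane : set C := [set z | 0 < complex.Im z].

Definition arcosh (u : R) : R := ln (u + Num.sqrt (u ^+ 2 - 1)).

Definition hyp_dist z w : R :=
  arcosh (1 + (complex.Re (z - w) ^+ 2 + complex.Im (z - w) ^+ 2) /
              (2 * complex.Im z * complex.Im w)).

Definition moebius (M : 'M[R]_2) z : C :=
  ((M 0 0)%:C * z + (M 0 1)%:C) / ((M 1 0)%:C * z + (M 1 1)%:C).

Variable g : nat.
Implicit Types (A : tuple_space R g).

(* The points of the surface are the orbits, as subsets of the half-plane. *)
Definition orbit_of A z : set C := [set moebius M z | M in Gamma A].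

Definition surface A : set (set C) := [set orbit_of A z | z in half_plane].

Definition surface_dist (p q : set C) : R :=
  inf [set hyp_dist z w | z in p & w in q].

(* c is a closed geodesic of length l on the surface: an l-periodic, locally
   distance-realizing curve parametrized by arc length. *)
Definition closed_geodesic A (l : R) (c : R -> set C) : Prop :=
  [/\ 0 < l,
      forall t, surface A (c t),
      forall t, c (t + l) = c t &
      forall t, exists2 e, 0 < e & forall s s',
        `|s - t| < e -> `|s' - t| < e ->
        surface_dist (c s) (c s') = `|s - s'|].

(* The l-periodic closed curve c is in the free homotopy class of the deck
   transformation M in Gamma, under the identification of Gamma with the
   fundamental group: some lift of c to the half-plane is translated by M.
   (Changing the lift replaces M by its conjugates.) *)
Definition in_homotopy_class A (M : 'M[R]_2) (l : R) (c : R -> set C) : Prop :=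
  exists lift : R -> C,
    [/\ continuous (fun t => complex.Re (lift t)) /\
          continuous (fun t => complex.Im (lift t)),
        forall t, half_plane (lift t),
        forall t, c t = orbit_of A (lift t) &
        forall t, lift (t + l) = moebius M (lift t)].

Definition is_geodesic_length A (W : word g) (l : R) : Prop :=
  exists2 c, closed_geodesic A l c & in_homotopy_class A (eval_word A W) l c.

End Surface.

(* Main.v *)
Require Import Defs.
From mathcomp Require Import all_boot all_order all_algebra fingroup perm.
From mathcomp Require Import all_classical all_reals all_analysis.
From mathcomp Require mpoly.
From mathcomp Require Import complex.
From mathcomp Require Import zify ring lra.

(* Conjugate the tuple by an integral unipotent matrix so that suitable (0, 1)
   entries do not vanish. Then G_g is parametrized near the tuple, up to scaling
   each matrix, by integer polynomials in N = 6g - 3 coordinates: A_3, ..., A_2g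
   are free, and with C = [A_3, A_4] ... the relation amounts to the conditions
   tr (C A_1) = tr A_1 and C A_1 A_2 = A_2 A_1, linear in A_1 and then in A_2.
   Up to a factor exponential in m, the number tr(W1)^2 - tr(W2)^2 is the value
   of an integer polynomial of degree at most 16 m in each coordinate, where
   m = max(|W1|, |W2|). A nonzero integer polynomial of degree at most D in each
   variable is smaller than 2^-(D J) only on a proportion (7 D (J + 1))^N 2^-J
   of the unit cube. There are at most (4g + 1)^(2 m) pairs of words of length
   at most m, exponentially fewer than (4g - 1)^(3 m); hence, by Borel-Cantelli
   with 2^J about (4g - 1)^(3 m), for almost all coordinates every nonzero gap
   is at least (4g - 1)^(- 48 m^2), up to factors exponential in m.

   Null sets of coordinates pull back to null sets of parameters of the manifold
   of smooth points, without the inverse function theorem: the coordinates have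
   a locally Lipschitz right inverse with values in G_g.

   Finally, 48 <= (2g + 4) (4g - 2), the factors exponential in m are absorbed
   by eta, and tr(W)^2 = e^l + e^-l + 2: along the lift of a closed geodesic, the
   form attached to a point of the half-plane satisfies
   f(t + a) + f(t - a) = 2 cosh(a) f(t), hence equals e^t P + e^-t Q, and P is
   the square of an eigenvector of W of eigenvalue +- e^(l/2). *)

Set Implicit Arguments.
Unset Strict Implicit.
Unset Printing Implicit Defensive.

Import Order.TTheory GRing.Theory Num.Theory.
Import numFieldNormedType.Exports.

Local Open Scope classical_set_scope.
Local Open Scope ring_scope.

(** * Integer polynomials with small values on grids *)

(** The exponent is quadratic in [m] because a degree linear in [m] meets a number [J] of binary
    digits linear in [m]. The constant leaves no room at the lowest genus: [16 * 3 = 48] equals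
    [(2g + 4) (4g - 2)] when [g = 2]. Degrees are therefore measured in each coordinate separately,
    where they stay below 4 per letter whatever the genus, and sublevel sets are counted one
    variable at a time. That induction ends at a nonzero integer, of absolute value at least 1: this
    is where integrality of the coefficients enters. Traces are squared and balanced by determinants
    because the coordinates know each matrix only up to a scalar. The null sets live in charts of
    the smooth locus of which nothing is given beyond [local_param]; the dimension [d] of a chart is
    not known beforehand. Two facts suffice, and both come from the Lipschitz right inverse: the map
    from chart to coordinates expands distances up to a constant, and [N <= d]. The unipotent
    conjugation depends on the tuple, but only through a natural number [k], so that countably many
    coordinate systems cover all tuples. *)

Fixpoint ipoly (n : nat) : idomainType :=
  if n is n'.+1 then {poly (ipoly n')} else int.

Fixpoint ipoly_eval (R : comNzRingType) n (y : nat -> R) :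
    {rmorphism ipoly n -> R} :=
  if n is n'.+1 return {rmorphism ipoly n -> R} then
    GRing.RMorphism.clone _ _
      (horner_eval (y 0%N) \o map_poly (ipoly_eval n' (fun i => y i.+1))) _
  else GRing.RMorphism.clone _ _ (intmul (1 : R)) _.

(** One bound per variable, variable 0 being the outermost. A uniform bound would add up along the
    product of commutators and grow with the genus. *)
Fixpoint ipoly_mdeg_le n (D : nat -> nat) : ipoly n -> Prop :=
  if n is n'.+1 return ipoly n -> Prop then
    fun p => (size p <= (D 0%N).+1)%N /\
             forall i, ipoly_mdeg_le (fun j => D j.+1) p`_i
  else fun _ => True.

Notation ipoly_deg_le D := (ipoly_mdeg_le (fun _ => D)).

Fixpoint ipoly_var n (i : nat) : ipoly n :=
  match n, i with
  | n'.+1, 0%N => 'X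
  | n'.+1, i'.+1 => (ipoly_var n' i')%:P
  | 0%N, _ => 0
  end.

Lemma ipoly_eval_S (R : comNzRingType) n (y : nat -> R) (p : ipoly n.+1) :
  ipoly_eval n.+1 y p =
  (map_poly (ipoly_eval n (fun i => y i.+1)) p).[y 0%N].
Proof. by []. Qed.

Lemma ipoly_eval_var (R : comNzRingType) n (y : nat -> R) i : (i < n)%N ->
  ipoly_eval n y (ipoly_var n i) = y i.
Proof.
elim: n y i => [//|n IH] y [|i] lt_in; rewrite ipoly_eval_S /=.
  by rewrite map_polyX hornerX.
by rewrite map_polyC hornerC; exact: (IH (fun i => y i.+1)).
Qed.

Section DegLe.
Variable n : nat.
Implicit Types (D E : nat -> nat) (p q : ipoly n).

Lemma ipoly_mdeg_le0 D : @ipoly_mdeg_le n D 0.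
Proof.
elim: n D => [//|k IH] D /=; split; first by rewrite size_poly0.
by move=> i; rewrite coef0.
Qed.

Lemma ipoly_mdeg_leW D E p : (forall i, (D i <= E i)%N) ->
  ipoly_mdeg_le D p -> ipoly_mdeg_le E p.
Proof.
elim: n D E p => [//|k IH] D E p leDE /= [sp cp]; split.
  by apply: leq_trans sp _; rewrite ltnS.
by move=> i; apply: IH (cp i) => j; exact: leDE.
Qed.

Lemma ipoly_mdeg_leD D p q :
  ipoly_mdeg_le D p -> ipoly_mdeg_le D q -> ipoly_mdeg_le D (p + q).
Proof.
elim: n D p q => [//|k IH] D p q /= [sp cp] [sq cq]; split.
  by apply: leq_trans (size_polyD _ _) _; rewrite geq_max sp.
by move=> i; rewrite coefD; exact: IH.
Qed.

Lemma ipoly_mdeg_leN D p : ipoly_mdeg_le D p -> ipoly_mdeg_le D (- p).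
Proof.
elim: n D p => [//|k IH] D p /= [sp cp]; split; first by rewrite size_polyN.
by move=> i; rewrite coefN; exact: IH.
Qed.

Lemma ipoly_mdeg_leB D p q :
  ipoly_mdeg_le D p -> ipoly_mdeg_le D q -> ipoly_mdeg_le D (p - q).
Proof. by move=> dp dq; apply: ipoly_mdeg_leD => //; exact: ipoly_mdeg_leN. Qed.

End DegLe.

Lemma ipoly_mdeg_le_sum n D (I : Type) (s : seq I) (P : pred I)
    (F : I -> ipoly n) :
  (forall i, P i -> ipoly_mdeg_le D (F i)) ->
  ipoly_mdeg_le D (\sum_(i <- s | P i) F i).
Proof.
move=> H; elim/big_ind: _ => //; first exact: ipoly_mdeg_le0.
by move=> *; exact: ipoly_mdeg_leD.
Qed.

Lemma ipoly_mdeg_leM n D E (p q : ipoly n) :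
  ipoly_mdeg_le D p -> ipoly_mdeg_le E q ->
  ipoly_mdeg_le (fun i => D i + E i)%N (p * q).
Proof.
elim: n D E p q => [//|k IH] D E p q /= [sp cp] [sq cq]; split.
  apply: leq_trans (size_polyMleq _ _) _; have := leq_add sp sq.
  by rewrite addSn addnS; case: addn.
by move=> i; rewrite coefM; apply: ipoly_mdeg_le_sum => j _; exact: IH.
Qed.

Lemma ipoly_mdeg_le1 n D : @ipoly_mdeg_le n D 1.
Proof.
elim: n D => [//|k IH] D /=; split; first by rewrite size_poly1.
move=> i; rewrite coef1; case: (i == 0)%N => //; exact: ipoly_mdeg_le0.
Qed.

Lemma ipoly_mdeg_le_var n i : @ipoly_mdeg_le n (fun j => j == i) (ipoly_var n i).
Proof.
elim: n i => [//|k IH] [|i] /=; split.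
- by rewrite size_polyX.
- move=> j; rewrite coefX; case: (j == 1)%N;
    [exact: ipoly_mdeg_le1|exact: ipoly_mdeg_le0].
- by apply: leq_trans (size_polyC_leq1 _) _.
- move=> j; rewrite coefC; case: (j == 0)%N; last exact: ipoly_mdeg_le0.
  by apply: ipoly_mdeg_leW (IH i).
Qed.

(** By Lagrange interpolation the leading coefficient is the sum of the
    [p(x_i) / prod_(j != i) (x_i - x_j)], and every denominator is at least [del ^ d] in absolute
    value. *)
Lemma lead_coef_interpolation_le (R : realFieldType) (p : {poly R}) (d : nat)
    (x : nat -> R) (del eps : R) :
  size p = d.+1 -> 0 < del ->
  (forall i j, (i < j <= d)%N -> del <= x j - x i) ->
  (forall i, (i <= d)%N -> `|p.[x i]| <= eps) ->
  `|lead_coef p| * del ^+ d <= d.+1%:R * eps.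
Proof.
move=> sp del0 xdel xp.
have xdist i j : (i <= d)%N -> (j <= d)%N -> i != j -> del <= `|x i - x j|.
  move=> id jd; rewrite neq_ltn => /orP[lij|lji].
    by rewrite distrC; apply: le_trans (ler_norm _); apply: xdel; rewrite lij.
  by apply: le_trans (ler_norm _); apply: xdel; rewrite lji.
have xneq i j : (i <= d)%N -> (j <= d)%N -> i != j -> x i - x j != 0.
  by move=> id jd /(xdist _ _ id jd) h; rewrite -normr_gt0; exact: lt_le_trans h.
pose num (i : 'I_d.+1) : {poly R} := \prod_(j < d.+1 | j != i) ('X - (x j)%:P).
pose den (i : 'I_d.+1) := \prod_(j < d.+1 | j != i) (x i - x j).
have den0 i : den i != 0.
  by apply/prodf_neq0 => j ji; apply: xneq; rewrite ?leq_ord // eq_sym.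
have cardi (i : 'I_d.+1) : #|[pred j | j != i]| = d.
  by have := cardC1 i; rewrite card_ord.
have snum i : size (num i) = d.+1.
  rewrite /num -big_filter size_prod_XsubC.
  congr _.+1; by rewrite -sum1_size big_filter sum1_card cardi.
have numi (i j : 'I_d.+1) : (num i).[x j] = if j == i then den i else 0.
  rewrite /num horner_prod; case: eqP => [->|/eqP ji].
    by apply: eq_bigr => k _; rewrite hornerXsubC.
  by rewrite (bigD1 j) //= hornerXsubC subrr mul0r.
pose q := p - \sum_(i < d.+1) (p.[x i] / den i) *: num i.
(* [q] has degree at most [d] and vanishes at the [d + 1] nodes. *)
have q0 : q = 0.
  apply: (@roots_geq_poly_eq0 _ q [seq x (i : 'I__) | i : 'I_d.+1]).
  - apply/allP => y /mapP[j _ ->]; rewrite /root /q hornerD hornerN horner_sum.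
    rewrite (bigD1 j) //= hornerZ numi eqxx divfK // big1 ?addr0 ?subrr //.
    by move=> i ij; rewrite hornerZ numi eq_sym (negbTE ij) mulr0.
  - rewrite map_inj_uniq ?enum_uniq // => i j eij; apply/eqP.
    apply: contraT => ij.
    have := xneq i j (leq_ord i) (leq_ord j) ij.
    by rewrite eij subrr eqxx.
  - rewrite size_map -cardE card_ord /q.
    apply: leq_trans (size_polyD _ _) _; rewrite geq_max sp leqnn size_polyN /=.
    apply: leq_trans (size_sum _ _ _) _; apply/bigmax_leqP => i _.
    by apply: leq_trans (size_scale_leq _ _) _; rewrite snum.
have lc : lead_coef p = \sum_(i < d.+1) p.[x i] / den i.
  rewrite /lead_coef sp /=; move/eqP: q0; rewrite subr_eq0 => /eqP {1}->.
  rewrite coef_sum; apply: eq_bigr => i _; rewrite coefZ.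
  have : lead_coef (num i) = 1 by rewrite lead_coef_prod big1 // => j _; rewrite lead_coefXsubC.
  by rewrite /lead_coef snum /= => ->; rewrite mulr1.
have denge i : del ^+ d <= `|den i|.
  rewrite /den normr_prod -[X in del ^+ X](cardi i) -prodr_const.
  apply: ler_prod => j ji; rewrite ltW //=.
  by apply: xdist; rewrite ?leq_ord // eq_sym.
rewrite lc; apply: (@le_trans _ _ ((\sum_(i < d.+1) eps / del ^+ d) * del ^+ d)).
  apply: ler_wpM2r; first by rewrite exprn_ge0 // ltW.
  apply: le_trans (ler_norm_sum _ _ _) _; apply: ler_sum => i _.
  rewrite normrM normfV; apply: ler_pM; rewrite ?invr_ge0 //.
    by apply: xp; rewrite leq_ord.
  by rewrite lef_pV2 ?denge // posrE ?exprn_gt0 // normr_gt0.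
rewrite sumr_const card_ord -[_ *+ _]mulr_natl -mulrA divfK //.
by rewrite expf_neq0 // gt_eqF.
Qed.

Lemma sorted_ltn_nth_gap (s : seq nat) a b : sorted ltn s ->
  (a <= b < size s)%N -> (nth 0 s a + (b - a) <= nth 0 s b)%N.
Proof.
move=> ss /andP[ab]; rewrite -(subnKC ab); elim: (b - a)%N => [|k IH] bs.
  by rewrite addn0 subnn addn0.
have lt1 : (nth 0 s (a + k) < nth 0 s (a + k.+1))%N.
  by apply: (sorted_ltn_nth ltn_trans) => //; rewrite ?inE; lia.
have := IH ltac:(lia); lia.
Qed.

(** Many sublevel points on a grid of mesh [1 / n] contain [d + 1] points that are far apart: every
    [q]-th one, at mutual distance at least [q / n]. Interpolation at these, with [d + 1 <= 2 ^ d],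
    gives [q * 2 ^ (J - i) <= 2 n]. *)
Lemma sublevel_grid_count (R : realFieldType) (p : {poly R}) (o : R)
    (D i J n : nat) :
  (0 < D)%N -> (size p <= D.+1)%N -> (i <= J)%N -> (2 ^ J <= n)%N ->
  2 ^- (D * i) < `|lead_coef p| ->
  (#|[pred k : 'I_n | (`|p.[o + k%:R / n%:R]| <= 2 ^- (D * J))%R]| * 2 ^ (J - i)
     <= 3 * D * n)%N.
Proof.
move=> D0 sp iJ nJ lc.
have n0 : (0 < n)%N by apply: leq_trans nJ; rewrite expn_gt0.
pose Q k := `|p.[o + k%:R / n%:R]| <= 2 ^- (D * J).
pose s := [seq k <- iota 0 n | Q k].
have -> : #|[pred k : 'I_n | Q k]| = size s.
  rewrite -sum1_card -sum1_size /s big_filter.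
  by rewrite -(big_mkord Q (fun _ => 1%N)) /index_iota subn0.
have ss : sorted ltn s by apply: (sorted_filter ltn_trans); exact: iota_ltn_sorted.
have pos2 m : 0 < 2 ^+ m :> R by rewrite exprn_gt0.
have p0 : p != 0.
  by rewrite -lead_coef_eq0 -normr_gt0; apply: lt_trans lc; rewrite invr_gt0.
have leq2J : (2 ^ (J - i) <= n)%N.
  by apply: leq_trans nJ; rewrite leq_exp2l // leq_subr.
case: (posnP (size s)) => [->//|K0].
have Qnth a : (a < size s)%N -> Q (nth 0 s a).
  by move=> /(mem_nth 0%N); rewrite mem_filter => /andP[].
have [d spd] : exists d, size p = d.+1.
  by exists (size p).-1; rewrite prednK // lt0n size_poly_eq0.
have dD : (d <= D)%N by rewrite -ltnS -spd.
case: (posnP d) => d0.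
  have pc : p = (lead_coef p)%:P.
    have/size1_polyC h : (size p <= 1)%N by rewrite spd d0.
    by rewrite [LHS]h lead_coefE spd d0.
  have := Qnth 0%N K0; rewrite /Q pc hornerC leNgt => /negP[].
  apply: le_lt_trans lc; rewrite lef_pV2 ?posrE // ler_eXn2l ?ltr1n //.
  by rewrite leq_mul2l iJ orbT.
(* The largest step for which the [d + 1] indices [0, q, ..., d q] all stay below [size s]. *)
pose q := ((size s).-1 %/ d)%N.
have sdq : (size s <= d * q.+1)%N.
  by have := ltn_ceil (size s).-1 d0; rewrite mulnC -/q; lia.
have dq : (d * q < size s)%N.
  by have := leq_trunc_div (size s).-1 d; rewrite -/q mulnC; lia.
have q2 : (q * 2 ^ (J - i) <= 2 * n)%N.
  case: (posnP q) => [->//|q0].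
  pose x a := o + (nth 0 s (a * q))%:R / n%:R.
  have nR : 0 < n%:R :> R by rewrite ltr0n.
  have H : `|lead_coef p| * (q%:R / n%:R) ^+ d <= d.+1%:R * 2 ^- (D * J).
    apply: (@lead_coef_interpolation_le _ p d x) => // [|a b /andP[ab bd]|a ad].
    - by rewrite divr_gt0 // ltr0n.
    - rewrite /x opprD addrACA subrr add0r -mulrBl ler_pM2r ?invr_gt0 //.
      have h : ((nth 0 s (a * q)) + q <= (nth 0 s (b * q)))%N.
        have bq : (b * q <= d * q)%N by rewrite leq_mul2r bd orbT.
        have abq : (a * q + q <= b * q)%N by rewrite -mulSnr leq_mul2r ab orbT.
        by have := @sorted_ltn_nth_gap s (a * q) (b * q) ss ltac:(lia); lia.
      by rewrite lerBrDl -natrD ler_nat.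
    - apply: (Qnth (a * q)%N); apply: leq_ltn_trans dq.
      by rewrite leq_mul2r ad orbT.
  have h1 : 2 ^- (D * i) * (q%:R / n%:R) ^+ d <= 2 ^+ d * 2 ^- (D * J) :> R.
    apply: le_trans (le_trans H _).
      by apply: ler_wpM2r; [rewrite exprn_ge0 // divr_ge0|exact: ltW].
    apply: ler_wpM2r; first by rewrite invr_ge0 ltW.
    by rewrite -natrX ler_nat ltn_expl.
  have h2 : (q%:R / n%:R) ^+ d * (2 ^+ (J - i)) ^+ d <= 2 ^+ d :> R.
    rewrite -(@ler_pM2l _ (2 ^- (D * i))) ?invr_gt0 // mulrA.
    apply: le_trans (ler_wpM2r _ h1) _; first by rewrite exprn_ge0 // ltW.
    rewrite [X in _ <= X]mulrC -mulrA ler_pM2l // mulrC.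
    rewrite ler_pdivrMr // mulrC ler_pdivlMr // -exprM -exprD.
    rewrite ler_eXn2l ?ltr1n // addnC.
    have -> : (D * J = (J - i) * D + D * i)%N.
      by rewrite [X in (X + _)%N]mulnC -mulnDr subnK.
    by rewrite addnC leq_add2r leq_mul2l dD orbT.
  rewrite -exprMn ler_pXn2r ?nnegrE // in h2.
  by rewrite mulrAC ler_pdivrMr // -natrX -!natrM ler_nat in h2.
apply: leq_trans (leq_mul sdq (leqnn _)) _.
rewrite -mulnA mulSnr -[X in (_ <= X)%N]mulnA mulnCA.
apply: leq_mul dD _.
rewrite addnC; apply: leq_trans (leq_add leq2J q2) _; lia.
Qed.

Fixpoint grid (n N : nat) : finType :=
  if N is N'.+1 then ('I_n * grid n N')%type else unit.

Lemma card_grid n N : #|grid n N| = (n ^ N)%N.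
Proof.
elim: N => [|N IH] /=; first by rewrite card_unit.
by rewrite card_prod card_ord IH expnS.
Qed.

Fixpoint grid_point (R : realFieldType) (n N : nat) (o : nat -> R) :
    grid n N -> nat -> R :=
  if N is N'.+1 return grid n N -> nat -> R then
    fun t i => if i is i'.+1 then grid_point (fun j => o j.+1) t.2 i'
               else o 0%N + t.1%:R / n%:R
  else fun _ => o.

Definition small_grid (R : realFieldType) (D J n N : nat) (o : nat -> R)
    (f : ipoly N) : {set grid n N} :=
  [set t | `|ipoly_eval N (grid_point o t) f| <= 2 ^- (D * J)].

(* Induction on N: for each value of the last N variables, let i be least such
   that the leading coefficient in the first variable is larger than 2^-(D i)
   there; Lagrange interpolation then bounds the number of values of the first
   variable, and the induction hypothesis the number of points with given i. *)
Lemma card_small_grid (R : realFieldType) (D J n N : nat) (o : nat -> R)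
    (f : ipoly N) :
  (0 < D)%N -> (2 ^ J <= n)%N -> f != 0 -> ipoly_deg_le D f ->
  (#|small_grid D J n o f| * 2 ^ J <= n ^ N * (7 * D * J.+1) ^ N)%N.
Proof.
move=> D0; elim: N o f J => [|N IH] o f J nJ f0 degf.
  rewrite !expn0 muln1; case: J nJ => [|J] nJ.
    by rewrite muln1; apply: leq_trans (max_card _) _; rewrite card_unit.
  suff -> : small_grid D J.+1 n o f = finset.set0 by rewrite cards0.
  apply/finset.setP => t; rewrite !inE /=; apply/negbTE; rewrite -ltNge.
  apply: (@lt_le_trans _ _ 1).
    by rewrite invf_lt1 ?exprn_gt0 // exprn_egt1 ?ltr1n // muln_eq0 negb_or -!lt0n D0.
  by rewrite -intr_norm -[1]/(1%:~R) ler_int -gtz0_ge1 normr_gt0.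
pose c : ipoly N := lead_coef (f : {poly ipoly N}).
have c0 : c != 0 by rewrite lead_coef_eq0.
have degc : ipoly_deg_le D c by exact: degf.2.
pose o' := fun j => o j.+1.
pose A i := small_grid D i n o' c.
pose cnt (t : grid n N) :=
  #|[pred k : 'I_n | ((k, t) : grid n N.+1) \in small_grid D J n o f]|.
have cardf : #|small_grid D J n o f| = (\sum_t cnt t)%N.
  transitivity (\sum_t \sum_(k | ((k, t) : grid n N.+1) \in small_grid D J n o f) 1)%N.
    rewrite -sum1_card (exchange_big_dep predT) //= pair_big_dep /=.
    by apply: eq_bigl => -[k t].
  by apply: eq_bigr => t _; rewrite /cnt -sum1_card.
have n0 : (0 < n)%N by apply: leq_trans nJ; rewrite expn_gt0.
(* On [A J] the trivial bound [n] is used. Otherwise let [i] be least with [t] outside [A i]: the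
   case [i = 0] is the last term, and for [i > 0] the point lies in [A (i - 1)] and is charged to
   the summand of that index. *)
have cntP (t : grid n N) : (cnt t * 2 ^ J <= n * 2 ^ J * (t \in A J)
    + \sum_(i < J) 3 * D * n * 2 ^ i.+1 * (t \in A i) + 3 * D * n)%N.
  have cntn : (cnt t <= n)%N by rewrite -[X in (_ <= X)%N](card_ord n) max_card.
  case: (boolP (t \in A J)) => tA.
    rewrite muln1 -addnA; apply: leq_trans (leq_addr _ _).
    by rewrite leq_mul2r cntn orbT.
  rewrite muln0 add0n.
  have exi : exists i, t \notin A i by exists J.
  case: (ex_minnP exi) => i ti imin.
  have iJ : (i <= J)%N by exact: imin.
  set e := ipoly_eval N (grid_point o' t).
  have lce : 2 ^- (D * i) < `|e c| by rewrite inE -ltNge in ti.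
  have ec0 : e c != 0.
    by rewrite -normr_gt0; apply: le_lt_trans lce; rewrite invr_ge0 exprn_ge0.
  have key : (cnt t * 2 ^ (J - i) <= 3 * D * n)%N.
    pose p := map_poly e f.
    have -> : cnt t = #|[pred k : 'I_n |
        `|p.[o 0%N + k%:R / n%:R]| <= 2 ^- (D * J)]|.
      by apply: eq_card => k; rewrite !inE.
    apply: sublevel_grid_count => //.
    - by apply: leq_trans (size_poly _ _) _; case: degf.
    - by rewrite /p lead_coef_map_eq.
  have key2 : (cnt t * 2 ^ J <= 3 * D * n * 2 ^ i)%N.
    by rewrite -{1}(subnK iJ) expnD mulnA leq_mul2r key orbT.
  apply: leq_trans key2 _.
  case: i => [|i] in ti imin iJ lce key *.
    by rewrite expn0 muln1 leq_addl.
  have tAi : t \in A i by apply: contraT => /imin; rewrite ltnn.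
  apply: leq_trans (leq_addr _ _).
  by rewrite (bigD1 (Ordinal iJ)) //= tAi muln1 leq_addr.
have sumA i : (i <= J)%N ->
    ((\sum_t (t \in A i)) * 2 ^ i <= n ^ N * (7 * D * i.+1) ^ N)%N.
  move=> iJ; have -> : (\sum_t (t \in A i) = #|A i|)%N.
    by rewrite -sum1_card [RHS]big_mkcond.
  by apply: IH => //; apply: leq_trans nJ; rewrite leq_exp2l.
rewrite cardf big_distrl /=.
apply: leq_trans (leq_sum _ (fun t _ => cntP t)) _.
rewrite !big_split /= -big_distrr /= exchange_big /= sum_nat_const card_grid.
pose B := (n ^ N * (7 * D * J.+1) ^ N)%N.
apply: (@leq_trans (n * B + J * (6 * D * n * B) + 3 * D * n * B)%N).
  apply: leq_add; first apply: leq_add.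
  - by rewrite -mulnA leq_mul2l mulnC sumA ?orbT.
  - rewrite -[X in (_ <= X * _)%N](card_ord J) -sum_nat_const.
    apply: leq_sum => i _; rewrite -big_distrr /= expnS.
    have -> a b : (3 * D * n * (2 * b) * a = 6 * D * n * (a * b))%N by lia.
    rewrite leq_mul2l; apply/orP; right.
    apply: leq_trans (sumA i (ltnW (ltn_ord i))) _.
    rewrite leq_mul2l; apply/orP; right.
    case: (N) => [//|N0]; by rewrite leq_exp2r // leq_mul2l ltnS (ltnW (ltn_ord i)) orbT.
  - rewrite mulnC leq_mul2l; apply/orP; right.
    by rewrite leq_pmulr // expn_gt0 !muln_gt0 D0.
have -> : (n ^ N.+1 * (7 * D * J.+1) ^ N.+1 = n * (7 * D * J.+1) * B)%N.
  by rewrite !expnS /B; lia.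
(* After division by [n * B] this reads [1 + 6 D J + 3 D <= 7 D (J + 1)]. *)
nia.
Qed.

(** * Null sets *)

Section Covers.
Variables (R : realType) (d : nat).
Implicit Types (B : set 'rV[R]_d) (a : 'rV[R]_d) (r : R).

Definition cube a r : set 'rV[R]_d :=
  [set u | forall i, a 0 i <= u 0 i <= a 0 i + r].

(** Cubes in place of boxes: the preimage of a small cube under a map that expands distances lies in
    a cube of comparable side, while for a thin box only the longest side would be controlled. *)
Definition cube_cover B (v : \bar R) : Prop :=
  exists (D : pred nat) (a : nat -> 'rV[R]_d) (r : nat -> R),
    [/\ forall k, 0 <= r k,
        B `<=` \bigcup_(k in [set k | D k]) cube (a k) (r k) &
        (\sum_(0 <= k <oo | D k) (r k ^+ d)%:E <= v)%E].

Definition cube_null B : Prop := forall e : R, 0 < e -> cube_cover B e%:E.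

Lemma cube_null_lebesgue B : cube_null B -> lebesgue_null B.
Proof.
move=> B0 e /B0[D [a [r [r0 cov vol]]]].
exists D, a, (fun k => a k + const_mx (r k)); split.
- by move=> k i; rewrite !mxE lerDl.
- move=> u /cov[k Dk uk]; exists k => // i.
  by have := uk i; rewrite !mxE.
- rewrite (eq_eseriesr (g := fun k => (r k ^+ d)%:E)) // => k _.
  congr (_%:E); rewrite -[in RHS](card_ord d) -prodr_const.
  by apply: eq_bigr => i _; rewrite !mxE addrAC subrr add0r.
Qed.

Lemma cube_cover_countable (T : countType) (D : pred T) (a : T -> 'rV[R]_d)
    (r : T -> R) B (v : \bar R) :
  (forall k, 0 <= r k) ->
  B `<=` \bigcup_(k in [set k | D k]) cube (a k) (r k) ->
  (\esum_(k in [set k | D k]) (r k ^+ d)%:E <= v)%E ->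
  cube_cover B v.
Proof.
move=> r0 BD vD.
pose ext (V : nmodType) (f : T -> V) n := oapp f 0 (pickle_inv n).
have extr0 n : 0 <= ext _ r n by rewrite /ext; case: pickle_inv.
pose D' := [pred n | if pickle_inv n is Some t then D t else false].
exists D', (ext _ a), (ext _ r); split=> //.
- move=> u /BD[t Dt ut]; exists (pickle t); rewrite /= ?/ext pickleK_inv //=.
- rewrite nneseries_esum; last first.
    by move=> n _; rewrite lee_fin exprn_ge0.
  rewrite (@reindex_esum _ _ _ [set t | D t] _ pickle).
    by under eq_esum => t _ do rewrite /ext pickleK_inv /=.
  split.
  - by move=> t /= Dt; rewrite pickleK_inv.
  - by move=> s t _ _; exact: (pcan_inj pickleK).
  - move=> n /=; case E: (pickle_inv n) => [t|//] Dt; exists t => //.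
    by have := @pickle_invK T n; rewrite E.
Qed.

Lemma cube_cover_fin (T : finType) (A : {set T}) (a : T -> 'rV[R]_d) (r : T -> R)
    B (v : R) :
  (forall k, 0 <= r k) ->
  B `<=` \bigcup_(k in [set k | k \in A]) cube (a k) (r k) ->
  \sum_(k in A) r k ^+ d <= v ->
  cube_cover B v%:E.
Proof.
move=> r0 BD vD; apply: (cube_cover_countable r0 BD).
rewrite esum_fset; first last.
- by move=> t _; rewrite lee_fin exprn_ge0.
- exact: finite_finset.
rewrite -(@bigfs _ _ _ _ (index_enum T) (mem A)) ?index_enum_uniq // => [|t].
  by rewrite sumEFin lee_fin.
by rewrite mem_index_enum.
Qed.

Lemma cube_coverS B B' v v' :
  B' `<=` B -> (v <= v')%E -> cube_cover B v -> cube_cover B' v'.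
Proof.
move=> BB vv [D [a [r [r0 cov vol]]]]; exists D, a, r; split => //.
  exact: subset_trans cov.
exact: le_trans vv.
Qed.

Lemma cube_cover_bigcup (B : nat -> set 'rV[R]_d) (v : nat -> R) (e : R) :
  (forall k, 0 <= v k) ->
  (forall k, cube_cover (B k) (v k)%:E) ->
  (forall n, \sum_(k < n) v k <= e) ->
  cube_cover (\bigcup_k B k) e%:E.
Proof.
move=> v0 /choice[D] /choice[a] /choice[r] H ve.
pose DD := [pred p : nat * nat | D p.1 p.2].
apply: (@cube_cover_countable (nat * nat)%type DD (fun p => a p.1 p.2)
   (fun p => r p.1 p.2)).
- by move=> [k n]; have [+ _ _] := H k; exact.
- move=> u [k _ Bu]; have [_ + _] := H k => /(_ _ Bu)[n Dn un].
  by exists (k, n).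
- have -> : [set p | DD p] = [set: nat] `*`` (fun k => [set n | D k n]).
    by apply/seteqP; split => [[k n]|[k n]] //= [].
  rewrite -(esum_esum (a := fun k n => (r k n ^+ d)%:E)); last first.
    by move=> k n _ _; rewrite lee_fin exprn_ge0 //; have [+ _ _] := H k; exact.
  apply: (@le_trans _ _ (\esum_(k in [set: nat]) (v k)%:E)%E).
    apply: le_esum => k _; have [r0 _] := H k.
    by rewrite nneseries_esum // => n _; rewrite lee_fin exprn_ge0.
  rewrite -nneseries_esumT; last by move=> k; rewrite lee_fin.
  apply: lime_le.
    by apply: is_cvg_nneseries => k _ _; rewrite lee_fin.
  by apply: nearW => n; rewrite sumEFin lee_fin big_mkord.
Qed.

Lemma cube_null_bigcup (B : nat -> set 'rV[R]_d) :
  (forall k, cube_null (B k)) -> cube_null (\bigcup_k B k).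
Proof.
move=> B0 e e0; apply: (@cube_cover_bigcup B (fun k => e / 2 ^+ k.+1)).
- by move=> k; rewrite divr_ge0 ?exprn_ge0 // ltW.
- by move=> k; apply: B0; rewrite divr_gt0 // exprn_gt0.
- move=> n.
  have -> : \sum_(k < n) e / 2 ^+ k.+1 = e * (1 - 2 ^- n).
    elim: n => [|n IH]; first by rewrite big_ord0 expr0 invr1 subrr mulr0.
    by rewrite big_ord_recr /= IH exprS; field; rewrite expf_neq0.
  by rewrite ger_pMr // gerBl invr_ge0 exprn_ge0.
Qed.

Lemma cube_nullS B B' : B' `<=` B -> cube_null B -> cube_null B'.
Proof. by move=> BB B0 e e0; apply: cube_coverS (lexx _) (B0 e e0). Qed.

Lemma cube_null_countable (T : countType) (B : T -> set 'rV[R]_d) :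
  (forall t, cube_null (B t)) -> cube_null (\bigcup_t B t).
Proof.
move=> B0.
pose C n := if pickle_inv n is Some t then B t else set0.
have null0 : cube_null (@set0 'rV[R]_d).
  move=> e e0; exists pred0, (fun _ => 0), (fun _ => 0); split => //.
  by rewrite eseries_pred0 // lee_fin ltW.
apply: (@cube_nullS (\bigcup_n C n)).
  by move=> u [t _ Bu]; exists (pickle t) => //; rewrite /C pickleK_inv.
by apply: cube_null_bigcup => n; rewrite /C; case: pickle_inv.
Qed.

End Covers.

Definition coord_fun (R : realType) N (Y : 'rV[R]_N) : nat -> R :=
  fun i => oapp (fun k : 'I_N => Y 0 k) 0 (insub i).

Lemma coord_funE (R : realType) N (Y : 'rV[R]_N) (i : 'I_N) :
  coord_fun Y i = Y 0 i.
Proof. by rewrite /coord_fun valK. Qed.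

Lemma grid_point_near (R : realType) (n N : nat) (o y : nat -> R) :
  (0 < n)%N -> (forall i, (i < N)%N -> o i <= y i <= o i + 1) ->
  exists t : grid n N, forall i, (i < N)%N ->
    grid_point o t i <= y i <= grid_point o t i + n%:R^-1.
Proof.
move=> n0; elim: N o y => [|N IH] o y oy; first by exists tt.
have nR : 0 < n%:R :> R by rewrite ltr0n.
have [t tP] := IH (fun i => o i.+1) (fun i => y i.+1) (fun i => oy i.+1).
have [k kP] : exists k : 'I_n,
    k%:R <= (y 0%N - o 0%N) * n%:R <= k%:R + 1.
  have /andP[y0 y1] := oy 0%N isT.
  set z := (y 0%N - o 0%N) * n%:R.
  have z0 : 0 <= z by rewrite mulr_ge0 ?subr_ge0 // ltW.
  have zn : z <= n%:R by apply: ler_piMl; [exact: ltW|rewrite lerBlDl].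
  have [zlt|zge] := ltP z n%:R.
    have lt_n : (Num.truncn z < n)%N by rewrite truncn_lt_nat.
    exists (Ordinal lt_n) => /=.
    by have /andP[-> /ltW] := truncn_itv z0; rewrite -natr1.
  (* Only the right end [z = n] remains; it belongs to the last cell. *)
  have lt_n : (n.-1 < n)%N by rewrite prednK.
  exists (Ordinal lt_n) => /=.
  rewrite (le_trans _ zge) ?ler_nat ?leq_pred //=.
  by rewrite natr1 prednK.
exists ((k, t) : grid n N.+1) => -[|i] iN /=; last exact: tP.
case/andP: kP => k1 k2; apply/andP; split.
  by rewrite -lerBrDl ler_pdivrMr.
by rewrite -addrA -lerBlDl -{2}(mul1r (n%:R^-1)) -mulrDl ler_pdivlMr.
Qed.

(** Both bounds are proved together, by induction on the Horner form [p * X + c]: the variation of a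
    product involves the size of its factors. *)
Lemma ipoly_eval_lipschitz (R : realType) (N : nat) (M : R) (f : ipoly N) :
  exists2 C : R, 0 <= C & forall (y z : nat -> R) (del : R), 0 <= del ->
    (forall i, (i < N)%N -> [/\ `|y i| <= M, `|z i| <= M & `|y i - z i| <= del]) ->
    `|ipoly_eval N y f| <= C /\
    `|ipoly_eval N y f - ipoly_eval N z f| <= C * del.
Proof.
elim: N f => [|N IH] f.
  exists `|f%:~R| => // y z del del0 _ /=.
  by rewrite subrr normr0 mulr_ge0.
elim/poly_ind: (f : {poly ipoly N}) => [|p c [C C0 CP]].
  by exists 0 => // y z del _ _; rewrite !rmorph0 subrr normr0 mul0r.
have [E E0 EP] := IH c.
exists (C * `|M| + C + E); first by rewrite !addr_ge0 // mulr_ge0.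
move=> y z del del0 H.
have evE (w : nat -> R) : ipoly_eval N.+1 w (p * 'X + c%:P : {poly ipoly N}) =
    ipoly_eval N.+1 w p * w 0%N + ipoly_eval N (fun i => w i.+1) c.
  by rewrite !ipoly_eval_S rmorphD rmorphM /= map_polyX map_polyC /= hornerD
    hornerMX hornerC.
have [Cy Cd] := CP y z del del0 H.
have [Ey Ed] := EP (fun i => y i.+1) (fun i => z i.+1) del del0 (fun i => H i.+1).
have [y0 z0 d0] := H 0%N isT.
have M0 : M <= `|M| by exact: ler_norm.
rewrite !evE; split.
  apply: le_trans (ler_normD _ _) _; rewrite normrM.
  apply: lerD => //; apply: le_trans (_ : C * `|M| <= _); last by rewrite lerDl.
  by apply: ler_pM => //; exact: le_trans y0 _.
rewrite opprD addrACA.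
apply: le_trans (ler_normD _ _) _; rewrite mulrDl; apply: lerD => //.
set a := ipoly_eval N.+1 y p in Cy Cd *; set b := ipoly_eval N.+1 z p in Cd *.
have -> : a * y 0%N - b * z 0%N = a * (y 0%N - z 0%N) + (a - b) * z 0%N by ring.
apply: le_trans (ler_normD _ _) _; rewrite !normrM addrC mulrDl.
apply: lerD.
  rewrite mulrAC; apply: ler_pM => //; exact: le_trans z0 _.
by apply: ler_pM.
Qed.

(** The grid is refined until the value changes by at most half the threshold inside a cell; hence
    the factor [1 / 2]. The lower corner of any cell that meets the sublevel set is then a point of
    [small_grid], and each cell has volume [n ^ - N]. *)
Lemma sublevel_cube_cover (R : realType) (N : nat) (o : 'rV[R]_N)
    (D J : nat) (f : ipoly N) :
  (0 < D)%N -> f != 0 -> ipoly_deg_le D f ->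
  cube_cover [set Y | cube o 1 Y /\
      `|ipoly_eval N (coord_fun Y) f| <= 2 ^- (D * J) / 2]
    (((7 * D * J.+1) ^ N)%:R / 2 ^+ J)%:E.
Proof.
move=> D0 f0 degf.
pose M := 1 + \sum_i `|o 0 i|.
have oM i : `|o 0 i| <= \sum_j `|o 0 j|.
  by rewrite (bigD1 i) //= lerDl sumr_ge0.
have [C C0 CP] := ipoly_eval_lipschitz (M + 1) f.
have pos2 m : 0 < 2 ^+ m :> R by rewrite exprn_gt0.
pose n := maxn (2 ^ J) (Num.truncn (C * 2 ^+ (D * J) * 2)).+1.
have nJ : (2 ^ J <= n)%N by rewrite leq_maxl.
have n0 : (0 < n)%N by rewrite leq_max orbT.
have nR : 0 < n%:R :> R by rewrite ltr0n.
have nC : C * n%:R^-1 <= 2 ^- (D * J) / 2.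
  rewrite ler_pdivrMr // mulrC mulrA ler_pdivlMr // ler_pdivlMr // mulrAC.
  apply: le_trans (ltW (truncnS_gt _)) _.
  by rewrite ler_nat leq_maxr.
pose A := small_grid D J n (coord_fun o) f.
pose a (t : grid n N) : 'rV[R]_N := \row_i grid_point (coord_fun o) t i.
have inv_le1 : n%:R^-1 <= 1 :> R by rewrite invf_le1 // ler1n.
apply: (@cube_cover_fin _ _ _ A a (fun=> n%:R^-1)).
- by move=> t; rewrite invr_ge0 ltW.
- move=> Y [Yo Yf].
  have [i lt_iN|t tP] := @grid_point_near _ n N (coord_fun o) (coord_fun Y) n0.
    by have := Yo (Ordinal lt_iN); rewrite -!coord_funE.
  exists t; last first.
    by move=> i; rewrite !mxE -coord_funE; exact: tP.
  rewrite /= inE -(subrK (ipoly_eval N (coord_fun Y) f) (ipoly_eval N _ f)).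
  rewrite [leRHS](splitr (2 ^- (D * J))); apply: le_trans (ler_normD _ _) _.
  apply: lerD Yf; apply: le_trans nC.
  apply: (CP _ _ _ _ _).2; first by rewrite invr_ge0 ltW.
  move=> i lt_iN; have /andP[t1 t2] := tP i lt_iN.
  have YM : `|coord_fun Y i| <= M.
    have := Yo (Ordinal lt_iN); rewrite -(coord_funE Y) /=.
    have := oM (Ordinal lt_iN); rewrite ler_norml ler_norml /M.
    by move=> /andP[h1 h2] /andP[h3 h4]; apply/andP; split; lra.
  have dist : `|grid_point (coord_fun o) t i - coord_fun Y i| <= n%:R^-1.
    by rewrite ler_norml; apply/andP; split; lra.
  split=> //; last by apply: le_trans YM _; rewrite lerDl.
  rewrite -(subrK (coord_fun Y i) (grid_point _ _ _)) addrC.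
  apply: le_trans (ler_normD _ _) _; apply: lerD => //.
  exact: le_trans dist _.
- rewrite sumr_const -[X in X <= _]mulr_natl.
  rewrite exprVn ler_pdivrMr ?exprn_gt0 // mulrAC ler_pdivlMr //.
  rewrite -!natrX -!natrM ler_nat mulnC [leqRHS]mulnC mulnC.
  exact: card_small_grid.
Qed.

(** Induction on [N] with [a] replaced by its square root [b]: of the two factors [b ^ m], one
    dominates [m + 1] by Bernoulli's inequality, the other the remaining power. *)
Lemma exp_ge_poly (R : realType) (N : nat) (a : R) : 1 < a ->
  exists2 C : R, 0 < C & forall m : nat, (m.+1%:R) ^+ N <= C * a ^+ m.
Proof.
elim: N a => [|N IH] a a1.
  by exists 1 => // m; rewrite expr0 mul1r exprn_ege1 // ltW.
pose b := Num.sqrt a.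
have a0 : 0 <= a by rewrite ltW // (lt_trans _ a1).
have b1 : 1 < b by rewrite -sqrtr1 ltr_sqrt // (lt_trans _ a1).
have bb : b ^+ 2 = a by rewrite sqr_sqrtr.
have [C C0 CP] := IH b b1.
have b10 : 0 < b - 1 by rewrite subr_gt0.
exists ((1 + (b - 1)^-1) * C); first by rewrite mulr_gt0 // addr_gt0 // invr_gt0.
move=> m; rewrite exprS -bb -exprM mulnC exprM expr2 mulrACA.
apply: ler_pM; rewrite ?exprn_ge0 //.
have bern : 1 + m%:R * (b - 1) <= b ^+ m.
  elim: m => [|m IHm]; first by rewrite mul0r addr0 expr0.
  rewrite exprS; apply: le_trans (ler_wpM2l _ IHm); last by rewrite ltW // (lt_trans _ b1).
  rewrite -subr_ge0 (_ : _ - _ = m%:R * (b - 1) ^+ 2); last by rewrite -natr1; ring.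
  by rewrite mulr_ge0 // exprn_ge0 // ltW.
have bm1 : 1 <= b ^+ m by rewrite exprn_ege1 // ltW.
rewrite mulrDl mul1r -natr1 addrC; apply: lerD => //.
rewrite ler_pdivlMl // mulrC; apply: le_trans bern; by rewrite lerDr.
Qed.

(** * The Borel-Cantelli argument for families of integer polynomials *)

Section SmallValues.
Variables (R : realType) (N t : nat) (fam : nat -> seq (ipoly N)).
Hypothesis degfam : forall m f, f \in fam m -> ipoly_deg_le (16 * m) f.
Variables p q : nat.
Hypotheses (p0 : (0 < p)%N) (pq : (2 * p < q)%N).
Hypothesis sizefam :
  forall m, (size (fam m) * q ^ m <= p ^ m * 2 ^ (t * m))%N.

(** The limsup set of Borel-Cantelli; the threshold is that of [sublevel_cube_cover] with [D = 16 m]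
    and [J = t m]. *)
Definition often_small : set 'rV[R]_N :=
  [set Y | forall m0, exists m f, [/\ (m0 <= m)%N, f \in fam m, f != 0 &
     `|ipoly_eval N (coord_fun Y) f| <= 2 ^- (16 * m * (t * m)) / 2]].

(** In a unit cube the [m]-th stage has volume at most a polynomial in [m] times [(p / q) ^ m]. As
    [p / q < 1 / 2], the polynomial is absorbed by [(q / (2 p)) ^ m], and a summable [2 ^ - m]
    remains. *)
Lemma often_small_null : cube_null often_small.
Proof.
suff null_o (o : 'rV[R]_N) : cube_null (often_small `&` cube o 1).
  apply: (@cube_nullS _ _ (\bigcup_(o : 'rV[int]_N)
      (often_small `&` cube (map_mx intr o) 1))).
    move=> Y YB; exists (\row_i Num.floor (Y 0 i)) => //; split=> // i.
    by rewrite !mxE ge_floor /= ltW // -[1]/(1%:~R) -intrD1 floorD1_gt.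
  by apply: cube_null_countable => o; exact: null_o.
have pR : 0 < p%:R :> R by rewrite ltr0n.
have qR : 0 < q%:R :> R by rewrite ltr0n; apply: leq_ltn_trans pq.
have pqR : 2 * p%:R < q%:R :> R by rewrite -natrM ltr_nat.
have [|C C0 CP] := @exp_ge_poly R (2 * N) (q%:R / (2 * p%:R)).
  by rewrite ltr_pdivlMr ?mul1r // mulr_gt0.
pose K : R := ((112 * t.+1) ^ N)%:R * C.
have K0 : 0 <= K by rewrite mulr_ge0 // ltW.
pose v m : R := (size (fam m))%:R * (((7 * (16 * m) * (t * m).+1) ^ N)%:R / 2 ^+ (t * m)).
have v0 m : 0 <= v m by rewrite mulr_ge0 // divr_ge0 // exprn_ge0.
have vK m : v m <= K / 2 ^+ m.
  have h1 : ((7 * (16 * m) * (t * m).+1) ^ N)%:R <= K * (q%:R / (2 * p%:R)) ^+ m.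
    rewrite /K -mulrA; apply: le_trans (ler_wpM2l _ (CP m)); last by [].
    rewrite exprM -!natrX -natrM ler_nat -expnMn.
    case: (N) => [//|N']; rewrite leq_exp2r //; nia.
  have h2 : (size (fam m))%:R / 2 ^+ (t * m) <= (p%:R / q%:R) ^+ m :> R.
    rewrite ler_pdivrMr ?exprn_gt0 // expr_div_n mulrAC ler_pdivlMr ?exprn_gt0 //.
    by rewrite -!natrX -!natrM ler_nat.
  rewrite /v mulrCA.
  apply: le_trans (ler_pM _ _ h1 h2) _ => //.
  rewrite -mulrA -exprMn -exprVn ler_wpM2l //.
  rewrite (_ : q%:R / (2 * p%:R) * (p%:R / q%:R) = 2^-1 :> R) //; field.
  by rewrite !gt_eqF.
move=> e e0.
(* Large enough for the tail from [m0] on to be at most [e], and positive, so that the degree bound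
   [16 m] is positive at every stage used. *)
pose m0 := (Num.truncn (2 * K / e)).+1.
have m0K : 2 * K / 2 ^+ m0 <= e.
  rewrite ler_pdivrMr ?exprn_gt0 // [leRHS]mulrC -ler_pdivrMr //.
  apply: le_trans (ltW (truncnS_gt _)) _.
  by rewrite ltW // -natrX ltr_nat ltn_expl.
pose S f m := [set Y : 'rV[R]_N | cube o 1 Y /\
   `|ipoly_eval N (coord_fun Y) f| <= 2 ^- (16 * m * (t * m)) / 2].
pose T m := [set Y : 'rV[R]_N | exists f, [/\ f \in fam m, f != 0 & S f m Y]].
have coverT m : (0 < m)%N -> cube_cover (T m) (v m)%:E.
  move=> mpos; pose w : R := ((7 * (16 * m) * (t * m).+1) ^ N)%:R / 2 ^+ (t * m).
  have w0 : 0 <= w by rewrite divr_ge0 // exprn_ge0.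
  pose Tk k := if (k < size (fam m))%N && (nth 0 (fam m) k != 0)
               then S (nth 0 (fam m) k) m else set0.
  apply: (@cube_coverS _ _ (\bigcup_k Tk k) _ (v m)%:E) => //.
    move=> Y [f [ff f0 Sf]]; exists (index f (fam m)) => //.
    by rewrite /Tk index_mem ff nth_index // f0.
  apply: (@cube_cover_bigcup _ _ _ (fun k => if (k < size (fam m))%N then w else 0)).
  - by move=> k; case: ifP.
  - move=> k; rewrite /Tk; case: ltnP => [klt|_] /=; last first.
      apply: (@cube_cover_fin _ _ 'I_0 finset.set0 0 (fun=> 0)) => //.
      by rewrite big_set0.
    case: eqP => [_|/eqP f0] /=.
      apply: (@cube_cover_fin _ _ 'I_0 finset.set0 0 (fun=> 0)) => //.
      by rewrite big_set0.
    by apply: sublevel_cube_cover; rewrite ?muln_gt0 //; apply: degfam; rewrite mem_nth.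
  - move=> n; set s := size (fam m).
    have -> : \sum_(k < n) (if (k < s)%N then w else 0) = (minn n s)%:R * w.
      elim: n => [|n IH]; first by rewrite big_ord0 min0n mul0r.
      rewrite big_ord_recr /= IH; case: (ltnP n s) => ns.
        by rewrite (minn_idPl ns) -natr1 mulrDl mul1r.
      by rewrite (minn_idPr (leqW ns)) addr0.
    by apply: ler_wpM2r => //; rewrite ler_nat geq_minr.
apply: (@cube_coverS _ _ (\bigcup_k T (m0 + k)%N) _ e%:E) => //.
  move=> Y [Ysmall Yo]; have [m [f [m0m ff f0 sf]]] := Ysmall m0.
  by exists (m - m0)%N => //; rewrite subnKC //; exists f.
apply: (@cube_cover_bigcup _ _ _ (fun k => K / 2 ^+ (m0 + k))).
- by move=> k; rewrite divr_ge0 // exprn_ge0.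
- move=> k; apply: (cube_coverS (@subset_refl _ _) _ (coverT (m0 + k)%N isT)).
  by rewrite lee_fin.
- move=> n; apply: le_trans m0K.
  have -> : \sum_(k < n) K / 2 ^+ (m0 + k) = 2 * K / 2 ^+ m0 * (1 - 2 ^- n).
    elim: n => [|n IH]; first by rewrite big_ord0 expr0 invr1 subrr mulr0.
    rewrite big_ord_recr /= IH exprD exprS; field.
    by rewrite !expf_neq0.
  rewrite -[leRHS]mulr1 ler_wpM2l ?gerBl ?invr_ge0 ?exprn_ge0 //.
  by rewrite divr_ge0 ?exprn_ge0 // mulr_ge0.
Qed.

End SmallValues.

(** * Transfer of null sets along parametrizations *)

Lemma nbhs_ltP (R : realType) (V : normedModType R) (x : V) (P : set V) :
  nbhs x P <-> exists2 r : R, 0 < r & forall y, `|y - x| < r -> P y.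
Proof.
split=> [/nbhs_normP[r r0 rP]|[r r0 rP]].
  by exists r => // y yr; apply: rP; rewrite /ball_ /= distrC.
by apply/nbhs_normP; exists r => // y; rewrite /ball_ /= distrC; exact: rP.
Qed.

Lemma ler_mx_norm (R : realType) m n (M : 'M[R]_(m, n)) i j : `|M i j| <= `|M|.
Proof.
rewrite [leRHS]/Num.Def.normr /= mx_normrE; apply/bigmax_geP; right => /=.
by exists (i, j).
Qed.

Lemma mx_norm_le (R : realType) m n (M : 'M[R]_(m, n)) (e : R) :
  0 <= e -> (forall i j, `|M i j| <= e) -> `|M| <= e.
Proof.
by move=> e0 Me; rewrite [leLHS]/Num.Def.normr /= mx_normrE; apply: bigmax_le.
Qed.

Lemma ler_mulmx_norm (R : realType) m n p (A : 'M[R]_(m, n)) (B : 'M[R]_(n, p)) :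
  `|A *m B| <= n%:R * `|A| * `|B|.
Proof.
apply: mx_norm_le => [|i j]; first by rewrite !mulr_ge0.
rewrite mxE; apply: le_trans (ler_norm_sum _ _ _) _.
rewrite -mulrA mulr_natl -[X in _ *+ X](card_ord n) -sumr_const.
apply: ler_sum => k _; rewrite normrM.
by apply: ler_pM => //; exact: ler_mx_norm.
Qed.

Lemma mulmx_perturb_linv (R : realType) m d n (h : 'M[R]_(m, d))
    (J J0 : 'M[R]_(d, n)) (B : 'M[R]_(n, d)) :
  J0 *m B = 1%:M -> h *m J *m B = h + h *m ((J - J0) *m B).
Proof.
by move=> JB; rewrite mulmxBl JB mulmxBr mulmx1 mulmxA addrC subrK.
Qed.

Lemma is_derive_line (R : realType) d n (phi : 'rV[R]_d -> 'rV[R]_n)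
    (v h : 'rV[R]_d) (t : R) j :
  differentiable phi (v + t *: h) ->
  is_derive t 1 (fun s : R => phi (v + s *: h) 0 j)
    ((h *m jacobian phi (v + t *: h)) 0 j).
Proof.
move=> dphi.
pose aff (s : R) : 'rV[R]_d := v + s *: h.
pose lin (s : R) : 'rV[R]_d := s *: h.
have dlin : is_diff t lin lin := is_diff_scalel t h.
have daff : is_diff t aff lin.
  have := is_diffD (is_diff_cst v t) dlin.
  by rewrite add0r.
have d1 : differentiable (phi \o aff) t by apply: differentiable_comp.
have d2 : derivable (phi \o aff) t 1 by exact: diff_derivable.
apply: DeriveDef; first by have /derivable_mxP := d2; exact.
have := derive_mx d2 => /matrixP/(_ 0 j); rewrite mxE => <-.
rewrite deriveE // diff_comp //= diff_val /lin scale1r.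
by rewrite /jacobian mul_rV_lin1.
Qed.

(** A right inverse [B] of the Jacobian at [u0] makes the derivative of [phi *m B] close to the
    identity. The mean value theorem is applied along the segment from [v] to [u], to the one
    coordinate in which [u - v] attains its sup norm. *)
Lemma immersion_expanding (R : realType) d n (U : set 'rV[R]_d)
    (phi : 'rV[R]_d -> 'rV[R]_n) (u0 : 'rV[R]_d) :
  open U -> U u0 -> (forall u, U u -> differentiable phi u) ->
  {for u0, continuous (jacobian phi)} -> row_free (jacobian phi u0) ->
  exists K r : R, [/\ 0 < K, 0 < r, forall u, `|u - u0| < r -> U u &
    forall u v, `|u - u0| < r -> `|v - u0| < r ->
      `|u - v| <= K * `|phi u - phi v|].
Proof.
move=> oU Uu0 dphi Jc /row_freeP[B JB].
pose C := d%:R * (n%:R * `|B|) + 1.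
have C0 : 0 < C by rewrite ltr_wpDl // !mulr_ge0.
(* Since [d n |B| = C - 1], Jacobians within [eta] of the one at [u0] perturb the derivative by at
   most [|h| / 2]. *)
pose eta := (2 * C)^-1.
have eta0 : 0 < eta by rewrite invr_gt0 mulr_gt0.
have [r1 r10 r1U] := (nbhs_ltP _ _).1 (open_nbhs_nbhs (conj oU Uu0)).
have [r2 r20 r2J] := (nbhs_ltP _ _).1 ((cvgrPdist_lt _ _).1 Jc _ eta0).
pose r := Num.min r1 r2.
exists (2 * (n%:R * `|B|) + 1), r; split.
- by rewrite ltr_wpDl // !mulr_ge0.
- by rewrite lt_min r10.
- by move=> u; rewrite lt_min => /andP[/r1U].
move=> u v ur vr; set h := u - v.
have [->|h0] := eqVneq h 0; first by rewrite normr0 mulr_ge0 // addr_ge0 // !mulr_ge0.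
have [[i0 i] hi] : exists i, `|h| = `|h i.1 i.2|.
  by apply: mx_norm_neq0; rewrite -[X in X != 0]/(`|h|) normr_eq0.
rewrite /= (ord1 i0) in hi.
have seg (t : R) : t \in `[0, 1] -> `|v + t *: h - u0| < r.
  rewrite in_itv /= => /andP[t0 t1].
  have -> : v + t *: h - u0 = t *: (u - u0) + (1 - t) *: (v - u0).
    by rewrite /h; apply/matrixP => a b; rewrite !mxE; ring.
  apply: le_lt_trans (ler_normD _ _) _.
  rewrite !normrZ ger0_norm // (@ger0_norm _ (1 - t)) ?subr_ge0 //.
  have [->|tn0] := eqVneq t 0; first by rewrite mul0r add0r subr0 mul1r.
  have -> : r = t * r + (1 - t) * r by ring.
  apply: ltr_leD; first by rewrite ltr_pM2l // lt_neqAle eq_sym tn0.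
  by rewrite ler_wpM2l ?subr_ge0 // ltW.
have segU (t : R) : t \in `[0, 1] -> U (v + t *: h).
  by move=> /seg; rewrite lt_min => /andP[/r1U].
pose s (t : R) : R := \sum_j phi (v + t *: h) 0 j * B j i.
pose ds (t : R) : R := (h *m jacobian phi (v + t *: h) *m B) 0 i.
have sder (t : R) : t \in `[0, 1] -> is_derive t 1 s (ds t).
  move=> /segU /dphi dphit.
  have -> : s = \sum_j (fun t : R => phi (v + t *: h) 0 j * B j i).
    by apply/funext => x; rewrite fct_sumE.
  have -> : ds t = \sum_j (h *m jacobian phi (v + t *: h)) 0 j * B j i.
    by rewrite /ds mxE.
  apply: is_derive_sum => j.
  have := is_derive_line j dphit; set f := (fun _ : R => phi _ 0 j) => df.
  rewrite (_ : (fun _ => _) = B j i \*: f); last by apply/funext => x; rewrite /= mulrC.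
  by rewrite mulrC; apply: is_deriveZ.
have [|c c01 sc] := @MVT_segment R s ds 0 1 ler01 (fun x xi => sder x (subset_itv_oo_cc xi)).
  apply: derivable_within_continuous => x xi; have := sder x xi => dx.
  exact: ex_derive.
have dsc : `|h| / 2 <= `|ds c|.
  set J1 := jacobian phi (v + c *: h); set J0 := jacobian phi u0 in JB.
  have E : h *m J1 *m B = h + h *m ((J1 - J0) *m B).
    exact: mulmx_perturb_linv.
  have -> : ds c = h 0 i + (h *m ((J1 - J0) *m B)) 0 i.
    by rewrite /ds -/J1 E mxE.
  have small : `|(J1 - J0) *m B| <= n%:R * eta * `|B|.
    apply: le_trans (ler_mulmx_norm _ _) _.
    rewrite ler_wpM2r // ler_wpM2l // distrC; apply/ltW/r2J.
    by have := seg _ c01; rewrite lt_min => /andP[].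
  have small2 : `|(h *m ((J1 - J0) *m B)) 0 i| <= `|h| / 2.
    apply: le_trans (ler_mx_norm _ _ _) _.
    apply: le_trans (ler_mulmx_norm _ _) _.
    apply: le_trans (ler_wpM2l _ small) _; first by rewrite mulr_ge0.
    have -> : d%:R * `|h| * (n%:R * eta * `|B|) = `|h| * (eta * (C - 1)).
      by rewrite /C; ring.
    rewrite ler_wpM2l // /eta invfM -mulrA ger_pMr ?invr_gt0 //.
    by rewrite mulrC ler_pdivrMr // mul1r gerDl lerN10.
  have := lerB_dist (h 0 i) (- (h *m ((J1 - J0) *m B)) 0 i).
  rewrite opprK normrN -hi; apply: le_trans; lra.
have sB : s 1 - s 0 = ((phi u - phi v) *m B) 0 i.
  rewrite /s scale1r scale0r addr0 [v + h]addrC subrK -sumrB mxE.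
  by apply: eq_bigr => j _; rewrite !mxE mulrBl.
have : `|h| / 2 <= n%:R * `|phi u - phi v| * `|B|.
  apply: le_trans dsc _; move: sc; rewrite subr0 mulr1 => <-.
  rewrite sB; apply: le_trans (ler_mx_norm _ _ _) (ler_mulmx_norm _ _).
rewrite ler_pdivrMr // => hle; apply: le_trans hle _; rewrite mulrDl mul1r ler_wpDr //.
by rewrite le_eqVlt; apply/orP; left; apply/eqP; ring.
Qed.

(** The part of [S] over a cube of side [r] has diameter at most [K r], hence lies in a cube of side
    [2 K r], whose volume is at most [(2 K) ^ d * r ^ N] if [r <= 1] and [N <= d]. *)
Lemma cube_null_preimage (R : realType) d N (F : 'rV[R]_d -> 'rV[R]_N)
    (S : set 'rV[R]_d) (B : set 'rV[R]_N) (K : R) :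
  (0 < N <= d)%N -> 0 < K ->
  (forall u v, S u -> S v -> `|u - v| <= K * `|F u - F v|) ->
  cube_null B -> cube_null [set u | S u /\ B (F u)].
Proof.
move=> /andP[N0 Nd] K0 SF B0 e e0.
have Kd : 0 < (2 * K) ^+ d by rewrite exprn_gt0 // mulr_gt0.
(* The minimum with 1 forces [r k <= 1], each single volume [r k ^ N] being at most the total. *)
pose e' := Num.min 1 (e / (2 * K) ^+ d).
have e'0 : 0 < e' by rewrite lt_min ltr01 divr_gt0.
have [D [a [r [r0 cov vol]]]] := B0 _ e'0.
have r1 k : D k -> r k <= 1.
  move=> Dk; rewrite -(expr_le1 N0) // -lee_fin.
  have le_e' : (e'%:E <= 1%:E)%E by rewrite lee_fin ge_min lexx.
  apply: le_trans (le_trans vol le_e').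
  have rN0 n : (0 <= (r n ^+ N)%:E)%E by rewrite lee_fin exprn_ge0.
  apply: le_trans (@nneseries_lim_ge R _ D 0%N k.+1 (fun n _ _ => rN0 n)).
  by rewrite big_mkcond big_nat_recr //= Dk -big_mkcond leeDr // sume_ge0.
have /choice[c cP] : forall k, exists c : 'rV[R]_d, forall u, S u ->
    cube (a k) (r k) (F u) -> `|u - c| <= K * r k.
  move=> k; have [[c [Sc Fc]]|no] := pselect (exists c, S c /\ cube (a k) (r k) (F c)).
    exists c => u Su Fu; apply: le_trans (SF _ _ Su Sc) _.
    apply: ler_wpM2l; first exact: ltW.
    apply: mx_norm_le => // i j.
    rewrite (ord1 i) !mxE ler_norml.
    have /andP[? ?] := Fc j; have /andP[? ?] := Fu j.
    by apply/andP; split; lra.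
  by exists 0 => u Su Fu; case: no; exists u.
exists D, (fun k => c k - const_mx (K * r k)), (fun k => 2 * K * r k); split.
- by move=> k; rewrite mulr_ge0 // mulr_ge0 // ltW.
- move=> u [Su /cov[k Dk uk]]; exists k => // i.
  have := le_trans (ler_mx_norm _ 0 i) (cP k u Su uk).
  rewrite !mxE ler_norml => /andP[? ?].
  by apply/andP; split; lra.
- apply: (@le_trans _ _ (\sum_(0 <= k <oo | D k) ((2 * K) ^+ d)%:E * (r k ^+ N)%:E)%E).
    apply: lee_nneseries => [k _ _|k Dk].
      by rewrite lee_fin exprn_ge0 // mulr_ge0 // mulr_ge0 // ltW.
    rewrite -EFinM lee_fin exprMn; apply: ler_wpM2l; first exact: ltW.
    by apply: ler_wiXn2l => //; exact: r1.
  rewrite nneseriesZl; last by move=> k _; rewrite lee_fin exprn_ge0.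
  apply: le_trans (lee_wpmul2l _ vol) _; first by rewrite lee_fin ltW.
  by rewrite -EFinM lee_fin mulrC -ler_pdivlMr // ge_min lexx orbT.
Qed.

Lemma differentiable_approx (R : realType) d N (F : 'rV[R]_d -> 'rV[R]_N) u0 e :
  differentiable F u0 -> 0 < e ->
  exists2 r : R, 0 < r & forall u, `|u - u0| < r ->
    `|F u - F u0 - (u - u0) *m jacobian F u0| <= e * `|u - u0|.
Proof.
move=> /diff_locallyP[_ /eqaddoP/(_ e)] H e0.
have [r r0 rP] := (nbhs_ltP _ _).1 (H e0).
exists r => // u ur; have := rP (u - u0); rewrite subr0 => /(_ ur) /=.
rewrite /cst !fctE subrK /jacobian mul_rV_lin1 opprD addrA.
by [].
Qed.

Lemma continuous_bigsum (R : realType) (T : topologicalType) (I : Type)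
    (s : seq I) (P : pred I) (F : I -> T -> R) :
  (forall i, continuous (F i)) -> continuous (fun x => \sum_(i <- s | P i) F i x).
Proof.
move=> Fc; elim: s => [|i s IH].
  by under eq_fun do rewrite big_nil; exact: cst_continuous.
under eq_fun do rewrite big_cons.
by case: (P i) => // x; apply: continuousD; [exact: Fc|exact: IH].
Qed.

Lemma continuous_bigprod (R : realType) (T : topologicalType) (I : Type)
    (s : seq I) (P : pred I) (F : I -> T -> R) :
  (forall i, continuous (F i)) -> continuous (fun x => \prod_(i <- s | P i) F i x).
Proof.
move=> Fc; elim: s => [|i s IH].
  by under eq_fun do rewrite big_nil; exact: cst_continuous.
under eq_fun do rewrite big_cons.
by case: (P i) => // x; apply: continuousM; [exact: Fc|exact: IH].
Qed.

Lemma continuous_det (R : realType) (T : topologicalType) n (M : T -> 'M[R]_n) :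
  (forall i j, continuous (fun x => M x i j)) -> continuous (fun x => \det (M x)).
Proof.
move=> Mc; apply: continuous_bigsum => s x.
apply: cvgM; first exact: cvg_cst.
by move: x; apply: continuous_bigprod => i; exact: Mc.
Qed.

Lemma poly_val_continuous (R : realType) n (f : mpoly.mpoly n R) :
  continuous (poly_val f).
Proof.
rewrite (_ : poly_val f = fun x : 'rV[R]_n => \sum_(m <- mpoly.msupp f)
    mpoly.mcoeff m f * \prod_(i < n) (x 0 i) ^+ (mpoly.fun_of_multinom m i)); last first.
  by apply/funext => x; rewrite /poly_val mpoly.mevalE.
apply: continuous_bigsum => m x.
apply: (@continuousM R _ (fun=> mpoly.mcoeff m f)); first exact: cst_continuous.
move: x; apply: continuous_bigprod => i; elim: (mpoly.fun_of_multinom m i) => [|k IH].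
  by under eq_fun do rewrite expr0; exact: cst_continuous.
under eq_fun do rewrite exprS.
move=> y; apply: (@continuousM R _ (fun z : 'rV[R]_n => z 0 i)); last exact: IH.
exact: coord_continuous.
Qed.

(** The maximal rank is taken over all of [V], so it suffices that [r] independent gradients at [x]
    stay independent nearby, as a nonvanishing determinant shows. Points produced by a right inverse
    are only known to lie in [V]; near a smooth point this puts them in the smooth locus, where
    charts are open. *)
Lemma near_smooth_point (R : realType) n (V : set 'rV[R]_n) (x : 'rV[R]_n) :
  smooth_point V x -> \forall y \near x, V y -> smooth_point V y.
Proof.
move=> [Vx [r [[f [fV fr]] rmax]]].
pose M (y : 'rV[R]_n) := \matrix_(i < r, j < n) poly_val (mpoly.mderiv j (f i)) y.
have /row_freeP[B MB] : row_free (M x) by [].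
have detc : continuous (fun y => \det (M y *m B)).
  apply: continuous_det => i j.
  rewrite (_ : (fun y => _) = fun y => \sum_k poly_val (mpoly.mderiv k (f i)) y * B k j).
    apply: continuous_bigsum => k y.
    apply: (@continuousM R _ (poly_val _) (fun=> B k j)).
      exact: poly_val_continuous.
    exact: cst_continuous.
  by apply/funext => y; rewrite mxE; apply: eq_bigr => k _; rewrite mxE.
have near_unit : \forall y \near x, 0 < \det (M y *m B).
  have := detc x; rewrite /continuous_at MB det1 => /cvgr_gt; apply.
  exact: ltr01.
near=> y => Vy; split=> //; exists r; split=> //; exists f; split=> //.
apply/row_freeP; exists (B *m invmx (M y *m B)).
rewrite mulmxA mulmxV // unitmxE unitfE gt_eqF //.
by near: y.
Unshelve. all: by end_near. Qed.

Lemma open_norm_lt (R : realType) (V : normedModType R) (x : V) (r : R) :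
  open [set u | `|u - x| < r].
Proof.
rewrite openE => u /= ur; apply/nbhs_ltP; exists (r - `|u - x|).
  by rewrite subr_gt0.
move=> v; rewrite ltrBrDr /= => vr; apply: le_lt_trans vr.
by rewrite -[v - x](subrKA u) ler_normD.
Qed.

Section Transfer.
Variables (R : realType) (n d N : nat) (V : set 'rV[R]_n) (U : set 'rV[R]_d).
Variables (phi : 'rV[R]_d -> 'rV[R]_n) (psi : 'rV[R]_n -> 'rV[R]_N).
Variables (P : 'rV[R]_N -> 'rV[R]_n) (u0 : 'rV[R]_d) (L : R).
Hypotheses (paramphi : local_param V U phi) (Uu0 : U u0) (N0 : (0 < N)%N).
Hypothesis dpsi : differentiable psi (phi u0).
Hypothesis PK : \forall A \near phi u0, V A -> P (psi A) = A.
Hypothesis psiK : \forall y \near psi (phi u0), V (P y) /\ psi (P y) = y.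
Hypothesis Plip : exists2 r : R, 0 < r & forall y z,
  `|y - psi (phi u0)| < r -> `|z - psi (phi u0)| < r -> `|P y - P z| <= L * `|y - z|.

Let F := psi \o phi.

Let dphi : differentiable phi u0.
Proof. exact: param_differentiable paramphi _ Uu0. Qed.

Let dF : differentiable F u0.
Proof. exact: differentiable_comp. Qed.

Let phiV u : U u -> V (phi u).
Proof.
move=> Uu; have [W oW eW] := param_homeo paramphi (param_open paramphi) (@subset_refl _ U).
have : (phi @` U) (phi u) by exists u.
by rewrite eW => -[_ []].
Qed.

(** Near [u0] one has [phi = P \o F] with [P] Lipschitz, so [F] inherits the expansion of the
    immersion [phi]. *)
Lemma transfer_expanding : exists K r : R, [/\ 0 < K, 0 < r,
  forall u, `|u - u0| < r -> U u &
  forall u v, `|u - u0| < r -> `|v - u0| < r -> `|u - v| <= K * `|F u - F v|].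
Proof.
have [K [r1 [K0 r10 r1U phiK]]] := immersion_expanding (param_open paramphi) Uu0
  (param_differentiable paramphi) (param_C1 paramphi Uu0)
  (param_immersion paramphi Uu0).
have [rL rL0 Plip'] := Plip.
have phic : {for u0, continuous phi} by exact: differentiable_continuous.
have Fc : {for u0, continuous F} by exact: differentiable_continuous.
have [r2 r20 r2P] := (nbhs_ltP _ _).1 (phic _ PK).
have [r3 r30 r3P] := (nbhs_ltP _ _).1 ((cvgrPdist_lt _ _).1 Fc _ rL0).
pose r := Num.min r1 (Num.min r2 r3).
exists (K * `|L| + 1), r.
have lt_r u : `|u - u0| < r -> [/\ `|u - u0| < r1, `|u - u0| < r2 & `|u - u0| < r3].
  by rewrite !lt_min => /andP[-> /andP[-> ->]].
have PF u : `|u - u0| < r -> P (F u) = phi u /\ `|F u - F u0| < rL.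
  move=> /lt_r[u1 u2 u3]; split; first by apply: (r2P _ u2); apply: phiV; exact: r1U.
  by rewrite distrC; exact: r3P.
split.
- by rewrite ltr_wpDl // mulr_ge0 // ltW.
- by rewrite !lt_min r10 r20.
- by move=> u /lt_r[/r1U].
- move=> u v ur vr; have [u1 _ _] := lt_r _ ur; have [v1 _ _] := lt_r _ vr.
  have [Pu Fu] := PF _ ur; have [Pv Fv] := PF _ vr.
  apply: le_trans (phiK _ _ u1 v1) _; rewrite -Pu -Pv.
  apply: le_trans (ler_wpM2l (ltW K0) (Plip' _ _ Fu Fv)) _.
  rewrite mulrA; apply: ler_wpM2r => //; apply: le_trans (ler_norm _) _.
  by rewrite normrM (gtr0_norm K0) lerDl.
Qed.

(* A direction at psi (phi u0) orthogonal to the image of the differential of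
   psi o phi would be reached by openness of phi, along P. *)
Lemma transfer_dim : (N <= d)%N.
Proof.
rewrite leqNgt; apply/negP => dN.
pose J := jacobian F u0.
have rankJ : (\rank J < N)%N by apply: leq_ltn_trans (rank_leq_row _) dN.
have /negP : cokermx J != 0.
  by rewrite -mxrank_eq0 mxrank_coker subn_eq0 -ltnNge.
case; apply/eqP/matrixP => i j; rewrite [RHS]mxE; apply/eqP.
apply: contraT => cij0.
pose c := col j (cokermx J).
have Jc : J *m c = 0 by rewrite /c colE mulmxA mulmx_coker mul0mx.
pose y0 := F u0; pose y (t : R) := y0 + t *: delta_mx 0 i.
have yc (t : R) : (y t - y0) *m c = (t * c i 0)%:M.
  have -> : y t - y0 = t *: delta_mx 0 i by rewrite /y addrC addKr.
  rewrite -scalemxAl; have -> : delta_mx 0 i *m c = row i c by rewrite rowE.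
  by apply/matrixP => a b; rewrite (ord1 a) (ord1 b) !mxE mulr1n.
have ydist (t : R) : `|y t - y0| <= `|t|.
  rewrite /y addrC addKr normrZ ler_piMr //.
  apply: mx_norm_le => // a b; by rewrite mxE; case: (_ && _); rewrite ?normr1 ?normr0.
have [K [r [K0 r0 rU FK]]] := transfer_expanding.
pose C := 1 + N%:R * `|c|.
have C0 : 0 < C by rewrite ltr_pwDl // mulr_ge0.
have ci0 : 0 < `|c i 0| by rewrite normr_gt0 mxE.
(* Chosen so that [N * (e * K) * |c|], which is [|c i 0| * (C - 1) / (2 C)], is smaller than
   [|c i 0|]. *)
pose e := `|c i 0| / (2 * C * K).
have e0 : 0 < e by rewrite divr_gt0 // !mulr_gt0.
have [r' r'0 approx] := differentiable_approx dF e0.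
pose W := [set u | `|u - u0| < Num.min r r'].
have oW : open W.
  exact: open_norm_lt.
have WU : W `<=` U by move=> u; rewrite /W /= lt_min => /andP[/rU].
have [S oS eS] := param_homeo paramphi oW WU.
have Wu0 : W u0 by rewrite /W /= subrr normr0 lt_min r0.
have [Su0 su0] : (S `&` smooth_point V) (phi u0) by rewrite -eS; exists u0.
have nearO : \forall A \near phi u0, V A -> exists2 u, W u & phi u = A.
  have nO : nbhs (phi u0) S by apply: open_nbhs_nbhs.
  have nS := near_smooth_point su0.
  near=> A => VA; have : (phi @` W) A.
    rewrite eS; split; first by near: A; exact: nO.
    by move: VA; near: A; exact: nS.
  by move=> [u Wu <-]; exists u.
have Py0 : P y0 = phi u0.
  by have := nbhs_singleton PK; apply; apply: phiV.
have [rL rL0 Plip'] := Plip.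
have [r5 r50 r5P] := (nbhs_ltP _ _).1 psiK.
have [rho rho0 rhoP] := (nbhs_ltP _ _).1 nearO.
have L1 : 0 < `|L| + 1 by rewrite ltr_wpDl.
pose r4 := Num.min r5 (Num.min rL (rho / (`|L| + 1))).
have r40 : 0 < r4 by rewrite !lt_min r50 rL0 divr_gt0.
have r4P z : `|z - y0| < r4 -> (V (P z) /\ psi (P z) = z) /\
    exists2 u, W u & phi u = P z.
  rewrite !lt_min => /andP[z5 /andP[zL zrho]].
  have [Vz psiz] := r5P _ z5; split=> //.
  apply: (rhoP _ _ Vz).
  have := Plip' z y0 zL; rewrite subrr normr0 -Py0 => /(_ rL0) h.
  apply: le_lt_trans h _; rewrite ltr_pdivlMr // in zrho; apply: le_lt_trans zrho.
  rewrite mulrC; apply: ler_wpM2l => //.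
  by apply: le_trans (ler_norm _) _; rewrite lerDl.
pose t := r4 / 2.
have t0 : 0 < t by rewrite divr_gt0.
have [[_ psit] [u Wu phiu]] : (V (P (y t)) /\ psi (P (y t)) = y t) /\
    exists2 u, W u & phi u = P (y t).
  apply: r4P; apply: le_lt_trans (ydist t) _; rewrite gtr0_norm // /t; lra.
have Fu : F u = y t by rewrite /F /= phiu psit.
move: Wu; rewrite /W /= lt_min => /andP[ur ur'].
have uu0 : `|u - u0| <= K * t.
  apply: le_trans (FK u u0 ur _) _; first by rewrite subrr normr0.
  by rewrite Fu ler_pM2l // (le_trans (ydist t)) // gtr0_norm.
(* Since [J *m c = 0], the first-order term drops out of the product with [c]: the displacement
   [t * c i 0] is entirely due to the differentiability remainder, at most [e * K * t]. *)
have key : t * `|c i 0| <= N%:R * (e * (K * t)) * `|c|.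
  have -> : t * `|c i 0| = `|((F u - F u0 - (u - u0) *m J) *m c) 0 0|.
    rewrite mulmxBl -mulmxA Jc mulmx0 subr0 Fu yc !mxE mulr1n normrM gtr0_norm //.
  apply: le_trans (ler_mx_norm _ _ _) (le_trans (ler_mulmx_norm _ _) _).
  apply: ler_wpM2r => //; apply: ler_wpM2l => //.
  apply: le_trans (approx u ur') _; by rewrite ler_pM2l.
have : N%:R * (e * (K * t)) * `|c| < t * `|c i 0|.
  have -> : N%:R * (e * (K * t)) * `|c| = t * (`|c i 0| * ((C - 1) / (2 * C))).
    rewrite /e /C; field; rewrite gt_eqF //=.
    by rewrite -/C gt_eqF.
  rewrite ltr_pM2l // gtr_pMr // ltr_pdivrMr ?mulr_gt0 //; lra.
by rewrite ltNge key.
Unshelve. all: by end_near. Qed.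

Lemma transfer_null (B : set 'rV[R]_N) : cube_null B ->
  exists2 r : R, 0 < r &
    cube_null [set u | (`|u - u0| < r /\ U u) /\ B (psi (phi u))].
Proof.
move=> B0; have [K [r [K0 r0 rU FK]]] := transfer_expanding.
exists r => //; apply: (cube_null_preimage _ K0 _ B0) => [|u v [ur _] [vr _]].
  by rewrite N0 transfer_dim.
exact: FK.
Qed.

End Transfer.

(** A Lindelof argument: every point of [S] lies in a ball of rational centre and radius
    [1 / (k + 1)] contained in its good neighbourhood, and there are countably many such balls. *)
Lemma cube_null_local (R : realType) d (S : set 'rV[R]_d) :
  (forall u, S u -> exists2 r : R, 0 < r &
     cube_null [set v | S v /\ `|v - u| < r]) ->
  cube_null S.
Proof.
move=> loc.
pose ratmx (q : 'rV[rat]_d) : 'rV[R]_d := map_mx ratr q.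
pose near_q (p : 'rV[rat]_d * nat) : set 'rV[R]_d :=
  [set v | S v /\ `|v - ratmx p.1| < p.2.+1%:R^-1].
(* The condition in front empties [B p] when the trace of the ball on [S] is not null, so that every
   [B p] is null. *)
pose B (p : 'rV[rat]_d * nat) : set 'rV[R]_d :=
  [set v | cube_null (near_q p) /\ near_q p v].
apply: (@cube_nullS _ _ (\bigcup_p B p)); last first.
  apply: cube_null_countable => p.
  have [null|nnull] := pselect (cube_null (near_q p)).
    by apply: cube_nullS null => v [].
  have -> : B p = set0 by apply/seteqP; split => v // [].
  move=> e e0; exists pred0, (fun _ => 0), (fun _ => 0); split => //.
  by rewrite eseries_pred0 // lee_fin ltW.
move=> u Su; have [r r0 rnull] := loc u Su.
pose k := Num.truncn (2 / r).
have k0 : 0 < k.+1%:R^-1 :> R by rewrite invr_gt0.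
have kr : k.+1%:R^-1 + k.+1%:R^-1 <= r.
  have : 2 / r < k.+1%:R by exact: truncnS_gt.
  rewrite ltr_pdivrMr // => /ltW h.
  by rewrite -mulr2n -[_ *+ 2]mulr_natl ler_pdivrMr ?ltr0n // mulrC.
have /choice[q qP] : forall i, exists q : rat, `|u 0 i - ratr q| < k.+1%:R^-1 / 2.
  move=> i.
  have [|q] := @rat_in_itvoo R (u 0 i - k.+1%:R^-1 / 2) (u 0 i + k.+1%:R^-1 / 2).
    by rewrite ltrBlDr -addrA ltrDl -splitr.
  rewrite in_itv /= => /andP[q1 q2]; exists q.
  rewrite ltr_norml; move: q1 q2; move: (_ / 2) => e q1 q2.
  by apply/andP; split; lra.
have uq : `|u - ratmx (\row_i q i)| < k.+1%:R^-1.
  apply: (@le_lt_trans _ _ (k.+1%:R^-1 / 2)); last first.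
    by rewrite ltr_pdivrMr // ltr_pMr // ltr1n.
  apply: mx_norm_le => [|i j]; first by rewrite ltW // divr_gt0.
  by rewrite (ord1 i) !mxE; exact/ltW/qP.
exists (\row_i q i, k) => //; split; last by split.
apply: cube_nullS rnull => v [Sv vq]; split=> //=; apply: lt_le_trans kr.
rewrite -[v - u](subrKA (ratmx (\row_i q i))); apply: le_lt_trans (ler_normD _ _) _.
by apply: ltrD => //; rewrite distrC.
Qed.

(** * Integral parametrization of the surface relation *)

Section TwoByTwo.
Variable K : comNzRingType.
Implicit Types M N : 'M[K]_2.

Definition mx2 (a b c d : K) : 'M[K]_2 :=
  \matrix_(i, j) if i == 0 then (if j == 0 then a else b)
                 else (if j == 0 then c else d).

Lemma mx2E a b c d : (mx2 a b c d 0 0 = a) * (mx2 a b c d 0 1 = b) *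
  (mx2 a b c d 1 0 = c) * (mx2 a b c d 1 1 = d).
Proof. by rewrite !mxE. Qed.

Lemma ord2P (i : 'I_2) : i = 0 \/ i = 1.
Proof. by case: i => [[|[|//]] hi]; [left|right]; apply: val_inj. Qed.

Lemma mx2P M N : M 0 0 = N 0 0 -> M 0 1 = N 0 1 -> M 1 0 = N 1 0 ->
  M 1 1 = N 1 1 -> M = N.
Proof.
move=> e00 e01 e10 e11; apply/matrixP => i j.
by have [->|->] := ord2P i; have [->|->] := ord2P j.
Qed.

Lemma mx2_eta M : M = mx2 (M 0 0) (M 0 1) (M 1 0) (M 1 1).
Proof. by apply: mx2P; rewrite mx2E. Qed.

Lemma mulmx2E M N i j : (M * N) i j = M i 0 * N 0 j + M i 1 * N 1 j.
Proof.
by rewrite [LHS]mxE big_ord_recl big_ord1; congr (_ + M i _ * N _ j); apply: val_inj.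
Qed.

Lemma det2E M : \det M = M 0 0 * M 1 1 - M 0 1 * M 1 0.
Proof.
rewrite (expand_det_row _ 0) big_ord_recl big_ord1 /cofactor !det_mx11 !mxE /=.
rewrite expr0 mul1r expr1 mulN1r mulrN.
by congr (_ * M _ _ - M _ _ * M _ _); apply: val_inj.
Qed.

Lemma trace2E M : \tr M = M 0 0 + M 1 1.
Proof.
by rewrite /mxtrace big_ord_recl big_ord1; congr (_ + M _ _); apply: val_inj.
Qed.

Definition adj2 M := mx2 (M 1 1) (- M 0 1) (- M 1 0) (M 0 0).

Lemma mulmx_adj2 M : M * adj2 M = (\det M)%:M.
Proof.
by apply: mx2P; rewrite mulmx2E !mx2E det2E !mxE /= ?mulr1n ?mulr0n; ring.
Qed.

Lemma adj2Z a M : adj2 (a *: M) = a *: adj2 M.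
Proof. by apply: mx2P; rewrite !mxE /= ?mulrN. Qed.

End TwoByTwo.

Lemma map_mx2 (K K' : comNzRingType) (f : {rmorphism K -> K'}) a b c d :
  map_mx f (mx2 a b c d) = mx2 (f a) (f b) (f c) (f d).
Proof. by apply: mx2P; rewrite !mxE. Qed.

Lemma map_adj2 (K K' : comNzRingType) (f : {rmorphism K -> K'}) (M : 'M[K]_2) :
  map_mx f (adj2 M) = adj2 (map_mx f M).
Proof. by rewrite map_mx2 /adj2 !mxE !rmorphN. Qed.

Section TwoByTwoField.
Variable K : fieldType.
Implicit Types (M N : 'M[K]_2) (A : nat -> 'M[K]_2).

Lemma det_mulmx2 M N : \det (M * N) = \det M * \det N.
Proof. exact: det_mulmx. Qed.

Lemma unitmx2 M : (M \is a GRing.unit) = (\det M != 0).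
Proof. by rewrite [LHS]unitmxE unitfE. Qed.

Lemma adj2_inv M : \det M != 0 -> adj2 M = \det M *: M^-1.
Proof.
move=> d0; have uM : M \is a GRing.unit by rewrite unitmx2.
by rewrite -[LHS](mulKr uM) mulmx_adj2 -mul_mx_scalar.
Qed.

Lemma det_inv2 M : \det (M^-1) = (\det M)^-1.
Proof. exact: det_inv. Qed.

Definition comm2 M N := M * N * M^-1 * N^-1.

Lemma det_comm2 M N : \det M != 0 -> \det N != 0 -> \det (comm2 M N) = 1.
Proof. by move=> dM dN; rewrite /comm2 !det_mulmx2 !det_inv2; field; rewrite dM dN. Qed.

Lemma inv2Z (a : K) M : a != 0 -> \det M != 0 -> (a *: M)^-1 = a^-1 *: M^-1.
Proof.
by move=> a0 dM; rewrite invrZ ?unitfE // unitmx2.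
Qed.

Lemma comm2Z a b M N : a != 0 -> b != 0 -> \det M != 0 -> \det N != 0 ->
  comm2 (a *: M) (b *: N) = comm2 M N.
Proof.
move=> a0 b0 dM dN; rewrite /comm2 !inv2Z //.
rewrite -!scalerAl -!scalerAr !scalerA -!scalerAl !scalerA.
by rewrite (_ : _ * _ = 1) ?scale1r //; field; rewrite a0 b0.
Qed.

Definition comm_prod m n A := \prod_(m <= j < n) comm2 (A (2 * j)%N) (A (2 * j).+1).

Lemma det_comm_prod m n A : (forall i, (i < 2 * n)%N -> \det (A i) != 0) ->
  \det (comm_prod m n A) = 1.
Proof.
move=> dA; rewrite /comm_prod big_nat_cond.
elim/big_ind: _ => [|M N dM dN|j]; first by rewrite det1.
  by rewrite det_mulmx2 dM dN mulr1.
by move=> /andP[/andP[_ jn] _]; rewrite det_comm2 // dA //; lia.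
Qed.

(** Since [W * (Y * X) = X * Y] for the commutator [W], the relation takes a form without inverses,
    linear in [Y] once [C] and [X] are fixed. *)
Lemma comm_rel_iff (X Y C : 'M[K]_2) : \det X != 0 -> \det Y != 0 ->
  comm2 X Y * C = 1 <-> C * X * Y = Y * X.
Proof.
rewrite -!unitmx2 => uX uY; set W := comm2 X Y.
have WYX : W * (Y * X) = X * Y.
  by rewrite mulrA /W /comm2 (mulrVK uY) (mulrVK uX).
have uW : W \is a GRing.unit by rewrite /W /comm2 !unitrMl ?unitrV.
rewrite -mulrA; split=> H.
  by apply: (mulrI uW); rewrite WYX [LHS]mulrA H mul1r.
have uXY : X * Y \is a GRing.unit by rewrite unitrMl.
by apply: (mulIr uXY); rewrite mul1r -[LHS]mulrA H WYX.
Qed.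

End TwoByTwoField.

Section Gen.
Variables (K : comNzRingType) (g : nat).
Implicit Types y : nat -> K.

(** Coordinates 0, 1, 2 are reserved for the first two matrices; matrix [i >= 2] owns [3 i - 3],
    [3 i - 2] and [3 i - 1], the last index in use being [6 g - 4]. The (0, 1) entry, not the
    determinant, is normalized, which keeps all entries polynomial; adjugates then replace inverses
    in [gen_comm], at the price of the factor [gen_det]. *)
Definition gen_free y i : 'M[K]_2 :=
  mx2 (y (3 * i - 3)%N) 1 (y (3 * i - 1)%N) (y (3 * i - 2)%N).

Definition gen_comm y : 'M[K]_2 := \prod_(1 <= j < g)
  (gen_free y (2 * j) * gen_free y (2 * j).+1 *
   adj2 (gen_free y (2 * j)) * adj2 (gen_free y (2 * j).+1)).

Definition gen_det y : K := \prod_(1 <= j < g)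
  (\det (gen_free y (2 * j)) * \det (gen_free y (2 * j).+1)).

(* The matrices X with \tr (C * X) = \tr X, and then the matrices Y with
   C * X * Y = Y * X, form linear spaces. They are parametrized here by their
   elements of (0, 1) entry 1, up to denominators: X by its diagonal and Y by
   its entry (1, 1). The matrix C is Ct / dl. *)
Definition gen_X (Ct : 'M[K]_2) (dl x0 x1 : K) : 'M[K]_2 :=
  mx2 (Ct 0 1 * x0) (Ct 0 1)
      (- ((Ct 0 0 - dl) * x0 + (Ct 1 1 - dl) * x1 + Ct 1 0)) (Ct 0 1 * x1).

Definition gen_Y (Ct : 'M[K]_2) (dl x0 x1 s : K) : 'M[K]_2 :=
  let u := Ct * gen_X Ct dl x0 x1 in
  mx2 (u 0 0 + u 0 1 * s - x1 * (dl * Ct 0 1)) (dl * Ct 0 1)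
      (u 1 0 + u 1 1 * s - x1 * (dl * Ct 0 1 * s)) (dl * Ct 0 1 * s).

(* Division-free representatives, up to scaling, of the matrices of a solution. *)
Definition gen y (i : nat) : 'M[K]_2 :=
  if i == 0%N then gen_X (gen_comm y) (gen_det y) (y 0%N) (y 1%N)
  else if i == 1%N then gen_Y (gen_comm y) (gen_det y) (y 0%N) (y 1%N) (y 2%N)
  else gen_free y i.

End Gen.

Section GenMorph.
Variables (K K' : comNzRingType) (f : {rmorphism K -> K'}) (g : nat) (y : nat -> K).

Lemma map_gen_free i : map_mx f (gen_free y i) = gen_free (f \o y) i.
Proof. by rewrite /gen_free map_mx2 rmorph1. Qed.

Lemma map_gen_comm : map_mx f (gen_comm g y) = gen_comm g (f \o y).
Proof.
rewrite /gen_comm rmorph_prod; apply: eq_bigr => j _.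
by rewrite !rmorphM /= !map_adj2 !map_gen_free.
Qed.

Lemma map_gen_det : f (gen_det g y) = gen_det g (f \o y).
Proof.
rewrite /gen_det rmorph_prod; apply: eq_bigr => j _.
by rewrite rmorphM /= -!det_map_mx !map_gen_free.
Qed.

Lemma map_gen_X Ct dl x0 x1 :
  map_mx f (gen_X Ct dl x0 x1) = gen_X (map_mx f Ct) (f dl) (f x0) (f x1).
Proof.
by rewrite /gen_X map_mx2 !mxE !(rmorphN, rmorphD, rmorphM, rmorphB).
Qed.

Lemma map_gen_Y Ct dl x0 x1 s :
  map_mx f (gen_Y Ct dl x0 x1 s) = gen_Y (map_mx f Ct) (f dl) (f x0) (f x1) (f s).
Proof.
have E i j : f ((Ct * gen_X Ct dl x0 x1) i j) =
    (map_mx f Ct * gen_X (map_mx f Ct) (f dl) (f x0) (f x1)) i j.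
  by rewrite -map_gen_X -rmorphM [RHS]mxE.
rewrite /gen_Y /= map_mx2 !(rmorphD, rmorphM, rmorphB, rmorphN) /= !E.
by rewrite [map_mx f Ct 0 1]mxE.
Qed.

Lemma map_gen i : map_mx f (gen g y i) = gen g (f \o y) i.
Proof.
rewrite /gen; case: ifP => _; first by rewrite map_gen_X map_gen_comm map_gen_det.
case: ifP => _; last exact: map_gen_free.
by rewrite map_gen_Y map_gen_comm map_gen_det.
Qed.

End GenMorph.

Section GenField.
Variables (K : fieldType) (g : nat).
Implicit Types (y : nat -> K) (A : nat -> 'M[K]_2).

Lemma gen_comm_prod y : (forall i, (2 <= i < 2 * g)%N -> \det (gen_free y i) != 0) ->
  gen_comm g y = gen_det g y *: comm_prod 1 g (gen_free y) /\ gen_det g y != 0.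
Proof.
move=> dy; rewrite /gen_comm /gen_det /comm_prod.
elim: {-2}g (leqnn g) => [_|n IH ng]; first by rewrite !big_geq // scale1r oner_eq0.
have [n0|n0] := posnP n; first by rewrite n0 !big_geq // scale1r oner_eq0.
rewrite !big_nat_recr //=; have [-> a0] := IH (ltnW ng).
have d0 : \det (gen_free y (2 * n)) != 0 by apply: dy; lia.
have d1 : \det (gen_free y (2 * n).+1) != 0 by apply: dy; lia.
split; last by rewrite !mulf_neq0.
rewrite !adj2_inv // -!scalerAr -!scalerAl !scalerA.
rewrite -scalerAr scalerA; congr (_ *: _); ring.
Qed.

(** The second column of the equation is how [gen_Y] is built. The first then follows from
    Cayley-Hamilton, [C * X] and [X] having the same trace and determinant; the computation
    eliminates [C 1 0] by [\det C = 1]. *)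
Lemma gen_XY_comm (C : 'M[K]_2) dl x0 x1 s : \det C = 1 -> C 0 1 != 0 ->
  C * gen_X (dl *: C) dl x0 x1 * gen_Y (dl *: C) dl x0 x1 s =
  gen_Y (dl *: C) dl x0 x1 s * gen_X (dl *: C) dl x0 x1.
Proof.
rewrite [C]mx2_eta det2E !mx2E => dC C01.
have eC : C 1 0 = (C 0 0 * C 1 1 - 1) / C 0 1.
  by rewrite -dC; field.
rewrite eC; move: (C 0 0) (C 0 1) (C 1 1) C01 => a b d b0 {eC dC}.
by apply: mx2P; rewrite /gen_Y /gen_X !(mulmx2E, mx2E, mxE) /= ; field.
Qed.

(** [C * X = Y * X * Y^-1] is conjugate to [X], so the traces agree; this linear equation expresses
    [C 0 1 * X 1 0] through the other entries of [X]. *)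
Lemma gen_X_sol (C X Y : 'M[K]_2) dl : \det X != 0 -> \det Y != 0 ->
  C * X * Y = Y * X -> X 0 1 != 0 ->
  gen_X (dl *: C) dl (X 0 0 / X 0 1) (X 1 1 / X 0 1) = (dl * C 0 1 / X 0 1) *: X.
Proof.
move=> dX dY CXY X01.
have trCX : \tr (C * X) = \tr X.
  have uY : Y \is a GRing.unit by rewrite unitmx2.
  have -> : C * X = Y * X * Y^-1 by rewrite -CXY mulrK.
  have -> : \tr (Y * X * Y^-1) = \tr (Y^-1 * (Y * X)) by exact: mxtrace_mulC.
  by rewrite mulKr.
move: trCX; rewrite !trace2E !mulmx2E => trCX.
have e : C 0 1 * X 1 0 = X 0 0 + X 1 1 - C 0 0 * X 0 0 - C 1 0 * X 0 1 - C 1 1 * X 1 1.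
  by rewrite -trCX; ring.
apply: mx2P; rewrite /gen_X ?mx2E !mxE; try by field.
rewrite (_ : dl * C 0 1 / X 0 1 * X 1 0 = dl / X 0 1 * (C 0 1 * X 1 0)); last by field.
by rewrite e; field.
Qed.

(** The second column of [C * X * Y = Y * X], divided by [X 0 1], gives the first column of [Y] in
    terms of its second one. *)
Lemma gen_Y_sol (C X Y : 'M[K]_2) dl : \det X != 0 -> \det Y != 0 ->
  C * X * Y = Y * X -> X 0 1 != 0 -> Y 0 1 != 0 ->
  gen_Y (dl *: C) dl (X 0 0 / X 0 1) (X 1 1 / X 0 1) (Y 1 1 / Y 0 1) =
  (dl ^+ 2 * C 0 1 / Y 0 1) *: Y.
Proof.
move=> dX dY CXY X01 Y01.
pose W := C * X.
have eY i : Y i 0 = (W i 0 * Y 0 1 + W i 1 * Y 1 1 - Y i 1 * X 1 1) / X 0 1.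
  by rewrite -mulmx2E CXY mulmx2E; field.
have eU i j : (dl *: C * gen_X (dl *: C) dl (X 0 0 / X 0 1) (X 1 1 / X 0 1)) i j =
    dl * (dl * C 0 1 / X 0 1) * W i j.
  rewrite (gen_X_sol dl dX dY CXY X01) -scalerAl -scalerAr scalerA -/W.
  by rewrite [LHS]mxE.
have eC : (dl *: C) 0 1 = dl * C 0 1 by rewrite mxE.
rewrite /gen_Y; apply: mx2P; rewrite mx2E [RHS]mxE ?eU ?eC.
- by rewrite [Y 0 0]eY; field; rewrite X01.
- by field.
- by rewrite [Y 1 0]eY; field; rewrite X01.
- by field.
Qed.

End GenField.

(** Every coordinate is a quotient by a (0, 1) entry, hence insensitive to scaling each matrix. For
    [k >= 3], the matrix is number [k %/ 3 + 1] and the residue selects the entry, in the order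
    fixed by [gen_free]. *)
Definition gen_coord (K : fieldType) (A : nat -> 'M[K]_2) (k : nat) : K :=
  if k == 0%N then A 0%N 0 0 / A 0%N 0 1
  else if k == 1%N then A 0%N 1 1 / A 0%N 0 1
  else if k == 2%N then A 1%N 1 1 / A 1%N 0 1
  else let i := (k %/ 3).+1 in
    (if (k %% 3 == 0)%N then A i 0 0
     else if (k %% 3 == 1)%N then A i 1 1 else A i 1 0) / A i 0 1.

Section GenSol.
Variables (K : fieldType) (g : nat).
Implicit Types (y : nat -> K) (A : nat -> 'M[K]_2).

Lemma gen_coord_free A i : (2 <= i)%N ->
  [/\ gen_coord A (3 * i - 3) = A i 0 0 / A i 0 1,
      gen_coord A (3 * i - 2) = A i 1 1 / A i 0 1 &
      gen_coord A (3 * i - 1) = A i 1 0 / A i 0 1].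
Proof.
case: i => [|[|i]] // _.
have -> : (3 * i.+2 - 3 = i.+1 * 3 + 0)%N by lia.
have -> : (3 * i.+2 - 2 = i.+1 * 3 + 1)%N by lia.
have -> : (3 * i.+2 - 1 = i.+1 * 3 + 2)%N by lia.
have E r n : (n < 3)%N -> (i.+1 * 3 + r == n)%N = false by move=> ?; apply/eqP; lia.
by split; rewrite /gen_coord !E // modnMDl divnMDl // addn0.
Qed.

Lemma gen_free_coord A y i : (2 <= i)%N -> A i 0 1 != 0 ->
  (forall k, (3 <= k < 3 * i)%N -> y k = gen_coord A k) ->
  gen_free y i = (A i 0 1)^-1 *: A i.
Proof.
move=> i2 A01 yA; have [e0 e1 e2] := gen_coord_free A i2.
rewrite /gen_free !yA ?e0 ?e1 ?e2; try lia.
by apply: mx2P; rewrite mx2E [RHS]mxE 1?mulrC // mulfV.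
Qed.

Lemma comm_prod_ext m n A B : (forall i, (2 * m <= i < 2 * n)%N ->
    exists2 a : K, a != 0 & B i = a *: A i) ->
  (forall i, (2 * m <= i < 2 * n)%N -> \det (A i) != 0) ->
  comm_prod m n B = comm_prod m n A.
Proof.
move=> AB dA; apply: eq_big_nat => j /andP[mj jn].
have [a a0 ->] := AB (2 * j)%N ltac:(lia).
have [b b0 ->] := AB (2 * j).+1 ltac:(lia).
by rewrite comm2Z // dA; lia.
Qed.

Section FromSolution.
Variables (A : nat -> 'M[K]_2) (y : nat -> K).
Hypotheses (g0 : (0 < g)%N) (dA : forall i, (i < 2 * g)%N -> \det (A i) = 1).
Hypothesis A01 : forall i, (i < 2 * g)%N -> A i 0 1 != 0.
Hypothesis yA : forall k, (k < 6 * g - 3)%N -> y k = gen_coord A k.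

Lemma gen_comm_coord :
  gen_comm g y = gen_det g y *: comm_prod 1 g A /\ gen_det g y != 0.
Proof.
have freeE i : (2 <= i < 2 * g)%N -> gen_free y i = (A i 0 1)^-1 *: A i.
  move=> /andP[i2 ig]; apply: gen_free_coord => //; first exact: A01.
  by move=> k /andP[k3 ki]; apply: yA; lia.
have [|Ct dl0] := @gen_comm_prod K g y.
  move=> i ig; have /andP[_ i2g] := ig.
  by rewrite freeE // detZ dA // mulr1 expf_neq0 // invr_eq0 A01.
split=> //; rewrite Ct; congr (_ *: _); apply: comm_prod_ext => i ig.
  exists (A i 0 1)^-1; first by rewrite invr_eq0 A01 //; lia.
  by apply: freeE; lia.
by rewrite dA ?oner_eq0 //; lia.
Qed.

Lemma gen_sol : comm_prod 0 g A = 1 -> comm_prod 1 g A 0 1 != 0 ->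
  forall i, (i < 2 * g)%N -> exists2 a, a != 0 & gen g y i = a *: A i.
Proof.
move=> relA C01; have [CtE dl0] := gen_comm_coord.
set C := comm_prod 1 g A in CtE C01.
have dX : \det (A 0%N) != 0 by rewrite dA ?oner_eq0 //; lia.
have dY : \det (A 1%N) != 0 by rewrite dA ?oner_eq0 //; lia.
have X01 : A 0%N 0 1 != 0 by apply: A01; lia.
have Y01 : A 1%N 0 1 != 0 by apply: A01; lia.
have CXY : C * A 0%N * A 1%N = A 1%N * A 0%N.
  apply/comm_rel_iff => //; rewrite -[RHS]relA /comm_prod.
  by rewrite [RHS]big_ltn.
have y0 : y 0%N = A 0%N 0 0 / A 0%N 0 1 by rewrite yA //; lia.
have y1 : y 1%N = A 0%N 1 1 / A 0%N 0 1 by rewrite yA //; lia.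
have y2 : y 2%N = A 1%N 1 1 / A 1%N 0 1 by rewrite yA //; lia.
rewrite /gen CtE y0 y1 y2 => i ig.
case: eqP => [->|/eqP i0].
  rewrite (gen_X_sol _ dX dY CXY X01); eexists; last by [].
  by rewrite !mulf_neq0 // ?invr_eq0.
case: eqP => [->|/eqP i1].
  rewrite (gen_Y_sol _ dX dY CXY X01 Y01); eexists; last by [].
  by rewrite !mulf_neq0 // ?invr_eq0.
exists (A i 0 1)^-1; first by rewrite invr_eq0 A01.
apply: gen_free_coord; [lia|exact: A01|].
by move=> k /andP[k3 ki]; apply: yA; lia.
Qed.

End FromSolution.

(** Nonzero determinants are the only condition to impose: [gen_comm g y 0 1 = 0] would make the
    first row of [gen_X] vanish. *)
Lemma gen_ok y : (0 < g)%N -> (forall i, (i < 2 * g)%N -> \det (gen g y i) != 0) ->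
  [/\ comm_prod 0 g (gen g y) = 1, gen_comm g y 0 1 != 0 & gen_det g y != 0].
Proof.
move=> g0 dgen.
have freeZ i : (2 <= i < 2 * g)%N -> \det (gen_free y i) != 0.
  move=> /andP[i2 ig]; have := dgen i ig; rewrite /gen.
  by case: i i2 {ig} => [|[|i]].
have [Ct dl0] := gen_comm_prod freeZ.
have dX : \det (gen g y 0%N) != 0 by apply: dgen; lia.
have Ct01 : gen_comm g y 0 1 != 0.
  apply: contraNneq dX => Ct0.
  by rewrite /gen /= /gen_X Ct0 det2E !mx2E !mul0r subrr.
split=> //.
have dY : \det (gen g y 1%N) != 0 by apply: dgen; lia.
pose C := comm_prod 1 g (gen_free y).
have dC : \det C = 1.
  rewrite /C /comm_prod big_nat_cond; elim/big_ind: _ => [|M N dM dN|j].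
  - by rewrite det1.
  - by rewrite det_mulmx2 dM dN mulr1.
  - by move=> /andP[/andP[j1 jg] _]; apply: det_comm2; apply: freeZ; lia.
have C01 : C 0 1 != 0.
  by apply: contraNneq Ct01; rewrite Ct mxE => ->; rewrite mulr0.
have CXY : C * gen g y 0%N * gen g y 1%N = gen g y 1%N * gen g y 0%N.
  by rewrite /gen /= Ct; apply: gen_XY_comm.
have := (comm_rel_iff _ dX dY).2 CXY.
have -> : C = comm_prod 1 g (gen g y).
  apply: eq_big_nat => j /andP[j1 jg]; rewrite /gen.
  by case: j j1 {jg} => // j _; rewrite mulnS.
by move=> H; rewrite -[RHS]H /comm_prod [LHS]big_ltn.
Qed.

Lemma gen_coord_gen y A : (0 < g)%N ->
  (forall i, (i < 2 * g)%N -> \det (gen g y i) != 0) ->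
  (forall i, (i < 2 * g)%N -> exists2 a, a != 0 & A i = a *: gen g y i) ->
  forall k, (k < 6 * g - 3)%N -> gen_coord A k = y k.
Proof.
move=> g0 dgen Agen k kg; have [_ Ct01 dl0] := gen_ok g0 dgen.
have [a a0 A0] := Agen 0%N ltac:(lia); have [b b0 A1] := Agen 1%N ltac:(lia).
have A0E i j : A 0%N i j = a * gen g y 0 i j by rewrite A0 mxE.
have A1E i j : A 1%N i j = b * gen g y 1 i j by rewrite A1 mxE.
rewrite /gen_coord; case: eqP => [->|/eqP k0].
  by rewrite !A0E /gen /= !mx2E; field; rewrite a0 Ct01.
case: eqP => [->|/eqP k1].
  by rewrite !A0E /gen /= !mx2E; field; rewrite a0 Ct01.
case: eqP => [->|/eqP k2].
  by rewrite !A1E /gen /= !mx2E; field; rewrite b0 dl0 Ct01.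
have i2 : (2 <= (k %/ 3).+1)%N by rewrite ltnS divn_gt0; lia.
have kmod := divn_eq k 3; have lt3 : (k %% 3 < 3)%N by rewrite ltn_mod.
move: i2 kmod lt3; move: (k %/ 3)%N (k %% 3)%N => q r i2 kmod lt3 /=.
have [c c0 Aq] := Agen q.+1 ltac:(lia).
have AqE i j : A q.+1 i j = c * gen_free y q.+1 i j.
  by rewrite Aq mxE /gen; case: q i2 {kmod Aq}.
rewrite !AqE !mx2E mulr1.
case: r kmod lt3 => [|[|[|//]]] kmod _ /=; by rewrite mulrC mulKf // kmod; congr (y _); lia.
Qed.

End GenSol.

(** * Functions that are Lipschitz near a point *)

Section LocLip.
Variables (R : realType) (V : normedModType R) (x0 : V).
Implicit Types f g : V -> R.

Definition loc_lip f : Prop := exists C r : R, 0 < r /\ forall x y,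
  `|x - x0| < r -> `|y - x0| < r -> `|f x - f y| <= C * `|x - y|.

Lemma loc_lip_near f e : loc_lip f -> 0 < e ->
  exists2 r : R, 0 < r & forall x, `|x - x0| < r -> `|f x - f x0| < e.
Proof.
move=> [C [r [r0 fC]]] e0; exists (Num.min r (e / (`|C| + 1))).
  by rewrite lt_min r0 divr_gt0 // ltr_wpDl.
move=> x; rewrite lt_min => /andP[xr xe].
have := fC x x0 xr; rewrite subrr normr0 => /(_ r0) /le_lt_trans; apply.
rewrite ltr_pdivlMr ?ltr_wpDl // in xe; apply: le_lt_trans xe.
rewrite mulrC; apply: ler_wpM2l => //; apply: le_trans (ler_norm _) _.
by rewrite lerDl.
Qed.

Lemma loc_lip_cst a : loc_lip (fun=> a).
Proof. by exists 0, 1; split=> // x y _ _; rewrite subrr normr0 mul0r. Qed.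

Lemma loc_lipM f g : loc_lip f -> loc_lip g -> loc_lip (fun x => f x * g x).
Proof.
move=> lf lg; have [rf rf0 fb] := loc_lip_near lf ltr01.
have [rg rg0 gb] := loc_lip_near lg ltr01.
have [Cf [r1 [r10 fC]]] := lf; have [Cg [r2 [r20 gC]]] := lg.
exists ((`|f x0| + 1) * `|Cg| + `|Cf| * (`|g x0| + 1)).
exists (Num.min (Num.min rf rg) (Num.min r1 r2)); rewrite !lt_min rf0 rg0 r10; split=> //.
move=> x y; rewrite !lt_min => /andP[/andP[xf xg] /andP[x1 x2]].
move=> /andP[/andP[yf yg] /andP[y1 y2]].
have -> : f x * g x - f y * g y = f x * (g x - g y) + (f x - f y) * g y by ring.
have bnd (h : V -> R) z : `|h z - h x0| < 1 -> `|h z| <= `|h x0| + 1.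
  move=> hz; rewrite -{1}[h z](subrK (h x0)) addrC.
  by apply: le_trans (ler_normD _ _) _; rewrite lerD2l ltW.
apply: le_trans (ler_normD _ _) _; rewrite [leRHS]mulrDl !normrM; apply: lerD.
  rewrite -mulrA; apply: ler_pM => //; first exact/bnd/fb.
  by apply: le_trans (gC _ _ x2 y2) _; apply: ler_wpM2r => //; exact: ler_norm.
rewrite mulrAC; apply: ler_pM => //; last exact/bnd/gb.
by apply: le_trans (fC _ _ x1 y1) _; apply: ler_wpM2r => //; exact: ler_norm.
Qed.

Lemma loc_lip_comp f (h : R -> R) (e C : R) : 0 < e -> loc_lip f ->
  (forall a b, `|a - f x0| < e -> `|b - f x0| < e -> `|h a - h b| <= C * `|a - b|) ->
  loc_lip (fun x => h (f x)).
Proof.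
move=> e0 lf hC; have [r rP fr] := loc_lip_near lf e0.
have [D [r1 [r10 fD]]] := lf.
exists (`|C| * `|D|), (Num.min r r1); rewrite lt_min rP r10; split=> // x y.
rewrite !lt_min => /andP[xr x1] /andP[yr y1].
apply: le_trans (hC _ _ (fr _ xr) (fr _ yr)) _.
apply: (@le_trans _ _ (`|C| * `|f x - f y|)); first by apply: ler_wpM2r => //; exact: ler_norm.
rewrite -mulrA; apply: ler_wpM2l => //; apply: le_trans (fD _ _ x1 y1) _.
by apply: ler_wpM2r => //; exact: ler_norm.
Qed.

Lemma loc_lipV f : f x0 != 0 -> loc_lip f -> loc_lip (fun x => (f x)^-1).
Proof.
move=> f0 lf; set m := `|f x0|; have m0 : 0 < m by rewrite normr_gt0.
apply: (@loc_lip_comp f (fun a => a^-1) (m / 2) (4 / m ^+ 2)) => //.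
  by rewrite divr_gt0.
have bnd a : `|a - f x0| < m / 2 -> m / 2 <= `|a|.
  move=> am; have := lerB_dist (f x0) (f x0 - a).
  rewrite subKr distrC -/m; lra.
move=> a b /bnd ha /bnd hb.
have a0 : a != 0 by rewrite -normr_gt0; apply: lt_le_trans ha; rewrite divr_gt0.
have b0 : b != 0 by rewrite -normr_gt0; apply: lt_le_trans hb; rewrite divr_gt0.
have -> : a^-1 - b^-1 = (a * b)^-1 * (b - a) by field; rewrite a0 b0.
rewrite normrM distrC; apply: ler_wpM2r => //.
rewrite normfV normrM.
have -> : 4 / m ^+ 2 = (m / 2 * (m / 2))^-1 by field; rewrite gt_eqF.
rewrite lef_pV2 ?posrE ?mulr_gt0 ?normr_gt0 ?divr_gt0 //.
by apply: ler_pM => //; rewrite ltW // divr_gt0.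
Qed.

Lemma loc_lip_sqrt f : 0 < f x0 -> loc_lip f -> loc_lip (fun x => Num.sqrt (f x)).
Proof.
move=> f0 lf.
apply: (@loc_lip_comp f Num.sqrt (f x0 / 2) (Num.sqrt (f x0 / 2))^-1) => //.
  by rewrite divr_gt0.
set m := f x0 / 2; have m0 : 0 < m by rewrite divr_gt0.
have bnd a : `|a - f x0| < m -> m <= a.
  by rewrite /m ltr_norml => /andP[? ?]; lra.
move=> a b /bnd ha /bnd hb.
have a0 : 0 < a by exact: lt_le_trans ha.
have b0 : 0 < b by exact: lt_le_trans hb.
rewrite ler_pdivlMl ?sqrtr_gt0 //.
have -> : a - b = (Num.sqrt a + Num.sqrt b) * (Num.sqrt a - Num.sqrt b).
  by rewrite mulrC -subr_sqr !sqr_sqrtr // ltW.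
rewrite normrM; apply: ler_wpM2r => //.
rewrite ger0_norm ?addr_ge0 ?sqrtr_ge0 //.
by apply: ler_wpDr; [exact: sqrtr_ge0|exact: ler_wsqrtr].
Qed.

End LocLip.

Lemma loc_lip_mx (R : realType) (V : normedModType R) (x0 : V) m n
    (F : V -> 'M[R]_(m, n)) :
  (forall i j, loc_lip x0 (fun x => F x i j)) ->
  exists C r : R, 0 < r /\ forall x y,
    `|x - x0| < r -> `|y - x0| < r -> `|F x - F y| <= C * `|x - y|.
Proof.
move=> FL.
have /choice[C /choice[r rP]] : forall p : 'I_m * 'I_n, exists C r : R, 0 < r /\
    forall x y, `|x - x0| < r -> `|y - x0| < r ->
    `|F x p.1 p.2 - F y p.1 p.2| <= C * `|x - y| by case=> i j; exact: FL.
exists (\sum_p `|C p|), (\big[Num.min/1]_p r p); split.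
  by apply: lt_bigmin => // p _; exact: (rP p).1.
move=> x y xr yr; apply: mx_norm_le => [|i j].
  by rewrite mulr_ge0 // sumr_ge0.
have le_r z : `|z - x0| < \big[Num.min/1]_p r p -> `|z - x0| < r (i, j).
  by move=> /lt_le_trans; apply; exact: bigmin_le_cond.
rewrite !mxE; apply: le_trans ((rP (i, j)).2 x y (le_r _ xr) (le_r _ yr)) _.
apply: ler_wpM2r => //; apply: le_trans (ler_norm _) _.
by rewrite (bigD1 (i, j)) //= lerDl sumr_ge0.
Qed.

Lemma loc_lip_ipoly (R : realType) N (y0 : 'rV[R]_N) (f : ipoly N) :
  loc_lip y0 (fun Y => ipoly_eval N (coord_fun Y) f).
Proof.
have [C C0 CP] := ipoly_eval_lipschitz (`|y0| + 1) f.
exists C, 1; split=> // x y xr yr.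
have bnd (z : 'rV[R]_N) i (iN : (i < N)%N) : `|z - y0| < 1 -> `|coord_fun z i| <= `|y0| + 1.
  move=> zr; rewrite (coord_funE z (Ordinal iN)).
  apply: le_trans (ler_mx_norm _ _ _) _; rewrite -[z](subrK y0) addrC.
  by apply: le_trans (ler_normD _ _) _; rewrite lerD2l ltW.
apply: (CP _ _ `|x - y| _ _).2 => // i iN; split; try exact: bnd.
rewrite (coord_funE x (Ordinal iN)) (coord_funE y (Ordinal iN)).
by have := ler_mx_norm (x - y) 0 (Ordinal iN); rewrite !mxE.
Qed.

(** * Conjugation by integral unipotent matrices *)

Section Shear.
Variables (K : comNzRingType) (k : nat).

Definition shear : 'M[K]_2 := mx2 1 k%:R 0 1.
Definition unshear : 'M[K]_2 := mx2 1 (- k%:R) 0 1.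

Lemma shearK : shear * unshear = 1.
Proof. by apply: mx2P; rewrite mulmx2E !mx2E !mxE /= ?mulr1n ?mulr0n; ring. Qed.

Lemma unshearK : unshear * shear = 1.
Proof. by apply: mx2P; rewrite mulmx2E !mx2E !mxE /= ?mulr1n ?mulr0n; ring. Qed.

Definition sconj (M : 'M[K]_2) : 'M[K]_2 := shear * M * unshear.
Definition unsconj (M : 'M[K]_2) : 'M[K]_2 := unshear * M * shear.

Lemma sconjK M : unsconj (sconj M) = M.
Proof.
by rewrite /sconj /unsconj !mulrA unshearK mul1r -mulrA unshearK mulr1.
Qed.

Lemma unsconjK M : sconj (unsconj M) = M.
Proof.
by rewrite /sconj /unsconj !mulrA shearK mul1r -mulrA shearK mulr1.
Qed.

Lemma sconjM M N : sconj (M * N) = sconj M * sconj N.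
Proof. by rewrite /sconj -!mulrA (mulrA unshear) unshearK mul1r. Qed.

Lemma sconj1 : sconj 1 = 1.
Proof. by rewrite /sconj mulr1 shearK. Qed.

Lemma det_sconj M : \det (sconj M) = \det M.
Proof.
rewrite /sconj; have -> : \det (shear * M * unshear) = \det shear * \det M * \det unshear.
  by rewrite -!det_mulmx.
by rewrite !det2E !mx2E; ring.
Qed.

Lemma tr_sconj M : \tr (sconj M) = \tr M.
Proof.
have -> : \tr (sconj M) = \tr (unshear * (shear * M)) by exact: mxtrace_mulC.
by rewrite mulrA unshearK mul1r.
Qed.

Lemma sconj_prod (I : Type) (s : seq I) (P : pred I) (F : I -> 'M[K]_2) :
  sconj (\prod_(i <- s | P i) F i) = \prod_(i <- s | P i) sconj (F i).
Proof. by apply: big_morph; [exact: sconjM|exact: sconj1]. Qed.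

End Shear.

Lemma sconj_inv (K : fieldType) k (M : 'M[K]_2) : \det M != 0 ->
  (sconj k M)^-1 = sconj k M^-1.
Proof.
move=> dM; have uM : M \is a GRing.unit by rewrite unitmx2.
have uS : sconj k M \is a GRing.unit by rewrite unitmx2 det_sconj.
by apply: (mulrI uS); rewrite mulrV // -sconjM mulrV // sconj1.
Qed.

Lemma sconj_comm2 (K : fieldType) k (M N : 'M[K]_2) : \det M != 0 -> \det N != 0 ->
  comm2 (sconj k M) (sconj k N) = sconj k (comm2 M N).
Proof. by move=> dM dN; rewrite /comm2 !sconjM !sconj_inv. Qed.

(** The (0, 1) entry of [sconj k M] is the polynomial [M 0 1 + (M 1 1 - M 0 0) k - M 1 0 k ^ 2],
    which is identically zero only for scalar [M]. The product over the list has finitely many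
    roots, so some natural number avoids them. *)
Lemma exists_shear (K : numFieldType) (s : seq 'M[K]_2) :
  (forall M, M \in s -> forall a, M != a%:M) ->
  exists k, forall M, M \in s -> sconj k M 0 1 != 0.
Proof.
move=> sM.
pose q (M : 'M[K]_2) : {poly K} :=
  (M 0 1)%:P + (M 1 1 - M 0 0) *: 'X - M 1 0 *: 'X^2.
have qE (M : 'M[K]_2) k : (q M).[k%:R] = sconj k M 0 1.
  rewrite /q !(hornerD, hornerN, hornerZ, hornerC, hornerX, hornerXn).
  by rewrite /sconj !mulmx2E !mx2E; ring.
have q0 M : M \in s -> q M != 0.
  move=> /sM Mns; apply/negP => /eqP q0.
  have c (i : nat) : (q M)`_i = 0 by rewrite q0 coef0.
  have c0 := c 0%N; have c1 := c 1%N; have c2 := c 2%N.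
  rewrite /q !(coefD, coefC, coefZ, coefX, coefXn, coefN) /= in c0 c1 c2.
  rewrite !(mulr0, mulr1, addr0, add0r, subr0, oppr0) in c0 c1 c2.
  have /negP := Mns (M 0 0); apply; apply/eqP/mx2P; rewrite !mxE /= ?mulr1n ?mulr0n //.
    by apply/eqP; rewrite -oppr_eq0 c2.
  by apply/eqP; rewrite -subr_eq0 c1.
pose p := \prod_(M <- s) q M.
have p0 : p != 0 by rewrite prodf_seq_neq0; apply/allP => M Ms; exact: q0.
have [k pk] : exists k : nat, p.[k%:R] != 0.
  apply/not_existsP => allroot.
  have := @max_poly_roots _ p [seq i%:R | i <- iota 0 (size p)] p0.
  rewrite size_map size_iota ltnn => h; apply: notF; apply: h.
    by apply/allP => _ /mapP[i _ ->]; have /negP := allroot i; rewrite negbK.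
  by rewrite map_inj_uniq ?iota_uniq // => i j /eqP; rewrite eqr_nat => /eqP.
exists k => M Ms; rewrite -qE.
by move: pk; rewrite /p horner_prod prodf_seq_neq0 => /allP/(_ M Ms).
Qed.

(** * Points of the representation variety as sequences of matrices *)

Section Tuples.
Variables (R : realType) (g : nat).
Implicit Types A : tuple_space R g.

Definition tuple_nat A (i : nat) : 'M[R]_2 := oapp (tuple_entry A) 1 (insub i).

Lemma tuple_natE A (i : 'I_(2 * g)) : tuple_nat A i = tuple_entry A i.
Proof. by rewrite /tuple_nat valK. Qed.

Definition tuple_space_of (F : nat -> 'M[R]_2) : tuple_space R g :=
  mxvec (\matrix_(i < 2 * g) mxvec (F i)).

Lemma tuple_space_of_entry F (i : 'I_(2 * g)) : tuple_entry (tuple_space_of F) i = F i.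
Proof. by rewrite /tuple_entry /tuple_space_of mxvecK rowK mxvecK. Qed.

Lemma tuple_space_of_nat F i : (i < 2 * g)%N -> tuple_nat (tuple_space_of F) i = F i.
Proof. by move=> ig; rewrite (tuple_natE _ (Ordinal ig)) tuple_space_of_entry. Qed.

Lemma tuple_space_ofP A F : (forall i, (i < 2 * g)%N -> tuple_nat A i = F i) ->
  A = tuple_space_of F.
Proof.
move=> AF; rewrite /tuple_space_of -[LHS]vec_mxK; congr mxvec.
apply/row_matrixP => i; rewrite rowK -[LHS]vec_mxK; congr mxvec.
by rewrite -AF // tuple_natE.
Qed.

Lemma G_setP A : G_set A <->
  (forall i, (i < 2 * g)%N -> \det (tuple_nat A i) = 1) /\
  comm_prod 0 g (tuple_nat A) = 1.
Proof.
have -> : comm_prod 0 g (tuple_nat A) =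
    \prod_(i < g) commutator_mx (tuple_entry A (odd_gen i)) (tuple_entry A (even_gen i)).
  rewrite /comm_prod big_mkord; apply: eq_bigr => i _.
  by rewrite -!tuple_natE.
split=> -[dA relA]; split=> // i.
  by move=> ig; rewrite (tuple_natE _ (Ordinal ig)).
by rewrite -tuple_natE; apply: dA.
Qed.

Definition sheared k A i := sconj k (tuple_nat A i).

Lemma sheared_sol k A : G_set A ->
  (forall i, (i < 2 * g)%N -> \det (sheared k A i) = 1) /\
  comm_prod 0 g (sheared k A) = 1.
Proof.
move=> /G_setP[dA relA]; split=> [i ig|]; first by rewrite det_sconj dA.
rewrite -(sconj1 _ k) -relA /comm_prod sconj_prod; apply: eq_big_nat => j jg.
by rewrite sconj_comm2 // dA ?oner_eq0 //; lia.
Qed.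

Lemma unsheared_sol k (F : nat -> 'M[R]_2) :
  (forall i, (i < 2 * g)%N -> \det (F i) = 1) -> comm_prod 0 g F = 1 ->
  G_set (tuple_space_of (fun i => unsconj k (F i))).
Proof.
move=> dF relF; apply/G_setP.
have FE i : (i < 2 * g)%N ->
    tuple_nat (tuple_space_of (fun i => unsconj k (F i))) i = unsconj k (F i).
  exact: tuple_space_of_nat.
have dU i : (i < 2 * g)%N -> \det (unsconj k (F i)) = 1.
  by move=> ig; rewrite -(det_sconj k) unsconjK dF.
split=> [i ig|]; first by rewrite FE // dU.
rewrite -[LHS](sconjK k) (_ : sconj k _ = 1) ?(sconjK k 1) //.
  by rewrite -{1}(sconj1 _ k) sconjK.
rewrite -relF /comm_prod sconj_prod; apply: eq_big_nat => j jg.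
have d0 : \det (unsconj k (F (2 * j)%N)) != 0 by rewrite dU ?oner_eq0 //; lia.
have d1 : \det (unsconj k (F (2 * j).+1)) != 0 by rewrite dU ?oner_eq0 //; lia.
by rewrite !FE ?(sconj_comm2 k d0 d1) -?sconj_comm2 // ?unsconjK //; lia.
Qed.

End Tuples.

(** * Charts of the representation variety *)

Lemma differentiable_rowP (R : realType) (V : normedModType R) n
    (F : V -> 'rV[R]_n) x :
  (forall j, differentiable (fun v => F v 0 j) x) -> differentiable F x.
Proof.
move=> dF.
have -> : F = \sum_j (fun v => F v 0 j *: delta_mx 0 j).
  by apply/funext => v; rewrite fct_sumE [LHS]row_sum_delta.
apply: differentiable_sum => j.
by apply: (@differentiableZl R V _ (fun v => F v 0 j)); exact: dF.
Qed.

Lemma map_unsconj (K K' : comNzRingType) (f : {rmorphism K -> K'}) k (M : 'M[K]_2) :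
  map_mx f (unsconj k M) = unsconj k (map_mx f M).
Proof.
rewrite /unsconj !rmorphM /= /shear /unshear !map_mx2.
by rewrite !(rmorph1, rmorph0, rmorphN, rmorph_nat).
Qed.

Section Chart.
Variables (R : realType) (g k : nat) (A0 : tuple_space R g).
Hypothesis g0 : (0 < g)%N.
Hypothesis GA0 : G_set A0.
Implicit Types A : tuple_space R g.

Notation N := (6 * g - 3)%N.

(* These (0, 1) entries are the denominators of the parametrization. *)
Definition shear_generic A : Prop :=
  (forall i, (i < 2 * g)%N -> sheared k A i 0 1 != 0) /\
  comm_prod 1 g (sheared k A) 0 1 != 0.

Definition chart_coord A : 'rV[R]_N := \row_j gen_coord (sheared k A) j.

Hypothesis good : shear_generic A0.

Let y0 := chart_coord A0.

Lemma chart_coordE A j : (j < N)%N ->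
  coord_fun (chart_coord A) j = gen_coord (sheared k A) j.
Proof. by move=> jN; rewrite (coord_funE _ (Ordinal jN)) mxE. Qed.

Lemma coord_fun_var (Y : 'rV[R]_N) :
  coord_fun Y = ipoly_eval N (coord_fun Y) \o ipoly_var N.
Proof.
apply/funext => j /=; case: (ltnP j N) => jN; first by rewrite ipoly_eval_var.
rewrite /coord_fun insubF; last by apply/negbTE; rewrite -leqNgt.
have -> : ipoly_var N j = 0; last by rewrite rmorph0.
by elim: N j jN => [//|n IH] [|j] //= jn; rewrite IH.
Qed.

Lemma gen_ipoly (Y : 'rV[R]_N) i :
  gen g (coord_fun Y) i =
  map_mx (ipoly_eval N (coord_fun Y)) (gen g (ipoly_var N) i).
Proof. by rewrite map_gen -coord_fun_var. Qed.

(* gen determines a matrix of determinant 1 up to sign only; the sign is the one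
   of the base point A0. *)
Definition chart_scale (Y : 'rV[R]_N) i : R :=
  let M := gen g (coord_fun Y) i in
  Num.sg (sheared k A0 i 0 1) / (M 0 1 * Num.sqrt (\det M / M 0 1 ^+ 2)).

Definition chart_inv (Y : 'rV[R]_N) : tuple_space R g :=
  tuple_space_of g (fun i => unsconj k (chart_scale Y i *: gen g (coord_fun Y) i)).

Lemma gen01_neq0 (Y : 'rV[R]_N) :
  (forall i, (i < 2 * g)%N -> 0 < \det (gen g (coord_fun Y) i)) ->
  forall i, (i < 2 * g)%N -> gen g (coord_fun Y) i 0 1 != 0.
Proof.
move=> dgen i ig.
have [|_ Ct01 dl0] := @gen_ok R g (coord_fun Y) g0.
  by move=> j jg; rewrite gt_eqF // dgen.
rewrite /gen; case: (i =P 0%N) => _; first by rewrite /gen_X mx2E.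
case: (i =P 1%N) => _; first by rewrite /gen_Y mx2E mulf_neq0.
by rewrite /gen_free mx2E oner_eq0.
Qed.

(** The alternative serves two uses. At the base point the entry of [comm_prod] is known to be
    nonzero; at nearby points only the determinants are controlled, and [gen_ok] with
    [gen_comm_coord] recovers the same fact. *)
Lemma sheared_gen A : G_set A ->
  (forall i, (i < 2 * g)%N -> sheared k A i 0 1 != 0) ->
  (comm_prod 1 g (sheared k A) 0 1 != 0 \/ forall i, (i < 2 * g)%N ->
     0 < \det (gen g (coord_fun (chart_coord A)) i)) ->
  forall i, (i < 2 * g)%N -> exists2 a, a != 0 &
    gen g (coord_fun (chart_coord A)) i = a *: sheared k A i.
Proof.
move=> GA A01 C01; have [dA relA] := sheared_sol k GA.
have yA j : (j < N)%N -> coord_fun (chart_coord A) j = gen_coord (sheared k A) j.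
  exact: chart_coordE.
apply: gen_sol => //; case: C01 => // dgen.
have [CtE dl0] := gen_comm_coord g0 dA A01 yA.
have [|_ Ct01 _] := @gen_ok R g (coord_fun (chart_coord A)) g0.
  by move=> j jg; rewrite gt_eqF // dgen.
by apply: contraNneq Ct01; rewrite CtE mxE => ->; rewrite mulr0.
Qed.

Lemma det_gen_y0 i : (i < 2 * g)%N -> 0 < \det (gen g (coord_fun y0) i).
Proof.
move=> ig; have [a a0 ->] := sheared_gen GA0 good.1 (or_introl good.2) ig.
have [dA _] := sheared_sol k GA0.
by rewrite detZ dA // mulr1 exprn_even_gt0.
Qed.

Lemma chart_scale_sq (Y : 'rV[R]_N) i :
  0 < \det (gen g (coord_fun Y) i) -> gen g (coord_fun Y) i 0 1 != 0 ->
  sheared k A0 i 0 1 != 0 ->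
  chart_scale Y i ^+ 2 * \det (gen g (coord_fun Y) i) = 1 /\ chart_scale Y i != 0.
Proof.
rewrite /chart_scale; set M := gen _ _ _; move=> dM M01 s0.
have q0 : 0 < \det M / M 0 1 ^+ 2 by rewrite divr_gt0 // exprn_even_gt0.
have sq0 : Num.sqrt (\det M / M 0 1 ^+ 2) != 0 by rewrite gt_eqF // sqrtr_gt0.
split; last by rewrite mulf_neq0 ?sgr_eq0 // invr_eq0 mulf_neq0.
rewrite expr_div_n sqr_sg s0 exprMn sqr_sqrtr ?ltW //=.
by field; rewrite M01 gt_eqF.
Qed.

Lemma loc_lip_gen (Y0 : 'rV[R]_N) i a b :
  loc_lip Y0 (fun Y => gen g (coord_fun Y) i a b).
Proof.
rewrite (_ : (fun Y : 'rV[R]_N => _) = fun Y =>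
    ipoly_eval N (coord_fun Y) (gen g (ipoly_var N) i a b)).
  exact: loc_lip_ipoly.
by apply/funext => Y; rewrite gen_ipoly mxE.
Qed.

Lemma loc_lip_det_gen (Y0 : 'rV[R]_N) i :
  loc_lip Y0 (fun Y => \det (gen g (coord_fun Y) i)).
Proof.
rewrite (_ : (fun Y : 'rV[R]_N => _) = fun Y =>
    ipoly_eval N (coord_fun Y) (\det (gen g (ipoly_var N) i))).
  exact: loc_lip_ipoly.
by apply/funext => Y; rewrite gen_ipoly det_map_mx.
Qed.

Lemma near_y0 : exists2 r : R, 0 < r & forall Y, `|Y - y0| < r ->
  forall i, (i < 2 * g)%N -> 0 < \det (gen g (coord_fun Y) i).
Proof.
have /choice[r rP] : forall i : 'I_(2 * g), exists r : R, 0 < r /\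
    forall Y, `|Y - y0| < r -> 0 < \det (gen g (coord_fun Y) i).
  move=> i; have d0 := det_gen_y0 (ltn_ord i).
  have [r r0 rP] := loc_lip_near (loc_lip_det_gen y0 i) d0.
  exists r; split=> // Y /rP; rewrite ltr_norml => /andP[+ _].
  by rewrite ltrBrDl subrr.
exists (\big[Num.min/1]_i r i); first by apply: lt_bigmin => // i _; exact: (rP i).1.
move=> Y Yr i ig; apply: ((rP (Ordinal ig)).2 Y).
by apply: lt_le_trans Yr _; exact: bigmin_le_cond.
Qed.

Lemma chart_inv_sol Y : (forall i, (i < 2 * g)%N -> 0 < \det (gen g (coord_fun Y) i)) ->
  G_set (chart_inv Y) /\ chart_coord (chart_inv Y) = Y.
Proof.
move=> dgen; have g01 := gen01_neq0 dgen.
have [|relY _ _] := @gen_ok R g (coord_fun Y) g0.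
  by move=> j jg; rewrite gt_eqF // dgen.
have cs i (ig : (i < 2 * g)%N) :=
  chart_scale_sq (dgen i ig) (g01 i ig) (good.1 i ig).
split.
  apply: unsheared_sol => [i ig|]; first by rewrite detZ (cs i ig).1.
  rewrite -relY; apply: comm_prod_ext => i /andP[_ ig].
    by exists (chart_scale Y i) => //; exact: (cs i ig).2.
  by rewrite gt_eqF // dgen.
apply/rowP => j; rewrite mxE -[RHS]coord_funE.
apply: (gen_coord_gen (g := g)) => //; first by move=> i ig; rewrite gt_eqF // dgen.
move=> i ig; exists (chart_scale Y i); first exact: (cs i ig).2.
by rewrite /sheared /chart_inv tuple_space_of_nat // unsconjK.
Qed.

(** If [gen] is [a] times a matrix of determinant 1 with (0, 1) entry [s], the root in [chart_scale]
    is [1 / |s|], and [a * chart_scale] equals [sg(s0) |s| / s], which is 1 because [s] and [s0]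
    have the same sign. *)
Lemma chart_invK A : G_set A ->
  (forall i, (i < 2 * g)%N -> 0 < sheared k A i 0 1 * sheared k A0 i 0 1) ->
  (forall i, (i < 2 * g)%N -> 0 < \det (gen g (coord_fun (chart_coord A)) i)) ->
  chart_inv (chart_coord A) = A.
Proof.
move=> GA same dgen; apply/esym/tuple_space_ofP => i ig.
have A01 j : (j < 2 * g)%N -> sheared k A j 0 1 != 0.
  by move=> /same; apply: contraTneq => ->; rewrite mul0r ltxx.
have [a a0 E] := sheared_gen GA A01 (or_intror dgen) ig.
have [dA _] := sheared_sol k GA.
rewrite /chart_scale E -[LHS](sconjK k) -/(sheared k A i); congr (unsconj k _).
rewrite scalerA -[LHS]scale1r; congr (_ *: _).
have -> : (a *: sheared k A i) 0 1 = a * sheared k A i 0 1 by rewrite mxE.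
rewrite detZ dA // mulr1 exprMn.
set s := sheared k A i 0 1; set s0 := sheared k A0 i 0 1.
have sn0 : s != 0 by exact: A01.
have s0n0 : s0 != 0.
  by have := same i ig; apply: contraTneq; rewrite -/s0 => ->; rewrite mulr0 ltxx.
have -> : a ^+ 2 / (a ^+ 2 * s ^+ 2) = (s^-1) ^+ 2 by field; rewrite a0 sn0.
rewrite sqrtr_sqr normfV.
have sgs : Num.sg s0 * `|s| = s.
  have -> : Num.sg s0 = Num.sg s; last by rewrite mulr_sg_norm.
    have : Num.sg (s * s0) = 1 by apply: gtr0_sg; exact: same.
    rewrite sgrM; case: (sgrP s) sn0 => //; case: (sgrP s0) s0n0 => //; lra.
have ns : `|s| != 0 by rewrite normr_eq0.
have -> : Num.sg s0 / (a * s * `|s|^-1) * a = (Num.sg s0 * `|s|) / s.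
  by field; rewrite a0 sn0 ns.
by rewrite sgs divff.
Qed.

Lemma loc_lip_chart_scale i : (i < 2 * g)%N -> loc_lip y0 (chart_scale^~ i).
Proof.
move=> ig; have M01 := gen01_neq0 det_gen_y0 ig.
have lM := loc_lip_gen y0 i 0 1.
have lq : loc_lip y0 (fun Y => \det (gen g (coord_fun Y) i) / gen g (coord_fun Y) i 0 1 ^+ 2).
  apply: loc_lipM; first exact: loc_lip_det_gen.
  by apply: loc_lipV; [rewrite expf_neq0|exact: loc_lipM].
have q0 : 0 < \det (gen g (coord_fun y0) i) / gen g (coord_fun y0) i 0 1 ^+ 2.
  by rewrite divr_gt0 ?det_gen_y0 // exprn_even_gt0.
apply: loc_lipM; first exact: loc_lip_cst.
apply: loc_lipV; first by rewrite mulf_neq0 // gt_eqF // sqrtr_gt0.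
by apply: loc_lipM => //; exact: loc_lip_sqrt.
Qed.

Lemma chart_inv_lip : exists C r : R, 0 < r /\ forall x y,
  `|x - y0| < r -> `|y - y0| < r ->
  `|chart_inv x - chart_inv y| <= C * `|x - y|.
Proof.
apply: loc_lip_mx => z j; rewrite (ord1 z).
case/mxvec_indexP: j => i ab; case/mxvec_indexP: ab => a b.
rewrite (_ : (fun x => _) = fun x => chart_scale x i *
    ipoly_eval N (coord_fun x) (unsconj k (gen g (ipoly_var N) i) a b)).
  apply: loc_lipM; first exact: loc_lip_chart_scale.
  exact: loc_lip_ipoly.
apply/funext => x; rewrite /chart_inv /tuple_space_of mxvecE mxE mxvecE.
have -> : ipoly_eval N (coord_fun x) (unsconj k (gen g (ipoly_var N) i) a b) =
    unsconj k (gen g (coord_fun x) i) a b.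
  rewrite gen_ipoly -map_unsconj [RHS]mxE //.
by rewrite /unsconj -scalerAr -scalerAl mxE.
Qed.

Lemma differentiable_sheared A i a b : differentiable (fun A => sheared k A i a b) A.
Proof.
have dlin c d : differentiable (fun A : tuple_space R g => tuple_nat A i c d) A.
  rewrite /tuple_nat; case: insubP => [j _ _|_] /=; last exact: differentiable_cst.
  rewrite (_ : (fun _ => _) = fun A : tuple_space R g => A 0 (mxvec_index j (mxvec_index c d))).
    exact: differentiable_coord.
  by apply/funext => B; rewrite /tuple_entry !(mxE, castmxE).
have dc (c : R) p q : differentiable (fun A : tuple_space R g => c * tuple_nat A i p q) A.
  by apply: differentiableM; [exact: differentiable_cst|exact: dlin].
rewrite (_ : (fun _ => _) = fun A : tuple_space R g =>
    (unshear R k 0 b * shear R k a 0) * tuple_nat A i 0 0 +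
    (unshear R k 0 b * shear R k a 1) * tuple_nat A i 1 0 +
    ((unshear R k 1 b * shear R k a 0) * tuple_nat A i 0 1 +
     (unshear R k 1 b * shear R k a 1) * tuple_nat A i 1 1)).
  exact: (differentiableD (differentiableD (dc _ 0 0) (dc _ 1 0))
    (differentiableD (dc _ 0 1) (dc _ 1 1))).
by apply/funext => B; rewrite /sheared /sconj !mulmx2E; ring.
Qed.

Lemma differentiable_chart_coord : differentiable chart_coord A0.
Proof.
apply: differentiable_rowP => j.
have dq i a b : (i < 2 * g)%N ->
    differentiable (fun A => sheared k A i a b / sheared k A i 0 1) A0.
  move=> ig; apply: differentiableM; first exact: differentiable_sheared.
  by apply: differentiableV; [exact: differentiable_sheared|exact: good.1].
rewrite (_ : (fun A => _) = fun A => gen_coord (sheared k A) j); last first.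
  by apply/funext => A; rewrite mxE.
rewrite /gen_coord; have jN := ltn_ord j.
case: (j =P 0%N :> nat) => [_|j0]; first by apply: dq; lia.
case: (j =P 1%N :> nat) => [_|j1]; first by apply: dq; lia.
case: (j =P 2%N :> nat) => [_|j2]; first by apply: dq; lia.
have ig : ((j %/ 3).+1 < 2 * g)%N by have := divn_eq j 3; lia.
by case: (j %% 3 == 0)%N; [|case: (j %% 3 == 1)%N]; exact: dq.
Qed.

Lemma near_same_sign : \forall A \near A0,
  forall i, (i < 2 * g)%N -> 0 < sheared k A i 0 1 * sheared k A0 i 0 1.
Proof.
have nearI (i : 'I_(2 * g)) : \forall A \near A0,
    0 < sheared k A i 0 1 * sheared k A0 i 0 1.
  have c : {for A0, continuous (fun A => sheared k A i 0 1 * sheared k A0 i 0 1)}.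
    apply: differentiable_continuous; apply: differentiableM.
      exact: differentiable_sheared.
    exact: differentiable_cst.
  have := cvgr_gt _ c; apply.
  by rewrite -expr2 exprn_even_gt0 //= good.1.
have := @filter_forall _ _ (fun i : 'I_(2 * g) =>
  [set A | 0 < sheared k A i 0 1 * sheared k A0 i 0 1]) _ (nbhs_filter A0) nearI.
apply: filterS => A H i ig.
exact: (H (Ordinal ig)).
Qed.

End Chart.

(** Each [u0] of the set serves as base point of its own local inverse, with the signs of [phi u0];
    the coordinates themselves are common to all, so the local null sets are preimages of the same
    [B]. *)
Lemma chart_null (R : realType) (g k d : nat) (U : set 'rV[R]_d)
    (phi : 'rV[R]_d -> tuple_space R g) (B : set 'rV[R]_(6 * g - 3)) :
  (0 < g)%N -> local_param (@G_set R g) U phi -> cube_null B ->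
  cube_null [set u | [/\ U u, shear_generic k (phi u) & B (chart_coord k (phi u))]].
Proof.
move=> g0 pphi B0; apply: cube_null_local => u0 /= [Uu0 good _].
have GA u : U u -> G_set (phi u).
  move=> Uu; have [W _ eW] := param_homeo pphi (param_open pphi) (@subset_refl _ U).
  have : (phi @` U) (phi u) by exists u.
  by rewrite eW => -[_ []].
have GA0 := GA _ Uu0.
have [r r0 rP] := near_y0 g0 GA0 good.
have N0 : (0 < 6 * g - 3)%N by lia.
have dpsi := differentiable_chart_coord g0 good.
have PK : \forall A \near phi u0, G_set A ->
    chart_inv k (phi u0) (chart_coord k A) = A.
  have Sg := near_same_sign good.
  have Cg : \forall A \near phi u0, `|chart_coord k (phi u0) - chart_coord k A| < r.
    by have /cvgrPdist_lt/(_ r r0) := differentiable_continuous dpsi.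
  have := @filterI _ _ (nbhs_filter (phi u0)) _ _ Sg Cg.
  apply: filterS => A [sA cA] GAA; apply: chart_invK => //.
  by apply: rP; rewrite distrC.
have psiK : \forall y \near chart_coord k (phi u0),
    G_set (chart_inv k (phi u0) y) /\ chart_coord k (chart_inv k (phi u0) y) = y.
  by apply/nbhs_ltP; exists r => // y /rP; exact: chart_inv_sol.
have [L [rL [rL0 Plip]]] := chart_inv_lip g0 GA0 good.
have [|rho rho0 nullB] := @transfer_null R _ d _ (@G_set R g) U phi (chart_coord k)
  (chart_inv k (phi u0)) u0 L pphi Uu0 N0 dpsi PK psiK _ B B0.
  by exists rL.
exists rho => //; apply: cube_nullS nullB => u [[Uu _ Bu] ur].
by split.
Qed.

(** * The surface group and the trace polynomials *)

Section SurfaceGroup.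
Local Open Scope group_scope.
Variables (g : nat) (gT : finGroupType) (f : 'I_(2 * g) -> gT).
Implicit Types w : word g.

Definition word_val w : gT := \prod_(s <- w) (if s.2 then (f s.1)^-1 else f s.1).

Lemma word_val_cat w1 w2 : word_val (w1 ++ w2) = word_val w1 * word_val w2.
Proof. exact: big_cat. Qed.

Hypothesis frel : \prod_(i < g)
  (f (odd_gen i) * f (even_gen i) * (f (odd_gen i))^-1 * (f (even_gen i))^-1) = 1.

Lemma word_val_surface w1 w2 : surface_eq w1 w2 -> word_val w1 = word_val w2.
Proof.
elim=> {w1 w2} [//|w1 w2 _ -> //|w1 w2 w3 _ -> _ -> //|u s v|u v].
- rewrite !word_val_cat; congr (_ * _).
  rewrite -[RHS]mul1g; congr (_ * _).
  rewrite /word_val !big_cons big_nil mulg1 /=.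
  by case: s.2; rewrite ?mulVg ?mulgV.
- rewrite !word_val_cat; congr (_ * _).
  rewrite -[RHS]mul1g; congr (_ * _); rewrite -[RHS]frel /word_val /relator.
  rewrite big_flatten big_map [index_enum _]unlock -enumT; apply: eq_bigr => i _.
  by rewrite !big_cons big_nil /= mulg1 !mulgA.
Qed.

End SurfaceGroup.

(** A transposition at [i] and the identity elsewhere respect the relator: in each commutator at
    least one of the two generators becomes trivial. *)
Lemma surface_gen_neq1 g (i : 'I_(2 * g)) : ~ surface_eq [:: (i, false)] [::].
Proof.
pose x : {perm 'I_3} := tperm 0 1.
move=> /(@word_val_surface g _ (fun j => if j == i then x else 1%g)).
rewrite /word_val big_cons !big_nil /= eqxx mulg1 => H.
have x1 : x = 1%g.
  apply: H; rewrite big1 // => j _.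
  by do 2!case: (_ == i); rewrite ?(invg1, mulg1, mul1g) ?mulgK ?mulgV.
by have := congr1 (fun p : {perm 'I_3} => p 0) x1; rewrite tpermL perm1.
Qed.

(** With [x] and [y] two transpositions of S_3 that do not commute, send the first four generators
    to [x, y, y, x] and the others to 1: the relator becomes [[x, y] [y, x] = 1], while the first
    commutator survives. *)
Lemma surface_comm_neq1 g (i : 'I_g) (hg : (2 <= g)%N) : i = 0%N :> nat ->
  ~ surface_eq [:: (odd_gen i, false); (even_gen i, false);
                   (odd_gen i, true); (even_gen i, true)] [::].
Proof.
case: g i hg => [|[|g]] // i _ i0.
have {i0}-> : i = ord0 by apply/val_inj.
pose x : {perm 'I_3} := tperm 0 1; pose y : {perm 'I_3} := tperm 1 2%:R.
pose f (j : 'I_(2 * g.+2)) := if (j == 0%N :> nat) || (j == 3%N :> nat) then x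
  else if (j == 1%N :> nat) || (j == 2%N :> nat) then y else 1%g.
have f1 (j : 'I_(2 * g.+2)) : (4 <= j)%N -> f j = 1%g.
  by move=> j4; rewrite /f !ifF //; apply/negbTE; rewrite negb_or; apply/andP; split; lia.
move=> /(@word_val_surface g.+2 _ f).
rewrite /word_val !big_cons !big_nil /= !mulg1 => H.
have : (x * y * x^-1 * y^-1 = 1)%g.
  rewrite -!mulgA; apply: H; rewrite !big_ord_recl /= big1 ?mulg1 => [|j _].
    by rewrite /f /= !mulgA !mulgKV mulgK mulgV.
  by rewrite !f1 ?mulg1 ?mulgV //= /bump /=; lia.
move=> e; have {e} e : (x * y = y * x)%g.
  by rewrite -[RHS]mul1g -e -!mulgA mulKg mulVg mulg1.
have := congr1 (fun p : {perm 'I_3} => p 0) e.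
by rewrite !permM [x 0]tpermL [y 1]tpermL [y 0]tpermD // [x 0]tpermL.
Qed.

(** * Degrees of the trace polynomials in each coordinate *)

Section GenDegree.
Variables (n g : nat).

Let v := ipoly_var n.
Let free_deg (i k : nat) : nat := ((k %/ 3).+1 == i) && (3 <= k)%N.
Let low (k : nat) : nat := (k < 3)%N.
Let high (k : nat) : nat := (3 <= k)%N.

Let mdeg_var i (D : nat -> nat) : (0 < D i)%N -> ipoly_mdeg_le D (v i).
Proof.
move=> Di; apply: ipoly_mdeg_leW (@ipoly_mdeg_le_var n i) => j.
by case: eqP => [->|].
Qed.

Definition mx_mdeg_le D (M : 'M[ipoly n]_2) : Prop :=
  forall a b, ipoly_mdeg_le D (M a b).

Lemma mx_mdeg_le_mx2 D a b c d : ipoly_mdeg_le D a -> ipoly_mdeg_le D b ->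
  ipoly_mdeg_le D c -> ipoly_mdeg_le D d -> mx_mdeg_le D (mx2 a b c d).
Proof. by move=> *; move=> i j; rewrite mxE; do 2!case: ifP => _. Qed.

Lemma mx_mdeg_leW D E M : (forall i, (D i <= E i)%N) ->
  mx_mdeg_le D M -> mx_mdeg_le E M.
Proof. by move=> DE dM a b; apply: ipoly_mdeg_leW (dM a b). Qed.

Lemma mx_mdeg_leM D E M N : mx_mdeg_le D M -> mx_mdeg_le E N ->
  mx_mdeg_le (fun i => D i + E i)%N (M * N).
Proof.
move=> dM dN a b; rewrite mulmx2E.
by apply: ipoly_mdeg_leD; exact: ipoly_mdeg_leM.
Qed.

Lemma mx_mdeg_le_adj2 D M : mx_mdeg_le D M -> mx_mdeg_le D (adj2 M).
Proof.
by move=> dM; apply: mx_mdeg_le_mx2; rewrite //; apply: ipoly_mdeg_leN.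
Qed.

Lemma mdeg_le_det2 D M : mx_mdeg_le D M ->
  ipoly_mdeg_le (fun i => D i + D i)%N (\det M).
Proof.
by move=> dM; rewrite det2E; apply: ipoly_mdeg_leB; exact: ipoly_mdeg_leM.
Qed.

Let mdeg_free i : (2 <= i)%N -> mx_mdeg_le (free_deg i) (gen_free v i).
Proof.
move=> i2; apply: mx_mdeg_le_mx2; try exact: ipoly_mdeg_le1.
all: apply: mdeg_var; rewrite /free_deg lt0b; apply/andP; split; last lia.
- have -> : (3 * i - 3 = (i - 1) * 3 + 0)%N by lia.
  by rewrite divnMDl //; lia.
- have -> : (3 * i - 1 = (i - 1) * 3 + 2)%N by lia.
  by rewrite divnMDl //; lia.
- have -> : (3 * i - 2 = (i - 1) * 3 + 1)%N by lia.
  by rewrite divnMDl //; lia.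
Qed.

(** A free coordinate belongs to one matrix only, so it enters a single commutator and the sum does
    not grow with [m]. The condition on the half index records whether that commutator has been
    reached; it carries the induction. *)
Let sum_free_deg m k :
  (\sum_(1 <= j < m) (free_deg (2 * j) k + free_deg (2 * j).+1 k)
     <= high k * (((k %/ 3).+1)./2 < m))%N.
Proof.
elim: m => [|m IH]; first by rewrite big_geq.
case: m IH => [_|m IH]; first by rewrite big_geq.
rewrite big_nat_recr //; apply: leq_trans (leq_add IH (leqnn _)) _.
rewrite /free_deg /high; case: (3 <= k)%N; last by rewrite !andbF.
rewrite !andbT !mul1n; have := odd_double_half (k %/ 3).+1.
move: (k %/ 3).+1 => b bE.
have e0 : (b == 2 * m.+1)%N -> (b./2 = m.+1)%N by move=> /eqP ->; rewrite mul2n doubleK.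
have e1 : (b == (2 * m.+1).+1)%N -> (b./2 = m.+1)%N.
  by move=> /eqP ->; rewrite mul2n -[_.*2.+1]/((true + _)%N) half_bit_double.
have e2 : ~~ ((b == 2 * m.+1)%N && (b == (2 * m.+1).+1)%N).
  by apply/negP => /andP[/eqP -> /eqP]; lia.
move: e0 e1 e2; case: (b == (2 * m.+1)%N); case: (b == (2 * m.+1).+1) => //= e0 e1 _.
- by rewrite e0 // ltnn ltnSn.
- by rewrite e1 // ltnn ltnSn.
- by rewrite addn0; case: (ltnP b./2 m.+1) => // /leqW; rewrite ltnS => ->.
Qed.

Let mdeg_comm : mx_mdeg_le (fun k => 2 * high k)%N (gen_comm g v).
Proof.
suff H m : mx_mdeg_le (fun k => 2 * \sum_(1 <= j < m)
    (free_deg (2 * j) k + free_deg (2 * j).+1 k))%N (gen_comm m v).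
  apply: mx_mdeg_leW (H g) => k; rewrite leq_mul2l /=.
  by apply: leq_trans (sum_free_deg g k) _; rewrite -[leqRHS]muln1 leq_mul2l leq_b1 orbT.
have one D : mx_mdeg_le D 1.
  by move=> a b; rewrite mxE; case: (a == b); rewrite ?mulr1n ?mulr0n;
    [exact: ipoly_mdeg_le1|exact: ipoly_mdeg_le0].
elim: m => [|m IH]; first by rewrite /gen_comm big_geq.
have [->|m0] := posnP m; first by rewrite /gen_comm big_geq.
rewrite /gen_comm big_nat_recr //=.
have d0 : mx_mdeg_le (free_deg (2 * m)) (gen_free v (2 * m)) by apply: mdeg_free; lia.
have d1 : mx_mdeg_le (free_deg (2 * m).+1) (gen_free v (2 * m).+1) by apply: mdeg_free; lia.
apply: mx_mdeg_leW (mx_mdeg_leM IH (mx_mdeg_leM (mx_mdeg_leM (mx_mdeg_leM d0 d1)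
  (mx_mdeg_le_adj2 d0)) (mx_mdeg_le_adj2 d1))) => k.
by rewrite big_nat_recr //=; lia.
Qed.

Let mdeg_det : ipoly_mdeg_le (fun k => 2 * high k)%N (gen_det g v).
Proof.
suff H m : ipoly_mdeg_le (fun k => 2 * \sum_(1 <= j < m)
    (free_deg (2 * j) k + free_deg (2 * j).+1 k))%N (gen_det m v).
  apply: ipoly_mdeg_leW (H g) => k; rewrite leq_mul2l /=.
  by apply: leq_trans (sum_free_deg g k) _; rewrite -[leqRHS]muln1 leq_mul2l leq_b1 orbT.
elim: m => [|m IH]; first by rewrite /gen_det big_geq //; exact: ipoly_mdeg_le1.
have [->|m0] := posnP m; first by rewrite /gen_det big_geq //; exact: ipoly_mdeg_le1.
rewrite /gen_det big_nat_recr //=.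
have d0 : mx_mdeg_le (free_deg (2 * m)) (gen_free v (2 * m)) by apply: mdeg_free; lia.
have d1 : mx_mdeg_le (free_deg (2 * m).+1) (gen_free v (2 * m).+1) by apply: mdeg_free; lia.
apply: ipoly_mdeg_leW (ipoly_mdeg_leM IH (ipoly_mdeg_leM (mdeg_le_det2 d0)
  (mdeg_le_det2 d1))) => k.
by rewrite big_nat_recr //=; lia.
Qed.

Let mdeg_X : mx_mdeg_le (fun k => 2 * high k + low k)%N
  (gen_X (gen_comm g v) (gen_det g v) (v 0%N) (v 1%N)).
Proof.
have lowv i : (i < 3)%N -> ipoly_mdeg_le low (v i) by move=> i3; apply: mdeg_var; rewrite /low i3.
have cW a b : ipoly_mdeg_le (fun k => 2 * high k + low k)%N (gen_comm g v a b).
  by apply: ipoly_mdeg_leW (mdeg_comm a b) => k; rewrite leq_addr.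
have cdW a b : ipoly_mdeg_le (fun k => 2 * high k)%N (gen_comm g v a b - gen_det g v).
  exact: ipoly_mdeg_leB.
apply: mx_mdeg_le_mx2 => //; try by apply: ipoly_mdeg_leM => //; exact: lowv.
apply: ipoly_mdeg_leN; apply: ipoly_mdeg_leD => //.
by apply: ipoly_mdeg_leD; apply: ipoly_mdeg_leM => //; exact: lowv.
Qed.

Let mdeg_Y : mx_mdeg_le (fun=> 4%N)
  (gen_Y (gen_comm g v) (gen_det g v) (v 0%N) (v 1%N) (v 2%N)).
Proof.
have lowv i : (i < 3)%N -> ipoly_mdeg_le low (v i) by move=> i3; apply: mdeg_var; rewrite /low i3.
have hl k : (high k + low k <= 1)%N by rewrite /high /low [(k < 3)%N]ltnNge; case: (2 < k)%N.
have dlC : ipoly_mdeg_le (fun k => 2 * high k + 2 * high k)%N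
    (gen_det g v * gen_comm g v 0 1) by exact: ipoly_mdeg_leM.
have dU := mx_mdeg_leM mdeg_comm mdeg_X.
have dUs a b : ipoly_mdeg_le (fun=> 4%N)
    ((gen_comm g v * gen_X (gen_comm g v) (gen_det g v) (v 0%N) (v 1%N)) a b * v 2%N).
  by apply: ipoly_mdeg_leW (ipoly_mdeg_leM (dU a b) (lowv 2%N isT)) => k; have := hl k; lia.
have dU4 a b : ipoly_mdeg_le (fun=> 4%N)
    ((gen_comm g v * gen_X (gen_comm g v) (gen_det g v) (v 0%N) (v 1%N)) a b).
  by apply: ipoly_mdeg_leW (dU a b) => k; have := hl k; lia.
have dC4 : ipoly_mdeg_le (fun=> 4%N) (gen_det g v * gen_comm g v 0 1).
  by apply: ipoly_mdeg_leW dlC => k; have := hl k; lia.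
have dCs4 : ipoly_mdeg_le (fun=> 4%N) (gen_det g v * gen_comm g v 0 1 * v 2%N).
  by apply: ipoly_mdeg_leW (ipoly_mdeg_leM dlC (lowv 2%N isT)) => k; have := hl k; lia.
apply: mx_mdeg_le_mx2 => //; apply: ipoly_mdeg_leB; try by apply: ipoly_mdeg_leD.
  by apply: ipoly_mdeg_leW (ipoly_mdeg_leM (lowv 1%N isT) dlC) => k; have := hl k; lia.
apply: ipoly_mdeg_leW (ipoly_mdeg_leM (lowv 1%N isT)
  (ipoly_mdeg_leM dlC (lowv 2%N isT))) => k; have := hl k; lia.
Qed.

(** In a free coordinate, [gen_comm] and [gen_det] have degree at most 2, the matrix and its
    adjugate each contributing 1; [gen_Y] multiplies two such factors. In the coordinates 0, 1, 2
    the degree is at most 2. Hence 4, for every genus. *)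
Lemma mdeg_gen i : mx_mdeg_le (fun=> 4%N) (gen g v i).
Proof.
rewrite /gen; case: i => [|[|i]] /=.
- apply: mx_mdeg_leW mdeg_X => k; by rewrite /high /low [(k < 3)%N]ltnNge; case: (2 < k)%N.
- exact: mdeg_Y.
- apply: mx_mdeg_leW (@mdeg_free i.+2 isT) => k.
  by rewrite /free_deg; case: andb.
Qed.

Definition poly_letter (s : letter g) : 'M[ipoly n]_2 :=
  if s.2 then adj2 (gen g v s.1) else gen g v s.1.

Definition poly_word (w : word g) : 'M[ipoly n]_2 := \prod_(s <- w) poly_letter s.

(** If the two words are represented up to scalars [c1] and [c2], both terms carry the factor
    [c1 ^ 2 * c2 ^ 2], so the value is that multiple of the difference of the squared traces. *)
Definition trace_gap (w1 w2 : word g) : ipoly n :=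
  \tr (poly_word w1) ^+ 2 * \det (poly_word w2) -
  \tr (poly_word w2) ^+ 2 * \det (poly_word w1).

Lemma mdeg_poly_word w : mx_mdeg_le (fun=> 4 * size w)%N (poly_word w).
Proof.
rewrite /poly_word; elim: w => [|s w IH].
  move=> a b; rewrite big_nil mxE; case: (a == b); rewrite ?mulr1n ?mulr0n;
    [exact: ipoly_mdeg_le1|exact: ipoly_mdeg_le0].
rewrite big_cons mulnS; apply: mx_mdeg_leM IH.
rewrite /poly_letter; case: s.2; last exact: mdeg_gen.
by apply: mx_mdeg_le_adj2; exact: mdeg_gen.
Qed.

(** Entries have degree at most [4 m]; a squared trace and a determinant contribute [8 m] each. *)
Lemma deg_trace_gap m w1 w2 : (size w1 <= m)%N -> (size w2 <= m)%N ->
  ipoly_deg_le (16 * m)%N (trace_gap w1 w2).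
Proof.
move=> w1m w2m.
have half u w : (size u <= m)%N -> (size w <= m)%N ->
    ipoly_deg_le (16 * m)%N (\tr (poly_word u) ^+ 2 * \det (poly_word w)).
  move=> um wm; have du := mdeg_poly_word u; have dw := mdeg_poly_word w.
  have dtr : ipoly_deg_le (4 * size u)%N (\tr (poly_word u)).
    by rewrite trace2E; exact: ipoly_mdeg_leD.
  have := ipoly_mdeg_leM (ipoly_mdeg_leM dtr dtr) (mdeg_le_det2 dw).
  by rewrite -expr2; apply: ipoly_mdeg_leW => k; lia.
by apply: ipoly_mdeg_leB; exact: half.
Qed.

End GenDegree.

Section TraceGapValue.
Variables (R : realType) (g k N : nat) (A : tuple_space R g) (y : nat -> R).
Hypothesis GA : G_set A.
Hypothesis evar : y = ipoly_eval N y \o ipoly_var N.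
Hypothesis genA : forall i, (i < 2 * g)%N -> exists2 a : R, a != 0 &
  gen g y i = a *: sheared k A i.

Lemma det_eval_word w : \det (eval_word A w) = 1.
Proof.
have [dA _] := (G_setP A).1 GA.
have dE i : \det (tuple_entry A i) = 1 by rewrite -tuple_natE dA.
rewrite /eval_word; elim: w => [|s w IH]; first by rewrite big_nil det1.
rewrite big_cons det_mulmx2 IH mulr1 /eval_letter.
by case: s.2; rewrite ?det_inv2 dE ?invr1.
Qed.

Lemma poly_word_value : exists2 L : R, 1 <= L & forall w : word g, exists c,
  [/\ c != 0, `|c| <= L ^+ size w &
   map_mx (ipoly_eval N y) (poly_word N w) = c *: sconj k (eval_word A w)].
Proof.
have [dA _] := (G_setP A).1 GA.
have /choice[a aP] : forall i : 'I_(2 * g), exists a : R, a != 0 /\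
    gen g y i = a *: sheared k A i.
  by move=> i; have [a a0 e] := genA (ltn_ord i); exists a.
exists (1 + \sum_i `|a i|); first by rewrite lerDl sumr_ge0.
set L := 1 + _.
have aL i : `|a i| <= L by rewrite /L (bigD1 i) //= addrCA lerDl addr_ge0 // sumr_ge0.
have L1 : 1 <= L by rewrite lerDl sumr_ge0.
rewrite /poly_word /eval_word; elim=> [|s w [c [c0 cL IH]]].
  exists 1; split; rewrite ?oner_eq0 ?normr1 ?expr0 //.
  by rewrite !big_nil scale1r rmorph1 sconj1.
exists (a s.1 * c); split.
- by rewrite mulf_neq0 // (aP s.1).1.
- by rewrite normrM exprS; apply: ler_pM.
have letterE : map_mx (ipoly_eval N y) (poly_letter N s) =
    a s.1 *: sconj k (eval_letter A s).
  have genE : map_mx (ipoly_eval N y) (gen g (ipoly_var N) s.1) = a s.1 *: sheared k A s.1.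
    by rewrite map_gen -evar (aP s.1).2.
  rewrite /poly_letter /eval_letter; case: s.2.
    rewrite map_adj2 genE adj2Z /sheared tuple_natE; congr (_ *: _).
    have d1 : \det (tuple_entry A s.1) = 1 by rewrite -tuple_natE dA.
    by rewrite adj2_inv ?det_sconj d1 ?oner_eq0 // scale1r sconj_inv // d1 oner_eq0.
  by rewrite genE /sheared tuple_natE.
by rewrite !big_cons rmorphM /= IH letterE sconjM -scalerAl -scalerAr scalerA.
Qed.

Lemma trace_gap_value : exists2 L : R, 1 <= L & forall w1 w2 : word g, exists c,
  [/\ c != 0, `|c| <= L ^+ (2 * (size w1 + size w2)) &
   ipoly_eval N y (trace_gap N w1 w2) =
     c * (\tr (eval_word A w1) ^+ 2 - \tr (eval_word A w2) ^+ 2)].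
Proof.
have [L L1 wP] := poly_word_value; exists L => // w1 w2.
have [c1 [c10 c1L E1]] := wP w1; have [c2 [c20 c2L E2]] := wP w2.
exists (c1 ^+ 2 * c2 ^+ 2); split.
- by rewrite mulf_neq0 // expf_neq0.
- rewrite normrM !normrX mulnDr exprD !(mulnC 2%N) !exprM.
  by apply: ler_pM; rewrite ?exprn_ge0 //; apply: lerXn2r; rewrite ?nnegrE // exprn_ge0 // (le_trans ler01).
have trE w c : map_mx (ipoly_eval N y) (poly_word N w) = c *: sconj k (eval_word A w) ->
    ipoly_eval N y (\tr (poly_word N w)) = c * \tr (eval_word A w).
  by move=> E; rewrite -trace_map_mx E mxtraceZ tr_sconj.
have detE w c : map_mx (ipoly_eval N y) (poly_word N w) = c *: sconj k (eval_word A w) ->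
    ipoly_eval N y (\det (poly_word N w)) = c ^+ 2.
  by move=> E; rewrite -det_map_mx E detZ det_sconj det_eval_word mulr1.
rewrite /trace_gap rmorphB !rmorphM.
by rewrite (trE _ _ E1) (trE _ _ E2) (detE _ _ E1) (detE _ _ E2); ring.
Qed.

End TraceGapValue.

(** A scalar matrix of determinant 1 is trivial in PSL_2. By injectivity no generator is scalar;
    neither is [C], as otherwise the commutator of the first two generators would be trivial in the
    surface group, against [g >= 2]. *)
Lemma surface_shear_generic (R : realType) (g : nat) (A : tuple_space R g) :
  (2 <= g)%N -> G_set A -> defines_closed_surface A -> exists k, shear_generic k A.
Proof.
move=> hg GA [injA _]; have [dA relA] := (G_setP A).1 GA.
have scalar_pm1 (M : 'M[R]_2) a : \det M = 1 -> M = a%:M -> psl_eq M 1.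
  move=> dM Ma; move: dM; rewrite Ma det_scalar => /eqP.
  by rewrite sqrf_eq1 => /orP[/eqP ->|/eqP ->]; [left|right]; rewrite // -scalemx1 scaleN1r.
pose C := comm_prod 1 g (tuple_nat A).
have dC : \det C = 1 by apply: det_comm_prod => i ig; rewrite dA ?oner_eq0.
have [|k kP] := @exists_shear R (C :: [seq tuple_entry A i | i <- enum 'I_(2 * g)]).
  move=> M; rewrite inE => /orP[/eqP ->|/mapP[i _ ->]] a; apply/eqP => E.
    pose i0 : 'I_g := Ordinal (leq_trans (isT : 0 < 2)%N hg).
    apply: (@surface_comm_neq1 g i0 hg erefl); apply: injA.
    rewrite /eval_word !big_cons !big_nil /eval_letter /= mulr1.
    have eW : tuple_entry A (odd_gen i0) * (tuple_entry A (even_gen i0) *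
       ((tuple_entry A (odd_gen i0))^-1 * (tuple_entry A (even_gen i0))^-1)) * C = 1.
      rewrite -relA /comm_prod [RHS]big_ltn; last by lia.
      by rewrite -(tuple_natE A (odd_gen i0)) -(tuple_natE A (even_gen i0)) /comm2 !mulrA.
    have [C1|C1] := scalar_pm1 C a dC E; move: eW; rewrite C1 ?mulr1 ?mulrN1.
      by left.
    by move=> /eqP; rewrite eqr_oppLR => /eqP; right.
  apply: (@surface_gen_neq1 g i); apply: injA.
  rewrite /eval_word big_cons !big_nil /eval_letter /= mulr1.
  by apply: (@scalar_pm1 _ a) => //; rewrite -tuple_natE dA.
exists k; split.
  move=> i ig; rewrite /sheared (tuple_natE A (Ordinal ig)); apply: kP.
  by rewrite inE map_f ?orbT // mem_enum.
have -> : comm_prod 1 g (sheared k A) = sconj k C.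
  rewrite /C /comm_prod sconj_prod; apply: eq_big_nat => j /andP[_ jg].
  by rewrite sconj_comm2 // dA ?oner_eq0 //; lia.
by apply: kP; rewrite inE eqxx.
Qed.

(** * The hyperbolic plane *)

Section HyperbolicPlane.
Variable R : realType.
Local Notation C := (complex R).
Implicit Types (z w : C) (M : 'M[R]_2).

(* The positive definite form of determinant 1 attached to z, on which the group
   acts by congruence. *)
Definition hgram z : 'M[R]_2 :=
  mx2 ((complex.Re z ^+ 2 + complex.Im z ^+ 2) / complex.Im z)
      (complex.Re z / complex.Im z) (complex.Re z / complex.Im z) (complex.Im z)^-1.

(** The hyperbolic cosine of the distance, which is a rational function of the coordinates. *)
Definition chd z w : R :=
  1 + (complex.Re (z - w) ^+ 2 + complex.Im (z - w) ^+ 2) /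
              (2 * complex.Im z * complex.Im w).

Lemma det_hgram z : half_plane z -> \det (hgram z) = 1.
Proof.
rewrite /half_plane /= => z0; rewrite det2E !mx2E; field.
by rewrite gt_eqF.
Qed.

Lemma hgram_inj z w : half_plane z -> half_plane w -> hgram z = hgram w -> z = w.
Proof.
case: z => x y; case: w => u v; rewrite /half_plane /hgram /= => y0 v0 /matrixP e.
have := e 1 1; rewrite !mxE /= => /invr_inj yv; subst v.
have := e 0 1; rewrite !mxE /= => /mulIf -> //.
by rewrite invr_eq0 gt_eqF.
Qed.

Lemma chd_hgram z w : half_plane z -> half_plane w ->
  chd z w = \det (hgram z + hgram w) / 2 - 1.
Proof.
case: z => x y; case: w => u v; rewrite /half_plane /chd /= => y0 v0.
rewrite det2E !mxE /=; field; rewrite !gt_eqF //.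
Qed.

(** It turns the action into a congruence of matrices; invariance of [chd] and multiplicativity of
    the action then need no complex arithmetic. *)
Lemma moebius_spec M z : \det M = 1 -> half_plane z ->
  half_plane (moebius M z) /\ hgram (moebius M z) = M *m hgram z *m M^T.
Proof.
case: z => x y; rewrite det2E => dM; rewrite {1}/half_plane => /= y0.
set a := M 0 0 in dM *; set b := M 0 1 in dM *; set c := M 1 0 in dM *; set d := M 1 1 in dM *.
pose n := (c * x + d) ^+ 2 + (c * y) ^+ 2.
have n0 : 0 < n.
  rewrite lt_neqAle addr_ge0 ?sqr_ge0 // andbT eq_sym paddr_eq0 ?sqr_ge0 //.
  rewrite !sqrf_eq0 mulf_eq0 (gt_eqF y0) orbF.
  apply/negP => /andP[/eqP e1 /eqP e2]; move: e1 dM; rewrite e2 mul0r add0r => ->.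
  by rewrite !mulr0 subr0 => /eqP; rewrite eq_sym oner_eq0.
have nn : n != 0 by rewrite gt_eqF.
have E : moebius M (x +i* y)%C =
    ((((a * x + b) * (c * x + d) + a * c * y ^+ 2) / n) +i*
     (y * (a * d - b * c) / n))%C.
  rewrite /moebius -/a -/b -/c -/d.
  have -> : (a%:C * (x +i* y) + b%:C = (a * x + b) +i* (a * y))%C.
    by apply/eqP; rewrite eq_complex /=; apply/andP; split; apply/eqP; ring.
  have -> : (c%:C * (x +i* y) + d%:C = (c * x + d) +i* (c * y))%C.
    by apply/eqP; rewrite eq_complex /=; apply/andP; split; apply/eqP; ring.
  have den0 : ((c * x + d) +i* (c * y))%C != 0.
    rewrite eq_complex /=; apply: contraTN n0 => /andP[/eqP e1 /eqP e2].
    by rewrite /n e1 e2 expr0n addr0 ltxx.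
  apply: (canLR (mulfK den0)); apply/eqP; rewrite eq_complex /=.
  by apply/andP; split; apply/eqP; rewrite /n; field.
rewrite E; split; first by rewrite /half_plane /= dM mulr1 divr_gt0.
have yn : y != 0 by rewrite gt_eqF.
have tr2 (N : 'M[R]_2) i j : (M *m N *m M^T) i j =
    (M i 0 * N 0 0 + M i 1 * N 1 0) * M j 0 + (M i 0 * N 0 1 + M i 1 * N 1 1) * M j 1.
  by rewrite [LHS](mulmx2E (M * N)) !mulmx2E !(mxE _ _ _ _).
apply: mx2P; rewrite /hgram /= tr2 !mx2E -/a -/b -/c -/d; rewrite ?dM ?mulr1.
- have := erefl (((a * x + b) ^+ 2 + (a * y) ^+ 2) * n).
  rewrite {1}(_ : _ * n = ((a * x + b) * (c * x + d) + a * c * y ^+ 2) ^+ 2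
    + (y * (a * d - b * c)) ^+ 2); last by rewrite /n; ring.
  rewrite dM mulr1 => key.
  rewrite (_ : _ / (y / n) = (((a * x + b) * (c * x + d) + a * c * y ^+ 2) ^+ 2
    + y ^+ 2) / (n * y)); last by field; rewrite yn nn.
  by rewrite key; field; rewrite yn nn.
- by field; rewrite yn nn.
- by field; rewrite yn nn.
- by rewrite /n; field; rewrite yn.
Qed.

Lemma chd_moebius M z w : \det M = 1 -> half_plane z -> half_plane w ->
  chd (moebius M z) (moebius M w) = chd z w.
Proof.
move=> dM Hz Hw; have [Hz' ez] := moebius_spec dM Hz; have [Hw' ew] := moebius_spec dM Hw.
rewrite !chd_hgram // ez ew -mulmxDl -mulmxDr !det_mulmx det_tr dM.
by rewrite mul1r mulr1.
Qed.

Lemma moebiusM M N z : \det M = 1 -> \det N = 1 -> half_plane z ->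
  moebius (M * N) z = moebius M (moebius N z).
Proof.
move=> dM dN Hz; have [Hn en] := moebius_spec dN Hz; have [Hm em] := moebius_spec dM Hn.
have dMN : \det (M * N) = 1 by rewrite det_mulmx2 dM dN mulr1.
have [Hmn emn] := moebius_spec dMN Hz.
apply: hgram_inj => //; rewrite emn em en.
by rewrite (_ : M * N = M *m N) // trmx_mul !mulmxA.
Qed.

Lemma moebius1 z : half_plane z -> moebius 1 z = z.
Proof.
move=> Hz; have [H1 e1] := moebius_spec (det1 _ _) Hz.
by apply: hgram_inj => //; rewrite e1 trmx1 mulmx1 mul1mx.
Qed.

Lemma chd_ge1 z w : half_plane z -> half_plane w -> 1 <= chd z w.
Proof.
move=> Hz Hw; rewrite /chd lerDl divr_ge0 // ?addr_ge0 ?sqr_ge0 //.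
by apply: mulr_ge0; [apply: mulr_ge0 => //; exact: ltW Hz|exact: ltW Hw].
Qed.

Lemma chdC z w : half_plane z -> half_plane w -> chd z w = chd w z.
Proof. by move=> Hz Hw; rewrite !chd_hgram // (addrC (hgram z)). Qed.

Lemma chd_eq1 z w : half_plane z -> half_plane w -> chd z w = 1 -> z = w.
Proof.
case: z => x y; case: w => u v; rewrite /half_plane /chd /= => y0 v0 e.
have p0 := mulr_gt0 (mulr_gt0 (ltr0Sn R 1) y0) v0.
have : ((x - u) ^+ 2 + (y - v) ^+ 2) / (2 * y * v) = 0.
  by apply: (addrI 1); rewrite addr0.
move=> /eqP; rewrite mulf_eq0 invr_eq0 (gt_eqF p0) orbF paddr_eq0 ?sqr_ge0 //.
by rewrite !sqrf_eq0 !subr_eq0 => /andP[/eqP -> /eqP ->].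
Qed.

Lemma chdxx z : chd z z = 1.
Proof. by rewrite /chd subrr /= expr0n /= addr0 mul0r addr0. Qed.

(* The Gram determinant of three vectors for a form of signature (1, 2). *)
Lemma chd_gram z p w : half_plane z -> half_plane p -> half_plane w ->
  (chd z p * chd p w - chd z w) ^+ 2 <= (chd z p ^+ 2 - 1) * (chd p w ^+ 2 - 1).
Proof.
case: z => x1 y1; case: p => x2 y2; case: w => x3 y3.
rewrite /half_plane /chd /= => h1 h2 h3; rewrite -subr_ge0.
have n1 : y1 != 0 by rewrite gt_eqF.
have n2 : y2 != 0 by rewrite gt_eqF.
have n3 : y3 != 0 by rewrite gt_eqF.
set e := (X in 0 <= X).
suff -> : e = (((x1 ^+ 2 + y1 ^+ 2) * (x2 - x3) + (x2 ^+ 2 + y2 ^+ 2) * (x3 - x1)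
   + (x3 ^+ 2 + y3 ^+ 2) * (x1 - x2)) / (2 * y1 * y2 * y3)) ^+ 2 by exact: sqr_ge0.
by rewrite /e; field; rewrite n1 n2 n3.
Qed.

(** The four squares are those of the entries of [N^-1 M N], where [N] is the upper triangular
    matrix that sends the imaginary unit to [x + i y]. A small displacement thus bounds all entries
    of [M]. *)
Lemma chd_conj M x y : \det M = 1 -> 0 < y ->
  2 * chd (x +i* y)%C (moebius M (x +i* y)%C) =
  (M 0 0 - M 1 0 * x) ^+ 2 +
  ((M 0 0 * x + M 0 1 - x * (M 1 0 * x + M 1 1)) / y) ^+ 2 +
  (M 1 0 * y) ^+ 2 + (M 1 0 * x + M 1 1) ^+ 2.
Proof.
move=> dM y0; have Hz : half_plane (x +i* y)%C by [].
have [Hm em] := moebius_spec dM Hz.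
rewrite chd_hgram // em.
have tr2 (N : 'M[R]_2) i j : (M *m N *m M^T) i j =
    (M i 0 * N 0 0 + M i 1 * N 1 0) * M j 0 + (M i 0 * N 0 1 + M i 1 * N 1 1) * M j 1.
  by rewrite [LHS](mulmx2E (M * N)) !mulmx2E !(mxE _ _ _ _).
have polar (P Q : 'M[R]_2) : \det (P + Q) = \det P + \det Q +
    (P 0 0 * Q 1 1 + P 1 1 * Q 0 0 - P 0 1 * Q 1 0 - P 1 0 * Q 0 1).
  by rewrite !det2E !mxE; ring.
have dE : \det (M *m hgram (x +i* y)%C *m M^T) = 1 by rewrite -em det_hgram.
rewrite polar dE det_hgram // !tr2 /hgram /= !mx2E; field.
by rewrite gt_eqF.
Qed.

End HyperbolicPlane.

(** * Hyperbolic cosine and its mean value property *)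

Section Cosh.
Variable R : realType.
Implicit Types a b t u : R.

Definition cosh t : R := (expR t + expR (- t)) / 2.
Definition sinh t : R := (expR t - expR (- t)) / 2.

Lemma cosh0 : cosh 0 = 1.
Proof. by rewrite /cosh oppr0 expR0; field. Qed.

Lemma coshN t : cosh (- t) = cosh t.
Proof. by rewrite /cosh opprK addrC. Qed.

Lemma cosh_norm t : cosh `|t| = cosh t.
Proof. by case: (ger0P t) => // _; rewrite coshN. Qed.

Lemma coshD a b : cosh (a + b) = cosh a * cosh b + sinh a * sinh b.
Proof. by rewrite /cosh /sinh opprD !expRD; field. Qed.

Lemma expR_inv t : expR t * expR (- t) = 1.
Proof. by rewrite -expRD subrr expR0. Qed.

Lemma cosh_sq t : cosh t ^+ 2 - sinh t ^+ 2 = 1.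
Proof.
by rewrite -[RHS](expR_inv t) /cosh /sinh; field.
Qed.

Lemma cosh_double t : cosh (t + t) = 2 * cosh t ^+ 2 - 1.
Proof. by have := cosh_sq t; rewrite coshD -!expr2; lra. Qed.

Lemma cosh_lt a b : 0 <= a -> a < b -> cosh a < cosh b.
Proof.
move=> a0 ab; rewrite /cosh ltr_pM2r ?invr_gt0 // !expRN -subr_gt0.
have ea : 1 <= expR a by rewrite -expR0 ler_expR.
have eab : expR a < expR b by rewrite ltr_expR.
have ea0 := expR_gt0 a; have eb0 := expR_gt0 b.
have -> : expR b + (expR b)^-1 - (expR a + (expR a)^-1) =
    (expR b - expR a) * (1 - (expR a * expR b)^-1).
  by move: ea0 eb0; move: (expR a) (expR b) => x y x0 y0; field; rewrite !gt_eqF.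
apply: mulr_gt0; first by rewrite subr_gt0.
rewrite subr_gt0 invf_lt1 ?mulr_gt0 //.
by apply: lt_le_trans (_ : expR b <= _); [exact: le_lt_trans eab|rewrite ler_peMl // ltW].
Qed.

Lemma cosh_le a b : 0 <= a -> a <= b -> cosh a <= cosh b.
Proof.
move=> a0; rewrite le_eqVlt => /orP[/eqP -> //|/(cosh_lt a0)]; exact: ltW.
Qed.

Lemma cosh_ge1 t : 1 <= cosh t.
Proof. by rewrite -cosh0 -[leRHS]cosh_norm; apply: cosh_le. Qed.

Lemma cosh_gt1 t : 0 < t -> 1 < cosh t.
Proof. by move=> t0; rewrite -cosh0; apply: cosh_lt. Qed.

Lemma cosh_le_inv a b : 0 <= b -> cosh a <= cosh b -> a <= b.
Proof. by move=> b0; apply: contraTT; rewrite -!ltNge; exact: cosh_lt. Qed.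

Lemma continuous_cosh : continuous cosh.
Proof.
move=> t; apply: cvgMl; apply: cvgD; first exact: continuous_expR.
apply: (@continuous_comp _ _ _ -%R expR); first exact: opp_continuous.
exact: continuous_expR.
Qed.

Lemma cosh_arcosh u : 1 <= u -> cosh (arcosh u) = u.
Proof.
move=> u1; rewrite /cosh /arcosh.
have q0 : 0 <= u ^+ 2 - 1 by rewrite subr_ge0 exprn_ege1.
have s0 : 0 < u + Num.sqrt (u ^+ 2 - 1).
  by rewrite ltr_wpDr ?sqrtr_ge0 // (lt_le_trans ltr01).
rewrite expRN lnK ?posrE //.
set s := Num.sqrt _ in s0 *.
have ss : s ^+ 2 = u ^+ 2 - 1 by rewrite sqr_sqrtr.
have -> : (u + s)^-1 = u - s.
  apply: (mulfI (lt0r_neq0 s0)); rewrite mulfV ?gt_eqF //.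
  by rewrite mulrC -subr_sqr ss; ring.
by field.
Qed.

Lemma arcosh_ge0 u : 1 <= u -> 0 <= arcosh u.
Proof.
move=> u1; rewrite /arcosh ln_ge0 // (le_trans u1) // lerDl sqrtr_ge0 //.
Qed.

Lemma hyp_dist_chd (z w : complex R) : half_plane z -> half_plane w ->
  0 <= hyp_dist z w /\ cosh (hyp_dist z w) = chd z w.
Proof.
move=> Hz Hw; have h := chd_ge1 Hz Hw.
by rewrite /hyp_dist -/(chd z w) cosh_arcosh // arcosh_ge0.
Qed.

(** The differential equation [f'' = f] in the form of a mean value property, meaningful for
    functions that are only continuous. *)
Definition cosh_mean (f : R -> R) : Prop := forall t, exists2 e : R, 0 < e &
  forall a, 0 < a < e -> f (t + a) + f (t - a) = 2 * cosh a * f t.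

(* At a positive interior maximum the mean value property fails, cosh a being
   larger than 1. *)
Lemma cosh_mean_le0 (f : R -> R) p q : p < q -> continuous f -> cosh_mean f ->
  f p = 0 -> f q = 0 -> forall t, p <= t <= q -> f t <= 0.
Proof.
move=> pq fc fm fp fq.
have [c cpq cmax] := EVT_max (ltW pq) (continuous_subspaceT fc).
suff fc0 : f c <= 0 by move=> t tpq; apply: le_trans (cmax t _) fc0; rewrite in_itv.
rewrite leNgt; apply/negP => fc0; move: cpq; rewrite in_itv /= => /andP[pc cq].
have pc' : p < c by rewrite lt_neqAle pc andbT; apply: contraTneq fc0 => <-; rewrite fp ltxx.
have cq' : c < q by rewrite lt_neqAle cq andbT; apply: contraTneq fc0 => ->; rewrite fq ltxx.
have [e e0 ef] := fm c.
pose a := Num.min (e / 2) (Num.min (c - p) (q - c)).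
have a0 : 0 < a by rewrite !lt_min divr_gt0 // !subr_gt0 pc'.
have ae : a < e.
  by apply: (@le_lt_trans _ _ (e / 2)); [rewrite ge_min lexx|rewrite ltr_pdivrMr // ltr_pMr // ltr1n].
have ap : a <= c - p by rewrite !ge_min lexx orbT.
have aq : a <= q - c by rewrite !ge_min lexx !orbT.
have h1 : f (c + a) <= f c by apply: cmax; rewrite in_itv /=; apply/andP; split; lra.
have h2 : f (c - a) <= f c by apply: cmax; rewrite in_itv /=; apply/andP; split; lra.
have h3 := ef a; rewrite a0 ae in h3; have {h3} := h3 isT.
have h4 := cosh_gt1 a0.
have : f c < cosh a * f c by rewrite ltr_pMl.
lra.
Qed.

Lemma cosh_mean_exp al be : cosh_mean (fun t => al * expR t + be * expR (- t)).
Proof.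
move=> t; exists 1 => [|a _]; first exact: ltr01.
rewrite /cosh !opprD !opprK !expRD.
have -> : 2 * ((expR a + expR (- a)) / 2) = expR a + expR (- a) by rewrite mulrC divfK.
by ring.
Qed.

(** Subtract the combination of exponentials with the same values at [p] and [q], and apply the
    maximum principle to the difference and to its opposite. *)
Lemma cosh_mean_span (f : R -> R) p q : p < q -> continuous f -> cosh_mean f ->
  exists al be, forall t, p <= t <= q -> f t = al * expR t + be * expR (- t).
Proof.
move=> pq fc fm.
pose D := expR p * expR (- q) - expR q * expR (- p).
have D0 : D != 0.
  rewrite /D subr_eq0 -!expRD lt_eqF // ltr_expR; lra.
pose al := (f p * expR (- q) - f q * expR (- p)) / D.
pose be := (expR p * f q - expR q * f p) / D.
exists al, be.
pose h t := al * expR t + be * expR (- t).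
have hp : h p = f p by rewrite /h /al /be /D; field; exact: D0.
have hq : h q = f q by rewrite /h /al /be /D; field; exact: D0.
have hc : continuous h.
  move=> t; apply: cvgD; apply: cvgMr; first exact: continuous_expR.
  apply: (@continuous_comp _ _ _ -%R expR); first exact: opp_continuous.
  exact: continuous_expR.
have diff_mean (f1 f2 : R -> R) : cosh_mean f1 -> cosh_mean f2 -> cosh_mean (f1 - f2).
  move=> m1 m2 t; have [e1 e10 H1] := m1 t; have [e2 e20 H2] := m2 t.
  exists (Num.min e1 e2); first by rewrite lt_min e10.
  move=> a /andP[a0]; rewrite lt_min => /andP[a1 a2].
  rewrite /= !fctE; have := H1 a; have := H2 a; rewrite a0 a1 a2 => /(_ isT) h2 /(_ isT) h1.
  by rewrite mulrBr -h1 -h2; ring.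
have hm : cosh_mean h := cosh_mean_exp al be.
have c1 : continuous (f - h) by move=> t; apply: cvgB; [exact: fc|exact: hc].
have c2 : continuous (h - f) by move=> t; apply: cvgB; [exact: hc|exact: fc].
move=> t tpq; apply/eqP; rewrite eq_le; apply/andP; split.
  have := cosh_mean_le0 pq c1 (diff_mean _ _ fm hm) _ _ tpq.
  by rewrite !fctE hp hq !subrr subr_le0; apply.
have := cosh_mean_le0 pq c2 (diff_mean _ _ hm fm) _ _ tpq.
by rewrite !fctE hp hq !subrr subr_le0; apply.
Qed.

End Cosh.

Section HyperbolicForm.
Variable R : realType.
Local Notation C := (complex R).
Implicit Types (z w : C) (P Q T : 'M[R]_2).

(** The polarization of the determinant, a Lorentzian form on symmetric matrices, for which the
    [hgram z] form a sheet of the hyperboloid. *)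
Definition hform P Q : R :=
  (P 0 0 * Q 1 1 + P 1 1 * Q 0 0 - P 0 1 * Q 1 0 - P 1 0 * Q 0 1) / 2.

Lemma hform_chd z w : half_plane z -> half_plane w ->
  hform (hgram z) (hgram w) = chd z w.
Proof.
move=> Hz Hw; rewrite chd_hgram // /hform.
have := det_hgram Hz; have := det_hgram Hw.
by rewrite !det2E ![(hgram z + _) _ _]mxE; lra.
Qed.

(** The form is negative definite on the orthogonal complement of the timelike vector [hgram z], so
    a null vector there is zero. *)
Lemma hform_null z T : half_plane z -> T 0 1 = T 1 0 -> hform T (hgram z) = 0 ->
  \det T = 0 -> T = 0.
Proof.
case: z => x y; rewrite /half_plane /= => y0 Ts; rewrite det2E /hform /hgram !mx2E /= Ts.
set p := T 0 0 in Ts *; set q := T 1 0 in Ts *; set r := T 1 1 in Ts *.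
have yn : y != 0 by rewrite gt_eqF.
move=> B0 D0.
have B1 : p - 2 * q * x + r * (x ^+ 2 + y ^+ 2) = 0.
  have -> : p - 2 * q * x + r * (x ^+ 2 + y ^+ 2) = 2 * y * ((p * y^-1 + r * ((x ^+ 2 + y ^+ 2) / y) -
    q * (x / y) - q * (x / y)) / 2) by field.
  by rewrite B0 mulr0.
have D1 : p * r = q ^+ 2 by apply/eqP; rewrite -subr_eq0 expr2 D0.
have : (r * x - q) ^+ 2 + (r * y) ^+ 2 = 0.
  have -> : (r * x - q) ^+ 2 + (r * y) ^+ 2 =
      r * (p - 2 * q * x + r * (x ^+ 2 + y ^+ 2)) - (p * r - q ^+ 2) by ring.
  by rewrite B1 D1 mulr0 subrr subr0.
move=> /eqP; rewrite paddr_eq0 ?sqr_ge0 // !sqrf_eq0 mulf_eq0 (negbTE yn) orbF.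
move=> /andP[/eqP e1 /eqP r0]; move: e1; rewrite r0 mul0r sub0r => /eqP.
rewrite oppr_eq0 => /eqP q0.
move: B1; rewrite r0 q0 mulr0 !mul0r subr0 addr0 => p0.
by apply: mx2P; rewrite !mxE // Ts.
Qed.

Lemma hgram_sym z : hgram z 0 1 = hgram z 1 0.
Proof. by rewrite !mx2E. Qed.

(** The Gram inequality gives [chd z w <= cosh (a + a)], hence equality. The difference [T] of the
    two sides is then orthogonal to [hgram p] and null. *)
Lemma hgram_midpoint z p w a : half_plane z -> half_plane p -> half_plane w ->
  0 <= a -> chd z p = cosh a -> chd p w = cosh a -> cosh (a + a) <= chd z w ->
  hgram z + hgram w = (2 * cosh a) *: hgram p.
Proof.
move=> Hz Hp Hw a0 zp pw zw.
have zwE : chd z w = cosh (a + a).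
  apply/eqP; rewrite eq_le zw andbT cosh_double.
  have := chd_gram Hz Hp Hw; rewrite zp pw => G.
  have c1 := cosh_ge1 a; move: G c1; move: (cosh a) (chd z w) => x u G c1.
  rewrite leNgt; apply/negP => ux.
  have : (x ^+ 2 - 1) ^+ 2 < (x * x - u) ^+ 2.
    rewrite -[ltRHS]sqrrN ltr_pXn2r ?nnegrE //; first by lra.
      by rewrite subr_ge0 exprn_ege1.
    have : 1 <= x ^+ 2 by rewrite exprn_ege1.
    by lra.
  by rewrite ltNge expr2 G.
pose T := hgram z + hgram w - (2 * cosh a) *: hgram p.
apply/eqP; rewrite -subr_eq0 -/T; apply/eqP.
have Bzz := det_hgram Hz; have Bpp := det_hgram Hp; have Bww := det_hgram Hw.
have Bzp := hform_chd Hz Hp; have Bpw := hform_chd Hp Hw; have Bzw := hform_chd Hz Hw.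
rewrite zp in Bzp; rewrite pw in Bpw; rewrite zwE cosh_double in Bzw.
have TE i j : T i j = hgram z i j + hgram w i j - 2 * cosh a * hgram p i j by rewrite !mxE.
apply: (hform_null Hp); first by rewrite !TE !hgram_sym.
  have -> : hform T (hgram p) = hform (hgram z) (hgram p) + hform (hgram p) (hgram w) -
      2 * cosh a * \det (hgram p).
    by rewrite /hform det2E !TE !hgram_sym; field.
  by rewrite Bzp Bpw Bpp; ring.
have -> : \det T = \det (hgram z) + \det (hgram w) + 4 * cosh a ^+ 2 * \det (hgram p) +
    2 * hform (hgram z) (hgram w) - 4 * cosh a * hform (hgram z) (hgram p) -
    4 * cosh a * hform (hgram p) (hgram w).
  by rewrite /hform !det2E !TE !hgram_sym; field.
by rewrite Bzz Bww Bpp Bzp Bpw Bzw; ring.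
Qed.

End HyperbolicForm.

(** The image [v = (al, be)] of [x] satisfies [v v^T = k x x^T], so [v = mu x] with [mu ^ 2 = k].
    The other eigenvalue of [M] is [1 / mu]. *)
Lemma eigen_trace_sq (R : realType) (M : 'M[R]_2) (x0 x1 k : R) (al be : R) :
  \det M = 1 -> 0 < k -> (x0 != 0) || (x1 != 0) ->
  al = M 0 0 * x0 + M 0 1 * x1 -> be = M 1 0 * x0 + M 1 1 * x1 ->
  al ^+ 2 = k * x0 ^+ 2 -> al * be = k * (x0 * x1) -> be ^+ 2 = k * x1 ^+ 2 ->
  \tr M ^+ 2 = k + k^-1 + 2.
Proof.
move=> dM k0 xn alE beE aa ab bb; rewrite trace2E.
have [mu [mu2 [e0 e1]]] : exists mu, mu ^+ 2 = k /\ al = mu * x0 /\ be = mu * x1.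
  have [x00|x00] := eqVneq x0 0.
    rewrite x00 eqxx /= in xn; exists (be / x1); split; last split.
    - by rewrite expr_div_n bb mulfK // sqrf_eq0.
    - by rewrite x00 mulr0; apply/eqP; rewrite -sqrf_eq0 aa x00 expr0n mulr0.
    - by rewrite divfK.
  exists (al / x0); split; last split.
  - by rewrite expr_div_n aa mulfK // sqrf_eq0.
  - by rewrite divfK.
  - have al0 : al != 0 by rewrite -sqrf_eq0 aa mulf_neq0 ?gt_eqF // exprn_even_gt0.
    apply: (mulfI al0); rewrite ab.
    have -> : al * (al / x0 * x1) = al ^+ 2 * x1 / x0 by field.
    by rewrite aa; field.
have mu0 : mu != 0 by rewrite -sqrf_eq0 mu2 gt_eqF.
rewrite det2E in dM.
move: alE beE; rewrite e0 e1; move: (M 0 0) (M 0 1) (M 1 0) (M 1 1) dM => a b c d dM E0 E1.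
have root x : (x == x0) || (x == x1) -> (mu ^+ 2 - (a + d) * mu + 1) * x = 0.
  rewrite -[X in _ + X]dM => /orP[]/eqP ->.
    have -> : (mu ^+ 2 - (a + d) * mu + (a * d - b * c)) * x0 =
      (mu - d) * (mu * x0 - (a * x0 + b * x1)) + b * (mu * x1 - (c * x0 + d * x1)) by ring.
    by rewrite -E0 -E1 !subrr !mulr0 addr0.
  have -> : (mu ^+ 2 - (a + d) * mu + (a * d - b * c)) * x1 =
    (mu - a) * (mu * x1 - (c * x0 + d * x1)) + c * (mu * x0 - (a * x0 + b * x1)) by ring.
  by rewrite -E0 -E1 !subrr !mulr0 addr0.
have chi : mu ^+ 2 - (a + d) * mu + 1 = 0.
  case/orP: xn => xn; apply: (mulIf xn); rewrite mul0r; apply: root;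
    by rewrite eqxx ?orbT.
have -> : a + d = mu + mu^-1.
  by apply: (mulIf mu0); rewrite [RHS]mulrDl mulVf // -expr2; lra.
by rewrite -mu2; field.
Qed.

(** * Lengths of closed geodesics *)

Section ProperDiscontinuity.
Variables (R : realType) (g : nat) (A : tuple_space R g).
Hypothesis GA : G_set A.
Local Notation C := (complex R).
Implicit Types (M N : 'M[R]_2) (w : word g).

Lemma eval_word_cat w1 w2 : eval_word A (w1 ++ w2) = eval_word A w1 * eval_word A w2.
Proof. exact: big_cat. Qed.

Definition inv_word w : word g := rev [seq inv_letter s | s <- w].

Lemma eval_inv_word w : eval_word A (inv_word w) = (eval_word A w)^-1.
Proof.
have unitE v : eval_word A v \is a GRing.unit.
  by rewrite unitmx2 (det_eval_word GA) oner_eq0.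
rewrite /inv_word; elim: w => [|s w IH]; first by rewrite /eval_word !big_nil invr1.
rewrite /= rev_cons -cats1 eval_word_cat IH.
have -> : eval_word A (s :: w) = eval_word A [:: s] * eval_word A w.
  by rewrite -eval_word_cat.
rewrite invrM ?unitE //; congr (_ * _).
rewrite /eval_word !big_seq1 /eval_letter /=.
by case: s.2; rewrite /= ?invrK.
Qed.

Lemma Gamma_det M : Gamma A M -> \det M = 1.
Proof.
move=> [w [->|->]]; first exact: det_eval_word.
by rewrite -scaleN1r detZ (det_eval_word GA) sqrrN expr1n mulr1.
Qed.

Lemma Gamma1 : Gamma A 1.
Proof. by exists [::]; left; rewrite /eval_word big_nil. Qed.

Lemma Gamma_eval w : Gamma A (eval_word A w).
Proof. by exists w; left. Qed.

Lemma Gamma_mulV M N : Gamma A M -> Gamma A N -> Gamma A (M^-1 * N).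
Proof.
move=> [w1 H1] [w2 H2]; exists (inv_word w1 ++ w2).
rewrite eval_word_cat eval_inv_word /psl_eq.
by case: H1 => ->; case: H2 => ->; rewrite ?invrN ?mulNr ?mulrN ?opprK; [left|right|right|left].
Qed.

Hypothesis discrete : Gamma A `<=` isolated (Gamma A).

Lemma Gamma_isolated1 : exists2 e : R, 0 < e &
  forall M, Gamma A M -> `|M - 1| < e -> M = 1.
Proof.
have [_ [V V1 VG]] := discrete Gamma1.
have [e e0 eV] := (nbhs_ltP _ _).1 V1.
exists e => // M GM Me.
have : (V `&` Gamma A) M by split => //; exact: eV.
by rewrite VG.
Qed.

(** [M^-1 N - 1 = M^-1 (N - M)], and [M^-1], being the adjugate, is bounded along with [M];
    isolation at the identity thus becomes uniform on bounded sets. *)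
Lemma Gamma_separated (B : R) : exists2 e : R, 0 < e &
  forall M N, Gamma A M -> Gamma A N -> `|M| <= B -> `|M - N| < e -> M = N.
Proof.
have [e0 e00 He] := Gamma_isolated1.
exists (e0 / (2 * `|B| + 1)); first by rewrite divr_gt0 // ltr_wpDl // mulr_ge0.
move=> M N GM GN MB; rewrite ltr_pdivlMr; last by rewrite ltr_wpDl // mulr_ge0.
move=> MN; have dM := Gamma_det GM.
have uM : M \is a GRing.unit by rewrite unitmx2 dM oner_eq0.
have invM : M^-1 = adj2 M by rewrite adj2_inv dM ?oner_eq0 // scale1r.
have nM : `|M^-1| <= `|B|.
  rewrite invM; apply: mx_norm_le => // i j.
  have MBi a b : `|M a b| <= `|B|.
    by apply: le_trans (ler_mx_norm _ _ _) _; apply: le_trans MB _; exact: ler_norm.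
  by rewrite mxE; do 2!case: ifP => _; rewrite ?normrN.
have M1N : M^-1 * N = 1.
  apply: He; first exact: Gamma_mulV.
  have -> : M^-1 * N - 1 = M^-1 * (N - M) by rewrite mulrBr mulVr.
  apply: le_lt_trans (ler_mulmx_norm _ _) _.
  rewrite distrC; apply: le_lt_trans MN; rewrite mulrC; apply: ler_wpM2l => //.
  by apply: le_trans (ler_wpM2l _ nM) _ => //; rewrite lerDl.
by rewrite -[LHS]mulr1 -M1N mulrA mulrV // mul1r.
Qed.

Lemma chd_moebius_bounded (z : C) : half_plane z -> exists B : R,
  forall M, \det M = 1 -> chd z (moebius M z) <= 2 -> `|M| <= B.
Proof.
case: z => x y Hz; have y0 : 0 < y := Hz.
pose B1 := 2 + 2 * `|x| / y; pose B2 := 2 * y + 2 * `|x| + `|x| * B1.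
have B10 : 0 <= B1 by rewrite addr_ge0 // divr_ge0 ?mulr_ge0 // ltW.
have B20 : 0 <= B2 by rewrite !addr_ge0 ?mulr_ge0 // ltW.
exists (B1 + B2 + 2 / y) => M dM.
rewrite -(ler_pM2l (ltr0Sn R 1)) (chd_conj x dM y0).
set a := M 0 0; set b := M 0 1; set c := M 1 0; set d := M 1 1.
set s1 := (_ ^+ 2); set s2 := (_ ^+ 2); set s3 := (_ ^+ 2); set s4 := (_ ^+ 2) => sum.
have s10 : 0 <= s1 by exact: sqr_ge0.
have s20 : 0 <= s2 by exact: sqr_ge0.
have s30 : 0 <= s3 by exact: sqr_ge0.
have s40 : 0 <= s4 by exact: sqr_ge0.
have sq (u : R) : u ^+ 2 <= 4 -> `|u| <= 2.
  move=> u4; rewrite -(@ler_pXn2r _ 2) ?nnegrE // -normrX ger0_norm ?sqr_ge0 //.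
  by rewrite (_ : 2 ^+ 2 = 4) // -natrX.
have n1 : `|a - c * x| <= 2 by apply: sq; rewrite -/s1; lra.
have n2 : `|(a * x + b - x * (c * x + d)) / y| <= 2 by apply: sq; rewrite -/s2; lra.
have n3 : `|c * y| <= 2 by apply: sq; rewrite -/s3; lra.
have n4 : `|c * x + d| <= 2 by apply: sq; rewrite -/s4; lra.
have cB : `|c| <= 2 / y.
  by rewrite ler_pdivlMr // (_ : `|c| * y = `|c * y|) // normrM (gtr0_norm y0).
have cxB : `|c * x| <= 2 * `|x| / y.
  by rewrite normrM mulrAC; apply: ler_wpM2r.
have aB : `|a| <= B1.
  rewrite -(subrK (c * x) a); apply: le_trans (ler_normD _ _) _; exact: lerD.
have dB : `|d| <= B1.
  rewrite -(addKr (c * x) d) addrC; apply: le_trans (ler_normB _ _) _; exact: lerD.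
have bB : `|b| <= B2.
  have -> : b = (a * x + b - x * (c * x + d)) / y * y + x * (c * x + d) - x * a.
    by field; rewrite gt_eqF.
  apply: le_trans (ler_normB _ _) _; apply: lerD; last by rewrite normrM ler_wpM2l.
  apply: le_trans (ler_normD _ _) _; apply: lerD.
    by rewrite normrM (gtr0_norm y0) ler_pM2r.
  by rewrite normrM mulrC ler_wpM2r.
have y2 : 0 <= 2 / y by rewrite divr_ge0 // ltW.
apply: mx_norm_le => [|i j]; first exact: addr_ge0 (addr_ge0 B10 B20) y2.
rewrite [M]mx2_eta -/a -/b -/c -/d mxE; do 2!case: ifP => _; lra.
Qed.

Lemma near_right_pos (P : R -> Prop) : (\forall r \near 0^'+, P r) ->
  exists2 r : R, 0 < r & P r.
Proof.
move=> HP; have : \forall r \near 0^'+, 0 < r /\ P r.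
  near=> r; split; [near: r; exact: nbhs_right_gt|near: r; exact: HP].
by move=> /filter_ex [r [r0 Pr]]; exists r.
Unshelve. all: by end_near. Qed.

(** Elements of [Gamma] that move [z] little lie in a compact ball of matrices. Each matrix of the
    ball has a neighbourhood containing at most one element of [Gamma], so some threshold works near
    it; compactness makes the threshold uniform. *)
Lemma moebius_proper (z : C) : half_plane z -> exists2 e : R, 0 < e &
  forall M, Gamma A M -> chd z (moebius M z) < 1 + e -> moebius M z = z.
Proof.
move=> Hz; have [B BP] := chd_moebius_bounded Hz.
have [dl dl0 sep] := Gamma_separated (`|B| + 1).
pose K : set 'rV[R]_(2 * 2) := [set v | `|v| <= `|B|].
have cK : compact K.
  apply: bounded_closed_compact.
    by exists `|B|; split; [exact: num_real|move=> r Br v /= Kv; exact: le_trans Kv (ltW Br)].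
  rewrite (_ : K = closed_ball_ Num.norm 0 `|B|); first exact: closed_closed_ball_.
  by apply/seteqP; split => v; rewrite /K /closed_ball_ /= sub0r normrN.
have HG M : Gamma A M -> half_plane (moebius M z).
  by move=> GM; have [] := moebius_spec (Gamma_det GM) Hz.
have vecB (v v' : 'rV[R]_(2 * 2)) : `|(vec_mx v - vec_mx v' : 'M[R]_2)| <= `|v - v'|.
  apply: mx_norm_le => // i j; rewrite -linearB /=.
  by rewrite mxE; exact: ler_mx_norm.
pose P (r : R) (v : 'rV[R]_(2 * 2)) := Gamma A (vec_mx v) ->
  moebius (vec_mx v) z = z \/ 1 + r <= chd z (moebius (vec_mx v) z).
have /compact_near_coveringP/(_ R (0^'+) P _) cover := cK.
have : \forall r \near 0^'+, K `<=` P r.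
  apply: cover => v Kv.
  pose rho := Num.min (dl / 2) 1.
  have rho0 : 0 < rho by rewrite lt_min divr_gt0 //= ltr01.
  have near_K v' : `|v' - v| < rho -> `|(vec_mx v' : 'M[R]_2)| <= `|B| + 1.
    rewrite lt_min => /andP[_ v1]; apply: mx_norm_le => [|i j]; first by rewrite addr_ge0.
    rewrite mxE; apply: le_trans (ler_mx_norm _ _ _) _.
    rewrite -(subrK v v') addrC; apply: le_trans (ler_normD _ _) _.
    by apply: lerD => //; exact: ltW.
  have same v1 v2 : Gamma A (vec_mx v1) -> Gamma A (vec_mx v2) ->
      `|v1 - v| < rho -> `|v2 - v| < rho -> vec_mx v1 = vec_mx v2 :> 'M[R]_2.
    move=> G1 G2 r1 r2; apply: sep => //; first exact: near_K.
    apply: le_lt_trans (vecB _ _) _; rewrite -(subrKA v).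
    apply: le_lt_trans (ler_normD _ _) _; rewrite (splitr dl) (distrC v v2).
    by move: r1 r2; rewrite !lt_min => /andP[r1 _] /andP[r2 _]; exact: ltrD.
  have [[v1 [G1 r1 m1]]|no] := pselect (exists v1, [/\ Gamma A (vec_mx v1),
      `|v1 - v| < rho & moebius (vec_mx v1) z <> z]).
    pose r0 := chd z (moebius (vec_mx v1) z) - 1.
    have r00 : 0 < r0.
      rewrite subr_gt0; have := chd_ge1 Hz (HG _ G1).
      rewrite le_eqVlt => /orP[/eqP e|//]; case: m1.
      by rewrite -(chd_eq1 Hz (HG _ G1) (esym e)).
    exists ([set v' | `|v' - v| < rho], [set r | r < r0]).
      split; first by apply/nbhs_ltP; exists rho.
      exact: nbhs_right_lt.
    move=> [v' r] /= [v'r rr] G'; right; rewrite (same _ _ G' G1 v'r r1).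
    by rewrite -lerBrDl ltW.
  exists ([set v' | `|v' - v| < rho], setT).
    split; first by apply/nbhs_ltP; exists rho.
    exact: filterT.
  move=> [v' r] /= [v'r _] G'; left; apply: contrapT => m'.
  by apply: no; exists v'.
move=> /near_right_pos[r r0 KP].
exists (Num.min r 1); first by rewrite lt_min r0 ltr01.
move=> M GM; rewrite -ltrBlDl lt_min !ltrBlDl => /andP[cr c1].
have MB : `|M| <= `|B|.
  by apply: le_trans (BP _ (Gamma_det GM) (ltW c1)) (ler_norm _).
have := KP (mxvec M); rewrite /P mxvecK; case=> //.
  rewrite /K /=; apply: mx_norm_le => // i j; rewrite (ord1 i).
  case/mxvec_indexP: j => a b; rewrite mxvecE.
  by apply: le_trans MB; exact: ler_mx_norm.
by rewrite leNgt cr.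
Qed.

End ProperDiscontinuity.

(* Here expR t *: P + expR (- t) *: Q is the form hgram along a geodesic, x is
   expR 2^-1 and k is expR l: the null form P is the square of an eigenvector
   of M, of eigenvalue +- expR (l / 2). *)
Lemma translation_trace_sq_mx (R : realType) (M P Q : 'M[R]_2) (x k : R) :
  \det M = 1 -> 1 < x -> 0 < k ->
  \det (P + Q) = 1 -> \det (x *: P + x^-1 *: Q) = 1 ->
  \det (x ^+ 2 *: P + (x ^+ 2)^-1 *: Q) = 1 ->
  (P + Q) 0 1 = (P + Q) 1 0 ->
  (x *: P + x^-1 *: Q) 0 1 = (x *: P + x^-1 *: Q) 1 0 ->
  k *: P + k^-1 *: Q = M *m (P + Q) *m M^T ->
  (x * k) *: P + (x * k)^-1 *: Q = M *m (x *: P + x^-1 *: Q) *m M^T ->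
  \tr M ^+ 2 = k + k^-1 + 2.
Proof.
move=> dM x1 k0; have x0 : x != 0 by rewrite gt_eqF // (lt_trans ltr01).
have y0 : x - x^-1 != 0.
  rewrite subr_eq0 gt_eqF // (@lt_trans _ _ 1) // invf_lt1 //.
  exact: lt_trans x1.
have kn : k != 0 by rewrite gt_eqF.
have MPE : forall S i j, (M *m S *m M^T) i j =
    (M i 0 * S 0 0 + M i 1 * S 1 0) * M j 0 + (M i 0 * S 0 1 + M i 1 * S 1 1) * M j 1.
  move=> S i j; change (M *m S *m M^T) with (M * S * M^T).
  by rewrite !mulmx2E ![M^T _ _]mxE.
rewrite !det2E !mxE => D0 D1 D2 S0 S1 /matrixP T0 /matrixP T1.
(* The combination of the two translation identities that cancels [Q]; what is left is divisible by
   [x - 1 / x]. *)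
have key i j : (M *m P *m M^T) i j = k * P i j.
  have := T0 i j; have := T1 i j; rewrite !MPE !mxE => t1 t0; apply: (mulfI y0).
  transitivity (x * k * P i j + (x * k)^-1 * Q i j - x^-1 * (k * P i j + k^-1 * Q i j)).
    by rewrite t1 t0; ring.
  by rewrite invfM; ring.
have sym : P 0 1 = P 1 0.
  apply: (mulfI y0).
  transitivity (x * P 0 1 + x^-1 * Q 0 1 - x^-1 * (P 0 1 + Q 0 1)); first by ring.
  by rewrite S0 S1; ring.
have [rank1 P0] : P 0 0 * P 1 1 = P 0 1 ^+ 2 /\ (P 0 0 != 0) || (P 1 1 != 0).
  have x0' : x ^+ 2 - 1 != 0 by rewrite subr_eq0 gt_eqF // exprn_egt1.
  (* The determinant of [s P + s^-1 Q] is [a s ^ 2 + b + c / s ^ 2]. Being 1 at [s = 1, x, x ^ 2],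
     it has [a = c = 0] and [b = 1]: thus [P] has rank at most 1, and [b = 1] prevents it from
     vanishing. *)
  pose a := P 0 0 * P 1 1 - P 0 1 ^+ 2; pose c := Q 0 0 * Q 1 1 - Q 0 1 ^+ 2.
  pose b := P 0 0 * Q 1 1 + Q 0 0 * P 1 1 - 2 * P 0 1 * Q 0 1.
  have symQ : Q 0 1 = Q 1 0 by move: S0; rewrite sym => /addrI.
  rewrite -!sym -!symQ in D0 D1 D2.
  have d0 : a + b + c = 1 by rewrite -D0 /a /b /c; ring.
  have d1 : a * x ^+ 2 + b + c / x ^+ 2 = 1 by rewrite -D1 /a /b /c; field.
  have d2 : a * x ^+ 4 + b + c / x ^+ 4 = 1 by rewrite -D2 /a /b /c; field.
  have e1 : a * x ^+ 2 = c.
    apply: (mulfI x0'); apply/eqP; rewrite -subr_eq0; apply/eqP.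
    transitivity (x ^+ 2 * (a * x ^+ 2 + b + c / x ^+ 2 - (a + b + c))); first by field.
    by rewrite d0 d1 subrr mulr0.
  have e2 : a = 0.
    have : (x ^+ 2 - 1) * (x ^+ 2 - 1) * (x ^+ 2 + 1) * a = 0.
      transitivity (x ^+ 2 * (a * x ^+ 4 + b + c / x ^+ 4 - (a * x ^+ 2 + b + c / x ^+ 2))).
        by rewrite -e1; field.
      by rewrite d1 d2 subrr mulr0.
    have x2 : x ^+ 2 + 1 != 0 by rewrite gt_eqF // ltr_wpDl // sqr_ge0.
    by move=> /eqP; rewrite !mulf_eq0 (negPf x0') (negPf x2) => /eqP.
  have b1 : b = 1 by move: d0; rewrite -e1 e2 mul0r add0r addr0.
  split; first by apply/eqP; rewrite -subr_eq0 -/a e2.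
  rewrite -negb_and; apply/negP => /andP[/eqP p0 /eqP r0].
  have q0 : P 0 1 = 0.
    by apply/eqP; rewrite -sqrf_eq0 -oppr_eq0 -[- _]add0r -{1}(mul0r (P 1 1)) -{1}p0 -/a e2.
  by move: b1; rewrite /b p0 r0 q0 mul0r !mulr0 !mul0r addr0 subr0 => /esym/eqP; rewrite oner_eq0.
have := key 0 0; have := key 0 1; have := key 1 1; rewrite !MPE -!sym.
move: (P 0 0) (P 0 1) (P 1 1) rank1 P0 => p q r pr pn k11 k01 k00.
have [p0|p0] := eqVneq p 0.
  have q0 : q = 0 by apply/eqP; rewrite -sqrf_eq0 -pr p0 mul0r.
  move: pn; rewrite {1}p0 eqxx /= => r0.
  apply: (@eigen_trace_sq _ M q r k (M 0 0 * q + M 0 1 * r) (M 1 0 * q + M 1 1 * r)) => //.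
  - by rewrite r0 orbT.
  - have -> : (M 0 0 * q + M 0 1 * r) ^+ 2 =
        r * ((M 0 0 * p + M 0 1 * q) * M 0 0 + (M 0 0 * q + M 0 1 * r) * M 0 1) -
        M 0 0 * M 0 0 * (p * r - q ^+ 2) by ring.
    by rewrite k00 pr subrr mulr0 subr0 -pr; ring.
  - have -> : (M 0 0 * q + M 0 1 * r) * (M 1 0 * q + M 1 1 * r) =
        r * ((M 0 0 * p + M 0 1 * q) * M 1 0 + (M 0 0 * q + M 0 1 * r) * M 1 1) -
        M 0 0 * M 1 0 * (p * r - q ^+ 2) by ring.
    by rewrite k01 pr subrr mulr0 subr0; ring.
  - have -> : (M 1 0 * q + M 1 1 * r) ^+ 2 =
        r * ((M 1 0 * p + M 1 1 * q) * M 1 0 + (M 1 0 * q + M 1 1 * r) * M 1 1) -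
        M 1 0 * M 1 0 * (p * r - q ^+ 2) by ring.
    by rewrite k11 pr subrr mulr0 subr0; ring.
apply: (@eigen_trace_sq _ M p q k (M 0 0 * p + M 0 1 * q) (M 1 0 * p + M 1 1 * q)) => //.
  - by rewrite p0.
  - have -> : (M 0 0 * p + M 0 1 * q) ^+ 2 =
        p * ((M 0 0 * p + M 0 1 * q) * M 0 0 + (M 0 0 * q + M 0 1 * r) * M 0 1) -
        M 0 1 * M 0 1 * (p * r - q ^+ 2) by ring.
    by rewrite k00 pr subrr mulr0 subr0; ring.
  - have -> : (M 0 0 * p + M 0 1 * q) * (M 1 0 * p + M 1 1 * q) =
        p * ((M 0 0 * p + M 0 1 * q) * M 1 0 + (M 0 0 * q + M 0 1 * r) * M 1 1) -
        M 0 1 * M 1 1 * (p * r - q ^+ 2) by ring.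
    by rewrite k01 pr subrr mulr0 subr0; ring.
  - have -> : (M 1 0 * p + M 1 1 * q) ^+ 2 =
        p * ((M 1 0 * p + M 1 1 * q) * M 1 0 + (M 1 0 * q + M 1 1 * r) * M 1 1) -
        M 1 1 * M 1 1 * (p * r - q ^+ 2) by ring.
    by rewrite k11 pr subrr mulr0 subr0 -pr; ring.
Qed.

(** * The lift of a closed geodesic and its translation *)

Section GeodesicTrace.
Variables (R : realType) (g : nat) (A : tuple_space R g).
Hypothesis GA : G_set A.
Hypothesis discrete : Gamma A `<=` isolated (Gamma A).
Local Notation C := (complex R).
Variables (l : R) (c : R -> set C) (lift : R -> C).
Hypothesis geod : forall t, exists2 e, 0 < e & forall s s',
  `|s - t| < e -> `|s' - t| < e -> surface_dist (c s) (c s') = `|s - s'|.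
Hypothesis liftRe : continuous (fun t => complex.Re (lift t)).
Hypothesis liftIm : continuous (fun t => complex.Im (lift t)).
Hypothesis liftH : forall t, half_plane (lift t).
Hypothesis liftc : forall t, c t = orbit_of A (lift t).

Let dists s s' : set R := [set hyp_dist z w | z in c s & w in c s'].

Let orbitH t z : c t z -> half_plane z.
Proof.
rewrite liftc => -[M GM <-].
by have [] := moebius_spec (Gamma_det GA GM) (liftH t).
Qed.

Let dists_lb s s' : lbound (dists s s') 0.
Proof.
move=> _ [z zs [w ws <-]].
by have [] := hyp_dist_chd (orbitH zs) (orbitH ws).
Qed.

Let lift_orbit t : c t (lift t).
Proof. by rewrite liftc; exists 1; [exact: Gamma1|exact: moebius1]. Qed.

Let dists_lift s s' : dists s s' (hyp_dist (lift s) (lift s')).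
Proof.
exists (lift s); first exact: lift_orbit.
by exists (lift s'); first exact: lift_orbit.
Qed.

Let lift_lower s s' : surface_dist (c s) (c s') = `|s - s'| ->
  `|s - s'| <= hyp_dist (lift s) (lift s').
Proof.
move=> <-; apply: ge_inf; last exact: dists_lift.
by exists 0; exact: dists_lb.
Qed.

(** The distance on the surface is an infimum, so only an element of [Gamma] approaching it within
    [e] is available. *)
Let lift_upper s s' e : surface_dist (c s) (c s') = `|s - s'| -> 0 < e ->
  exists2 M, Gamma A M & chd (lift s) (moebius M (lift s')) <= cosh (`|s - s'| + e).
Proof.
move=> sd e0; have hinf : has_inf (dists s s').
  split; first by exists (hyp_dist (lift s) (lift s')); exact: dists_lift.
  by exists 0; exact: dists_lb.
have [_ [z zs [w ws <-]] lt_e] := inf_adherent e0 hinf.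
rewrite -/(surface_dist (c s) (c s')) sd in lt_e.
have Hz := orbitH zs; have Hw := orbitH ws; move: zs ws; rewrite !liftc.
move=> [M GM Mz] [N GN Nw]; exists (M^-1 * N); first exact: Gamma_mulV.
have dM := Gamma_det GA GM; have dN := Gamma_det GA GN.
have dMN := Gamma_det GA (Gamma_mulV GA GM GN).
have [HMN _] := moebius_spec dMN (liftH s').
rewrite -(chd_moebius dM (liftH s) HMN) -moebiusM //.
have uM : M \is a GRing.unit by rewrite unitmx2 dM oner_eq0.
rewrite mulVKr // Mz Nw.
have [d0 <-] := hyp_dist_chd Hz Hw.
by apply: cosh_le => //; exact: ltW.
Qed.

Let chd_lift_continuous t : {for t, continuous (fun s => chd (lift t) (lift s))}.
Proof.
have E : (fun s => chd (lift t) (lift s)) = fun s => 1 +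
   ((complex.Re (lift t) - complex.Re (lift s)) ^+ 2 +
    (complex.Im (lift t) - complex.Im (lift s)) ^+ 2) /
   (2 * complex.Im (lift t) * complex.Im (lift s)).
  by apply/funext => s; rewrite /chd; case: (lift t) => ? ?; case: (lift s).
rewrite E; apply: cvgD; first exact: cvg_cst.
apply: cvgM.
  by apply: cvgD; apply: cvgM; apply: cvgB; (exact: cvg_cst || exact: liftRe || exact: liftIm).
apply: cvgV.
  by rewrite gt_eqF // !mulr_gt0 //; exact: liftH.
by apply: cvgM; [exact: cvg_cst|exact: liftIm].
Qed.

(** The lift itself realizes distances near [t]: the [M] of [lift_upper] brings [lift s] close to
    [lift t], hence moves [lift t] little, hence fixes it by [moebius_proper]; then [M] can be
    removed from the distance. *)
Let lift_local t : exists2 e : R, 0 < e & forall a, 0 < a < e ->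
  [/\ chd (lift (t + a)) (lift t) = cosh a, chd (lift t) (lift (t - a)) = cosh a &
      cosh (a + a) <= chd (lift (t + a)) (lift (t - a))].
Proof.
have [e1 e10 gd] := geod t.
have [rho rho0 proper] := moebius_proper GA discrete (liftH t).
(* Two legs with [chd] at most [1 + dl] compose to at most [2 (1 + dl) ^ 2 - 1 <= 1 + 6 dl], which
   is below [1 + rho]. *)
pose dl := Num.min 1 (rho / 7).
have dl0 : 0 < dl by rewrite lt_min ltr01 divr_gt0.
have dl1 : dl <= 1 by rewrite ge_min lexx.
have dlr : dl * 7 <= rho by rewrite -ler_pdivlMr // ge_min lexx orbT.
have [e2 e20 cosh2] : exists2 e : R, 0 < e & forall a, `|a| < e -> cosh a <= 1 + dl.
  have /cvgrPdist_lt/(_ _ dl0) := @continuous_cosh R 0.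
  move=> /nbhs_ltP[e e0 He]; exists e => // a ae.
  have := He a; rewrite subr0 cosh0 => /(_ ae); rewrite distrC ltr_norml => /andP[_ h].
  by rewrite -lerBlDl ltW.
have [e3 e30 near3] : exists2 e : R, 0 < e & forall s, `|s - t| < e ->
    chd (lift t) (lift s) <= 1 + dl.
  have /cvgrPdist_lt/(_ _ dl0) := @chd_lift_continuous t.
  move=> /nbhs_ltP[e e0 He]; exists e => // s se.
  have := He s se; rewrite chdxx distrC ltr_norml => /andP[_ h].
  by rewrite -lerBlDl ltW.
pose e := Num.min e1 (Num.min (e2 / 2) e3).
have e0 : 0 < e by rewrite !lt_min e10 e30 divr_gt0.
have upper s : `|s - t| < e -> chd (lift t) (lift s) = cosh (s - t).
  rewrite !lt_min => /andP[s1 /andP[s2 s3]].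
  have sd : surface_dist (c t) (c s) = `|t - s|.
    by apply: gd => //; rewrite subrr normr0.
  have [hd0 hdE] := hyp_dist_chd (liftH t) (liftH s).
  rewrite -hdE -[RHS]cosh_norm distrC; congr cosh.
  apply/eqP; rewrite eq_le; apply/andP; split; last exact: lift_lower.
  apply/ler_addgt0Pr => eps eps0.
  pose eps' := Num.min eps (e2 / 2).
  have eps'0 : 0 < eps' by rewrite lt_min eps0 divr_gt0.
  apply: (@le_trans _ _ (`|t - s| + eps')); last by rewrite lerD2l ge_min lexx.
  apply: cosh_le_inv; first by rewrite addr_ge0 // ltW.
  rewrite hdE; have [M GM Mle] := lift_upper sd eps'0.
  have Mle' := Mle; apply: le_trans Mle'; have dM := Gamma_det GA GM.
  have [HMs _] := moebius_spec dM (liftH s); have [HMt _] := moebius_spec dM (liftH t).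
  have x1 : chd (lift t) (moebius M (lift s)) <= 1 + dl.
    apply: (le_trans Mle); apply: cosh2.
    rewrite ger0_norm ?addr_ge0 // 1?ltW //.
    rewrite (splitr e2) distrC; apply: ltr_leD => //.
    by rewrite ge_min lexx orbT.
  have y1 : chd (moebius M (lift s)) (moebius M (lift t)) <= 1 + dl.
    by rewrite chd_moebius // chdC // near3.
  have fix_t : moebius M (lift t) = lift t.
    apply: proper => //.
    have := chd_gram (liftH t) HMs HMt.
    have := chd_ge1 (liftH t) HMs; have := chd_ge1 HMs HMt.
    move: x1 y1; move: (chd (lift t) (moebius M (lift s))) => x.
    move: (chd (moebius M (lift s)) _) => y; move: (chd _ _) => u x1 y1 y2 x2 G.
    rewrite ltNge; apply/negP => u1.
    have xy : x * y <= (1 + dl) ^+ 2 by rewrite expr2; apply: ler_pM => //; lra.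
    have x3 : x ^+ 2 - 1 <= (1 + dl) ^+ 2 - 1.
      by rewrite lerD2r; apply: lerXn2r; rewrite ?nnegrE; lra.
    have y3 : y ^+ 2 - 1 <= (1 + dl) ^+ 2 - 1.
      by rewrite lerD2r; apply: lerXn2r; rewrite ?nnegrE; lra.
    have x4 : 0 <= x ^+ 2 - 1 by rewrite subr_ge0 exprn_ege1.
    have y4 : 0 <= y ^+ 2 - 1 by rewrite subr_ge0 exprn_ege1.
    have d2 : dl ^+ 2 <= dl by rewrite expr2 ler_piMl // ltW.
    have key : (1 + dl) ^+ 2 = 1 + 2 * dl + dl ^+ 2 by ring.
    have big : (1 + dl) ^+ 2 - 1 < u - x * y by rewrite key in xy *; lra.
    have : ((1 + dl) ^+ 2 - 1) ^+ 2 < (x * y - u) ^+ 2.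
      rewrite -[ltRHS]sqrrN opprB ltr_pXn2r ?nnegrE //; first by lra.
      by apply: le_trans (ltW big); lra.
    rewrite ltNge => /negP; apply; apply: le_trans G _.
    by rewrite expr2; exact: ler_pM.
  by rewrite -[in leRHS]fix_t (chd_moebius dM (liftH t) (liftH s)).
exists e => // a /andP[a0 ae].
have na : `|a| = a by rewrite gtr0_norm.
have e1a : a < e1 by apply: lt_le_trans ae _; rewrite ge_min lexx.
split.
- rewrite chdC // upper addrAC subrr add0r //; first by rewrite na.
- by rewrite upper addrAC subrr add0r ?coshN // normrN na.
have sd : surface_dist (c (t + a)) (c (t - a)) = `|t + a - (t - a)|.
  by apply: gd; rewrite addrAC subrr add0r ?normrN na.
have [hd0 <-] := hyp_dist_chd (liftH (t + a)) (liftH (t - a)).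
apply: cosh_le; first by rewrite addr_ge0 // ltW.
apply: le_trans (lift_lower sd).
have -> : t + a - (t - a) = a + a by ring.
by rewrite ger0_norm ?addr_ge0 // ltW.
Qed.

Let hgram_lift_continuous i j : continuous (fun t => hgram (lift t) i j).
Proof.
have Im0 t : complex.Im (lift t) != 0 by rewrite gt_eqF //; exact: liftH.
have cV : continuous (fun t => (complex.Im (lift t))^-1).
  by move=> t; apply: cvgV; [exact: Im0|exact: liftIm].
have cRe : continuous (fun t => complex.Re (lift t) / complex.Im (lift t)).
  by move=> t; apply: cvgM; [exact: liftRe|exact: cV].
move=> t; case: (ord2P i) => ->; case: (ord2P j) => ->.
- under eq_fun do rewrite mx2E; apply: cvgM; last exact: cV.
  by apply: cvgD; apply: cvgM; (exact: liftRe || exact: liftIm).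
- by under eq_fun do rewrite mx2E; exact: cRe.
- by under eq_fun do rewrite mx2E; exact: cRe.
- by under eq_fun do rewrite mx2E; exact: cV.
Qed.

Let hgram_lift_mean i j : cosh_mean (fun t => hgram (lift t) i j).
Proof.
move=> t; have [e e0 He] := lift_local t; exists e => // a ae.
have [h1 h2 h3] := He a ae; have a0 : 0 <= a by case/andP: ae => /ltW.
have := hgram_midpoint (liftH _) (liftH _) (liftH _) a0 h1 h2 h3.
by move=> /matrixP/(_ i j); rewrite !mxE.
Qed.

Let hgram_lift_span (p q : R) : p < q -> exists P Q : 'M[R]_2,
  forall t, p <= t <= q -> hgram (lift t) = expR t *: P + expR (- t) *: Q.
Proof.
move=> pq; have /choice[ab H] : forall ij : 'I_2 * 'I_2, exists ab : R * R,
    forall t, p <= t <= q ->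
    hgram (lift t) ij.1 ij.2 = ab.1 * expR t + ab.2 * expR (- t).
  move=> [i j]; have [al [be H]] := cosh_mean_span pq
     (@hgram_lift_continuous i j) (@hgram_lift_mean i j).
  by exists (al, be).
exists (\matrix_(i, j) (ab (i, j)).1), (\matrix_(i, j) (ab (i, j)).2) => t tpq.
by apply/matrixP => i j; rewrite (H (i, j)) // !mxE mulrC [in RHS](mulrC (expR (- t))).
Qed.

Hypothesis l0 : 0 < l.
Variable M : 'M[R]_2.
Hypothesis GM : Gamma A M.
Hypothesis liftM : forall t, lift (t + l) = moebius M (lift t).

Lemma translation_trace_sq : \tr M ^+ 2 = expR l + (expR l)^-1 + 2.
Proof.
(* The segment [[0, l + 1]] contains [[0, 1]] and its translate by [l]. The times 0, 1/2 and 1 give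
   the powers 1, [x] and [x ^ 2] of [x = expR 2^-1]. *)
have l1 : 0 < l + 1 by rewrite addr_gt0.
have [P [Q PQ]] := hgram_lift_span l1.
have dM := Gamma_det GA GM.
have in0 t : 0 <= t -> t <= 1 -> 0 <= t <= l + 1.
  by move=> t0 t1; rewrite t0 (le_trans t1) // lerDr ltW.
have inl t : 0 <= t -> t <= 1 -> 0 <= t + l <= l + 1.
  by move=> t0 t1; rewrite addr_ge0 ?(ltW l0) //= addrC lerD2l.
have HM t : 0 <= t -> t <= 1 -> expR (t + l) *: P + expR (- (t + l)) *: Q =
    M *m (expR t *: P + expR (- t) *: Q) *m M^T.
  move=> t0 t1; rewrite -(PQ _ (in0 _ t0 t1)) -(PQ _ (inl _ t0 t1)) liftM.
  by have [] := moebius_spec dM (liftH t).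
have detPQ t : 0 <= t -> t <= 1 -> \det (expR t *: P + expR (- t) *: Q) = 1.
  by move=> t0 t1; rewrite -(PQ _ (in0 _ t0 t1)) det_hgram.
have symPQ t : 0 <= t -> t <= 1 -> (expR t *: P + expR (- t) *: Q) 0 1 =
    (expR t *: P + expR (- t) *: Q) 1 0.
  by move=> t0 t1; rewrite -(PQ _ (in0 _ t0 t1)) hgram_sym.
have z1 : (0 : R) <= 1 by [].
have h0 : (0 : R) <= 2^-1 by rewrite invr_ge0.
have h1 : (2^-1 : R) <= 1 by rewrite invf_le1 // ler1n.
have x1 : 1 < expR (2^-1 : R) by rewrite -expR0 ltr_expR invr_gt0.
have xx : expR (1 : R) = expR 2^-1 ^+ 2.
  by rewrite expr2 -expRD; congr expR; lra.
have E0 : expR 0 *: P + expR (- 0) *: Q = P + Q by rewrite oppr0 expR0 !scale1r.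
have := HM 0 (lexx 0) z1; have := HM 2^-1 h0 h1.
have := detPQ 0 (lexx 0) z1; have := detPQ 2^-1 h0 h1; have := detPQ 1 z1 (lexx 1).
have := symPQ 0 (lexx 0) z1; have := symPQ 2^-1 h0 h1.
rewrite add0r E0 !expRN expRD xx => S1 S0 D2 D1 D0 T1 T0.
exact: (@translation_trace_sq_mx R M P Q (expR 2^-1) (expR l)) (expR_gt0 _) _ _ _ _ _ _ _.
Qed.

End GeodesicTrace.

Lemma geodesic_length_trace (R : realType) (g : nat) (A : tuple_space R g)
    (W : word g) (l : R) : G_set A -> defines_closed_surface A ->
  is_geodesic_length A W l ->
  0 < l /\ \tr (eval_word A W) ^+ 2 = expR l + (expR l)^-1 + 2.
Proof.
move=> GA [_ discrete] [c [l0 _ _ geod] [lift [[liftRe liftIm] liftH liftc liftM]]].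
split=> //; apply: (translation_trace_sq GA discrete geod liftRe liftIm liftH liftc l0) liftM.
exact: Gamma_eval.
Qed.

(** * The length gap *)

Section Words.
Variable g : nat.

(** Words of length exactly [m] over the [4 g] letters and a blank; erasing the blanks yields all
    words of length at most [m], with repetitions. *)
Definition short_words (m : nat) : seq (word g) :=
  [seq pmap id (val s) | s <- enum {: m.-tuple (option ('I_(2 * g) * bool))}].

Lemma size_short_words m : size (short_words m) = ((4 * g).+1 ^ m)%N.
Proof.
rewrite size_map -cardE card_tuple card_option card_prod card_ord card_bool.
by congr (_.+1 ^ _)%N; lia.
Qed.

Lemma mem_short_words m w : (w \in short_words m) = (size w <= m)%N.
Proof.
apply/mapP/idP => [[s _ ->]|wm].
  by rewrite size_pmap -[leqRHS](size_tuple s) count_size.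
have hs : size ([seq Some s | s <- w] ++ nseq (m - size w) None) == m.
  by rewrite size_cat size_map size_nseq subnKC.
exists (Tuple hs); first exact: mem_enum.
rewrite /= {hs wm}; move: (m - _)%N => n.
by elim: w => [|x w IH] /=; [elim: n|rewrite -IH].
Qed.

Definition short_gaps N (m : nat) : seq (ipoly N) :=
  [seq trace_gap N w1 w2 | w1 <- short_words m, w2 <- short_words m].

Lemma deg_short_gaps N m f : f \in short_gaps N m -> ipoly_deg_le (16 * m) f.
Proof.
move=> /allpairsP[[w1 w2] [/= h1 h2 ->]].
by apply: deg_trace_gap; rewrite -mem_short_words.
Qed.

Let t : nat := trunc_log 2 ((4 * g - 1) ^ 3).

(* With q = 4g - 1 >= 7, (4g + 1)^2 <= (81 / 49) q^2 while q^3 < 2 * 2^t, whence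
   the ratio 162 / 343. *)
Lemma size_short_gaps N m : (2 <= g)%N ->
  (size (short_gaps N m) * 343 ^ m <= 162 ^ m * 2 ^ (t * m))%N.
Proof.
move=> hg; rewrite size_allpairs size_short_words -!expnMn expnM -expnMn.
case: m => // m; rewrite leq_exp2r //.
pose q := (4 * g - 1)%N; have q7 : (7 <= q)%N by rewrite /q; lia.
have -> : ((4 * g).+1 = q + 2)%N by rewrite /q; lia.
have : (q ^ 3 < 2 ^ t.+1)%N by apply: trunc_log_ltn.
rewrite [(2 ^ _)%N]expnS; move: (2 ^ t)%N => T.
have : (343 * ((q + 2) * (q + 2)) <= 81 * q ^ 3)%N.
  have h : (7 * (q + 2) <= 9 * q)%N by lia.
  have := leq_mul (leq_mul h h) q7; rewrite /expn /=; lia.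
by lia.
Qed.
End Words.

Lemma finite_gap (R : realType) (T : eqType) (s : seq T) (f : T -> R) :
  exists2 K : R, 0 < K & forall x, x \in s -> f x != 0 -> K <= `|f x|.
Proof.
elim: s => [|x s [K K0 IH]]; first by exists 1.
have [fx|fx] := eqVneq (f x) 0.
  exists K => // y; rewrite inE => /orP[/eqP ->|ys]; last exact: IH.
  by rewrite fx eqxx.
exists (Num.min K `|f x|); first by rewrite lt_min K0 normr_gt0.
move=> y; rewrite inE => /orP[/eqP -> _|ys fy]; rewrite ge_min ?lexx ?orbT //.
by rewrite IH.
Qed.

Section TraceLength.
Variable R : realType.
Implicit Types l : R.

Lemma trace_length_inj l1 l2 : 0 < l1 -> 0 < l2 ->
  expR l1 + (expR l1)^-1 = expR l2 + (expR l2)^-1 -> l1 = l2.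
Proof.
rewrite -!expRN => l10 l20 e; have ce : cosh l1 = cosh l2 by rewrite /cosh e.
by apply/eqP; rewrite eq_le; apply/andP; split; apply: cosh_le_inv;
  rewrite ?ce // ltW.
Qed.

(** The derivative of [expR l + expR (- l)] is at most [expR l <= T] for positive [l]; this turns a
    gap between traces into a gap between lengths. *)
Lemma trace_length_lipschitz l1 l2 T : 0 < l1 -> 0 < l2 ->
  expR l1 <= T -> expR l2 <= T ->
  `|expR l1 + (expR l1)^-1 - (expR l2 + (expR l2)^-1)| <= `|l1 - l2| * T.
Proof.
wlog l21 : l1 l2 / l2 <= l1.
  move=> H l10 l20 T1 T2; have [l21|/ltW l12] := leP l2 l1; first exact: H.
  by rewrite distrC [X in _ <= X * _]distrC; exact: H.
move=> l10 l20 T1 _; have e1 := expR_gt0 l1; have e2 := expR_gt0 l2.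
have e12 : expR l2 <= expR l1 by rewrite ler_expR.
have E : expR l1 + (expR l1)^-1 - (expR l2 + (expR l2)^-1) =
    (expR l1 - expR l2) * (1 - (expR l1 * expR l2)^-1).
  by field; rewrite !gt_eqF.
have p1 : 1 <= expR l1 * expR l2.
  by rewrite -expRD -expR0 ler_expR addr_ge0 // ltW.
have f1 : 0 <= 1 - (expR l1 * expR l2)^-1.
  by rewrite subr_ge0 invf_le1 // (lt_le_trans ltr01).
have f2 : 1 - (expR l1 * expR l2)^-1 <= 1.
  by rewrite gerBl invr_ge0 mulr_ge0 // ltW.
have -> : `|l1 - l2| = l1 - l2 by rewrite ger0_norm // subr_ge0.
rewrite E ger0_norm; last by rewrite mulr_ge0 // subr_ge0.
apply: (@le_trans _ _ (expR l1 - expR l2)).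
  by rewrite ler_piMr // subr_ge0.
apply: (@le_trans _ _ ((l1 - l2) * expR l1)); last by rewrite ler_wpM2l ?subr_ge0.
have -> : expR l2 = expR l1 * expR (l2 - l1) by rewrite -expRD addrC subrK.
rewrite -[X in X - _]mulr1 -mulrBr mulrC ler_wpM2r ?(ltW e1) //.
by have := expR_ge1Dx (l2 - l1); lra.
Qed.
End TraceLength.

Lemma trace_word_bound (R : realType) (g : nat) (A : tuple_space R g) :
  exists2 B : R, 1 <= B & forall w : word g, \tr (eval_word A w) ^+ 2 <= 4 * B ^+ size w.
Proof.
pose b : R := 1 + \sum_(s : 'I_(2 * g) * bool) `|eval_letter A s|.
have b1 : 1 <= b by rewrite lerDl sumr_ge0.
have b0 : 0 <= b by exact: le_trans b1.
have sb s : `|eval_letter A s| <= b.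
  by rewrite /b (bigD1 s) //= ler_wpDl // lerDl sumr_ge0.
have wb w : `|eval_word A w| <= (2 * b) ^+ size w.
  rewrite /eval_word; elim: w => [|s w IH].
    rewrite big_nil; apply: mx_norm_le => // i j; rewrite mxE.
    by case: eqP; rewrite ?normr1 ?normr0.
  rewrite big_cons exprS; apply: le_trans (ler_mulmx_norm _ _) _.
  by apply: ler_pM; rewrite ?mulr_ge0 // ler_wpM2l.
exists ((2 * b) ^+ 2).
  by rewrite exprn_ege1 //; lra.
move=> w; rewrite -exprM mulnC exprM; apply: (@le_trans _ _ ((2 * `|eval_word A w|) ^+ 2)).
  rewrite -[leLHS]real_normK ?num_real //; apply: lerXn2r; rewrite ?nnegrE ?mulr_ge0 //.
  rewrite trace2E mulr2n mulrDl !mul1r; apply: le_trans (ler_normD _ _) _.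
  by apply: lerD; exact: ler_mx_norm.
have -> : (2 * `|eval_word A w|) ^+ 2 = 4 * `|eval_word A w| ^+ 2 by ring.
by rewrite ler_wpM2l //; apply: lerXn2r; rewrite ?nnegrE ?exprn_ge0 ?mulr_ge0.
Qed.

(** The source of 48: degree [16 m] times [t m] digits, with [2 ^ t <= q ^ 3]. *)
Lemma pow2_trunc_log q m : (0 < q)%N ->
  (2 ^ (16 * m * (trunc_log 2 (q ^ 3) * m)) <= q ^ (48 * m ^ 2))%N.
Proof.
move=> q0; set t := trunc_log _ _.
have -> : (16 * m * (t * m) = t * (16 * m ^ 2))%N by rewrite -mulnn; ring.
have -> : (48 * m ^ 2 = 3 * (16 * m ^ 2))%N by ring.
rewrite (expnM 2 t) (expnM q 3); case: (16 * m ^ 2)%N => [|e]; first by [].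
by rewrite leq_exp2r //; apply: trunc_logP => //; rewrite expn_gt0 q0.
Qed.

(** Outside [often_small] the bound holds for all pairs of length at least some [m0]; the finitely
    many shorter pairs only affect the constant. *)
Lemma trace_sq_gap (R : realType) (g k : nat) (A : tuple_space R g) : (2 <= g)%N ->
  G_set A -> shear_generic k A ->
  ~ often_small (trunc_log 2 ((4 * g - 1) ^ 3)) (@short_gaps g (6 * g - 3))
      (chart_coord k A) ->
  exists K C : R, [/\ 0 < K, 1 <= C & forall W1 W2 : word g,
    \tr (eval_word A W1) ^+ 2 != \tr (eval_word A W2) ^+ 2 ->
    K <= `|\tr (eval_word A W1) ^+ 2 - \tr (eval_word A W2) ^+ 2| *
         (((4 * g - 1) ^ (48 * (maxn (size W1) (size W2)) ^ 2))%:R *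
          C ^+ maxn (size W1) (size W2))].
Proof.
move=> hg GA good; set t := trunc_log _ _; set y := coord_fun (chart_coord k A).
move=> /existsNP[m0 notsmall].
have g0 : (0 < g)%N by lia.
have q0 : (0 < 4 * g - 1)%N by lia.
have genA := sheared_gen g0 GA good.1 (or_introl good.2).
have [L L1 LP] := trace_gap_value GA (coord_fun_var (chart_coord k A)) genA.
pose gap (W : word g * word g) : R :=
  \tr (eval_word A W.1) ^+ 2 - \tr (eval_word A W.2) ^+ 2.
have [K K0 KP] := @finite_gap R _
  [seq (w1, w2) | w1 <- short_words g m0, w2 <- short_words g m0] gap.
(* [2^-1] is the factor in the threshold of [often_small]; the exponent 4 comes from
   [2 (|W1| + |W2|) <= 4 m]. *)
exists (Num.min K 2^-1), (L ^+ 4); split; [|exact: exprn_ege1|].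
  by rewrite lt_min K0 invr_gt0 ltr0n.
move=> W1 W2 trn; set m := maxn _ _.
have L0 : 0 <= L by exact: le_trans L1.
have gapn : gap (W1, W2) != 0 by rewrite subr_eq0.
have W1m : (size W1 <= m)%N := leq_maxl _ _.
have W2m : (size W2 <= m)%N := leq_maxr _ _.
have q1 : 1 <= ((4 * g - 1) ^ (48 * m ^ 2))%:R :> R.
  by rewrite ler1n expn_gt0 q0.
rewrite -[X in _ <= `|X| * _]/(gap (W1, W2)).
have [m0m|mm0] := leqP m0 m; last first.
  apply: (@le_trans _ _ `|gap (W1, W2)|).
    rewrite ge_min; apply/orP; left; apply: KP => //.
    by apply/allpairsP; exists (W1, W2); split=> //=; rewrite mem_short_words;
      [apply: leq_trans W1m _|apply: leq_trans W2m _]; exact: ltnW.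
  have C1 : 1 <= (L ^+ 4) ^+ m by apply: exprn_ege1; exact: exprn_ege1.
  by rewrite ler_peMr // mulr_ege1.
have [c [c0 cL ev]] := LP W1 W2.
have fam : trace_gap (6 * g - 3) W1 W2 \in short_gaps g (6 * g - 3) m.
  by apply: allpairs_f; rewrite mem_short_words.
have evn : ipoly_eval (6 * g - 3) y (trace_gap (6 * g - 3) W1 W2) != 0.
  by rewrite ev mulf_neq0.
have fn : trace_gap (6 * g - 3) W1 W2 != 0.
  by apply: contra_neq evn => ->; rewrite rmorph0.
have big : 2 ^- (16 * m * (t * m)) / 2 <
    `|ipoly_eval (6 * g - 3) y (trace_gap (6 * g - 3) W1 W2)|.
  rewrite ltNge; apply/negP => small; apply: notsmall.
  by exists m, (trace_gap (6 * g - 3) W1 W2).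
have tq : (2 ^ (16 * m * (t * m)) <= (4 * g - 1) ^ (48 * m ^ 2))%N.
  exact: pow2_trunc_log.
rewrite ge_min; apply/orP; right.
have cL' : `|c| <= (L ^+ 4) ^+ m.
  apply: le_trans cL _; rewrite -exprM ler_weXn2l //.
  by rewrite -[4%N]/(2 * 2)%N -mulnA leq_mul2l /= mul2n -addnn leq_add.
move: big; rewrite ev -/(gap (W1, W2)) normrM => big.
have tq' : 2 ^+ (16 * m * (t * m)) <= ((4 * g - 1) ^ (48 * m ^ 2))%:R :> R.
  by rewrite -natrX ler_nat.
have e0 : 0 < 2 ^+ (16 * m * (t * m)) :> R by rewrite exprn_gt0.
apply: (@le_trans _ _ (2 ^+ (16 * m * (t * m)) * (`|c| * `|gap (W1, W2)|))).
  by rewrite mulrC -ler_pdivrMr // mulrC ltW.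
by rewrite mulrA mulrC ler_wpM2l // ler_pM // exprn_ge0.
Qed.

Lemma powR_absorb (R : realType) (q eta E C : R) :
  1 < q -> 0 < eta -> 48 <= E -> 1 <= C ->
  exists2 K : R, 0 < K & forall m : nat,
    K * q `^ (- ((E + eta) * m%:R ^+ 2)) * (q ^+ (48 * m ^ 2) * C ^+ m) <= 1.
Proof.
move=> q1 eta0 E48 C1; have q0 : 0 < q by exact: lt_trans q1.
have C0 : 0 < C by exact: lt_le_trans C1.
pose h := ln q; pose a := ln C; have h0 : 0 < h by exact: ln_gt0.
have eh0 : 0 < eta * h by exact: mulr_gt0.
(* The inverse of the maximum of [expR (x a - eta h x ^ 2)], reached at [x = a / (2 eta h)]: the
   square is completed below. *)
exists (expR (- (a ^+ 2 / (4 * (eta * h))))); first exact: expR_gt0.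
move=> m; set x : R := m%:R.
have -> : q `^ (- ((E + eta) * x ^+ 2)) = expR (- ((E + eta) * x ^+ 2) * h).
  by rewrite /powR gt_eqF.
have -> : q ^+ (48 * m ^ 2) = expR ((48 * x ^+ 2) * h).
  by rewrite -[q in LHS](lnK q0) -expRM_natl natrM natrX.
have -> : C ^+ m = expR (x * a) by rewrite -[C in LHS](lnK C0) -expRM_natl.
rewrite -!expRD -[leRHS]expR0 ler_expR.
have -> : - (a ^+ 2 / (4 * (eta * h))) + - ((E + eta) * x ^+ 2) * h +
    (48 * x ^+ 2 * h + x * a) =
    - ((E - 48) * (x ^+ 2 * h) + (eta * h) * (x - a / (2 * (eta * h))) ^+ 2).
  by field; rewrite !gt_eqF.
rewrite oppr_le0 addr_ge0 // mulr_ge0 ?sqr_ge0 ?subr_ge0 ?mulr_ge0 ?sqr_ge0 //;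
  exact: ltW.
Qed.

Theorem corollary5p8 (R : realType) (g : nat) (hg : (2 <= g)%N)
    (eta : R) (heta : 0 < eta) :
  almost_all_smooth (@G_set R g) (fun A =>
    defines_closed_surface A ->
    exists K : R, 0 < K /\
      forall W1 W2 : word g, admissible_word W1 -> admissible_word W2 ->
      forall l1 l2 : R,
        is_geodesic_length A W1 l1 -> is_geodesic_length A W2 l2 ->
        l1 = l2 \/
        K * (4 * g%:R - 1) `^
              (- (((2 * g%:R + 4) * (4 * g%:R - 2) + eta) *
                  (maxn (size W1) (size W2))%:R ^+ 2))
          <= `|l1 - l2|).
Proof.
move=> d U phi pphi; apply: cube_null_lebesgue.
have g0 : (0 < g)%N by exact: leq_trans hg.
pose bad := often_small (R := R) (trunc_log 2 ((4 * g - 1) ^ 3)) (@short_gaps g (6 * g - 3)).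
have bad0 : cube_null bad.
  apply: (@often_small_null _ _ _ _ _ 162 343) => // [m f|m].
    exact: deg_short_gaps.
  exact: size_short_gaps.
(* The shear that makes a tuple generic varies with the tuple, hence the union over [k]. *)
apply: (@cube_nullS _ _ (\bigcup_(k : nat)
    [set u | [/\ U u, shear_generic k (phi u) & bad (chart_coord k (phi u))]]));
  last by apply: cube_null_countable => k; exact: chart_null pphi bad0.
move=> u [Uu notP]; apply: contrapT => notB; apply: notP; set A := phi u => surf.
have GA : G_set A.
  have [W _ eW] := param_homeo pphi (param_open pphi) (@subset_refl _ U).
  have : (phi @` U) (phi u) by exists u.
  by rewrite eW => -[_ []].
have [k good] := surface_shear_generic hg GA surf.
have [|K0 [C [K00 C1 gapP]]] := trace_sq_gap hg GA good.
  by move=> small; apply: notB; exists k.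
have [B B1 trB] := trace_word_bound A.
have g2 : 2 <= g%:R :> R by rewrite ler_nat.
have q1 : 1 < 4 * g%:R - 1 :> R by lra.
(* An equality for [g = 2]. *)
have E48 : 48 <= (2 * g%:R + 4) * (4 * g%:R - 2) :> R by nra.
have [K1 K10 K1P] := powR_absorb q1 heta E48 (mulr_ege1 C1 B1).
(* The 4 comes from [expR l <= 4 * B ^ m]; [K1] absorbs both [C ^ m], from the scalars of the
   parametrization, and [B ^ m], from the size of the traces. *)
exists (K0 / 4 * K1); split; first by rewrite mulr_gt0 // divr_gt0.
move=> W1 W2 _ _ l1 l2 gl1 gl2.
have [l10 tr1] := geodesic_length_trace GA surf gl1.
have [l20 tr2] := geodesic_length_trace GA surf gl2.
have [tr12|tr12] := eqVneq (\tr (eval_word A W1) ^+ 2) (\tr (eval_word A W2) ^+ 2).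
  by left; apply: trace_length_inj => //; apply: (addIr 2); rewrite -tr1 -tr2.
right; have := gapP W1 W2 tr12; move: (K1P (maxn (size W1) (size W2))).
have expl l W : 0 < l -> \tr (eval_word A W) ^+ 2 = expR l + (expR l)^-1 + 2 ->
    (size W <= maxn (size W1) (size W2))%N ->
    expR l <= 4 * B ^+ maxn (size W1) (size W2).
  move=> l0 trW Wm; apply: (@le_trans _ _ (4 * B ^+ size W)).
    apply: le_trans (trB W); rewrite trW -addrA lerDl.
    by rewrite addr_ge0 // invr_ge0 ltW // expR_gt0.
  by rewrite ler_wpM2l // ler_weXn2l.
have := trace_length_lipschitz l10 l20 (expl _ _ l10 tr1 (leq_maxl _ _))
                                       (expl _ _ l20 tr2 (leq_maxr _ _)).
have -> : expR l1 + (expR l1)^-1 - (expR l2 + (expR l2)^-1) =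
    \tr (eval_word A W1) ^+ 2 - \tr (eval_word A W2) ^+ 2.
  by rewrite tr1 tr2; ring.
move: (maxn _ _) => m {expl}.
have -> : ((4 * g - 1) ^ (48 * m ^ 2))%:R = (4 * g%:R - 1) ^+ (48 * m ^ 2) :> R.
  by rewrite natrX natrB ?natrM // muln_gt0.
rewrite exprMn; set P := _ `^ _; set X := _ ^+ (48 * m ^ 2).
have P0 : 0 <= P by exact: powR_ge0.
have X0 : 0 <= X by rewrite exprn_ge0 // ltW // (lt_trans ltr01).
have Cm0 : 0 <= C ^+ m by rewrite exprn_ge0 // (le_trans ler01).
move: (C ^+ m) (B ^+ m) (`|\tr _ ^+ 2 - _|) Cm0 => Cm Bm G Cm0 Glip KP1 K0G.
have d0 := normr_ge0 (l1 - l2); move: (`|l1 - l2|) d0 Glip => D D0 Glip.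
have KP0 : 0 <= K1 * P by rewrite mulr_ge0 // ltW.
apply: (@le_trans _ _ (D * (K1 * P * (X * (Cm * Bm))))); last by rewrite ler_piMr.
have XC0 : 0 <= X * Cm by exact: mulr_ge0.
apply: (@le_trans _ _ ((D * (4 * Bm)) * (X * Cm) / 4 * (K1 * P))); last first.
  by rewrite le_eqVlt; apply/orP; left; apply/eqP; field.
rewrite -mulrA; apply: ler_wpM2r => //; apply: ler_wpM2r; first by rewrite invr_ge0.
by apply: le_trans K0G _; apply: ler_wpM2r.
Qed.
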